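(* Let $F$ be a field with a Henselian valuation $v$ (with arbitrary residue characteristic), and let $(V,q)$ be an even-dimensional nondegenerate quadratic space over $F$. The following conditions are equivalent: (a) $q$ becomes hyperbolic over some tame extension of $F$; (b) there exists a tame norm $\alpha$ on $V$ compatible with $q$.
   Context: $v\colon F\to\Gamma\cup\{\infty\}$ is a Krull valuation, where $\Gamma$ is a divisible totally ordered abelian group; $\Gamma_F=v(F^\times)$ and $\overline{F}$ is the residue field. For an even-dimensional quadratic form $q$, nondegenerate means that the polar form $b(x,y)=q(x+y)-q(x)-q(y)$ is nondegenerate. An algebraic extension $K/F$ of the Henselian field $F$ is tame if for every finite subextension $L/F$ (with the unique extension of $v$) the residue extension $\overline{L}/\overline{F}$ is separable, the ramification index $(\Gamma_L:\Gamma_F)$ is not divisible by $\operatorname{char}\overline{F}$, and $[L:F]=[\overline{L}:\overline{F}]\,(\Gamma_L:\Gamma_F)$. A $v$-value function on a finite-dimensional $F$-vector space $V$ is a map $\alpha\colon V\to\Gamma\cup\{\infty\}$ with $\alpha(x)=\infty$ iff $x=0$, $\alpha(x\lambda)=\alpha(x)+v(\lambda)$ and $\alpha(x+y)\ge\min(\alpha(x),\alpha(y))$ for $x,y\in V$, $\lambda\in F$. It is a $v$-norm if there is a base $(e_i)_{i=1}^n$ of $V$ with $\alpha(\sum e_i\lambda_i)=\min_i\alpha(e_i\lambda_i)$ for all $\lambda_i\in F$. Put $V^{\ge\gamma}=\{x\mid\alpha(x)\ge\gamma\}$, $V^{>\gamma}=\{x\mid\alpha(x)>\gamma\}$, $V_\gamma=V^{\ge\gamma}/V^{>\gamma}$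 and $\operatorname{\mathsf{gr}}_\alpha(V)=\bigoplus_{\gamma\in\Gamma}V_\gamma$; similarly $\operatorname{\mathsf{gr}}(F)=\bigoplus_\gamma F_\gamma$ is the graded ring of the filtration of $F$ defined by $v$; its nonzero homogeneous elements are invertible, and $\operatorname{\mathsf{gr}}_\alpha(V)$ is a graded (free) $\operatorname{\mathsf{gr}}(F)$-module. For $x\ne0$, $\tilde x=x+V^{>\alpha(x)}\in V_{\alpha(x)}$. Write $\alpha\prec q$ if $v(b(x,y))\ge\alpha(x)+\alpha(y)$ and $v(q(x))\ge2\alpha(x)$ for all $x,y\in V$. In that case $q$ and $b$ induce maps $\tilde q_\alpha\colon V_\gamma\to F_{2\gamma}$, $\tilde b_\alpha\colon V_\gamma\times V_\delta\to F_{\gamma+\delta}$ by $\tilde q_\alpha(\tilde x)=q(x)+F^{>2\gamma}$, $\tilde b_\alpha(\tilde x,\tilde y)=b(x,y)+F^{>\gamma+\delta}$ for $\alpha(x)=\gamma$, $\alpha(y)=\delta$; extending $\tilde b_\alpha$ bilinearly and setting $\tilde q_\alpha(\sum_\gamma\tilde x_\gamma)=\sum_\gamma\tilde q_\alpha(\tilde x_\gamma)+\sum_{\gamma<\delta}\tilde b_\alpha(\tilde x_\gamma,\tilde x_\delta)$ for $\tilde x_\gamma\in V_\gamma$ yields a graded quadratic form $\tilde q_\alpha\colon\operatorname{\mathsf{gr}}_\alpha(V)\to\operatorname{\mathsf{gr}}(F)$ with polar form $\tilde b_\alpha$. A $v$-norm $\alpha$ on $V$ is a tame norm compatible with $q$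 if $\alpha\prec q$ and $\tilde q_\alpha$ is nonsingular, i.e., $\tilde b_\alpha$ is nondegenerate (only $0$ is orthogonal to all of $\operatorname{\mathsf{gr}}_\alpha(V)$). *)

(* Defs.v *)
From HB Require Import structures.
From mathcomp Require Import all_boot all_order all_algebra all_field.
From mathcomp Require Import boolp classical_sets cardinality fsbigop.

Set Implicit Arguments.
Unset Strict Implicit.
Unset Printing Implicit Defensive.

Import Order.TTheory GRing.Theory.

Local Open Scope ring_scope.

(* Totality is an axiom here rather than a parent Order.Total: a structure below
   both would need a join that Num.RealDomain does not inherit from. *)
HB.mixin Record isOrderedGroup G & Num.POrderedZmodule G := {
  og_total : total (<=%R : rel G);
  og_leD2l : forall z x y : G, x <= y -> z + x <= z + y
}.

#[short(type="orderedGroupType")]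
HB.structure Definition OrderedGroup :=
  { G of Num.POrderedZmodule G & isOrderedGroup G }.

HB.instance Definition _ (G : orderedGroupType) :=
  Order.POrder_isTotal.Build ring_display (OrderedGroup.sort G) og_total.

Definition divisible (G : zmodType) :=
  forall (n : nat) (x : G), (0 < n)%N -> exists y : G, y *+ n = x.

Section OrderedGroupTheory.
Variable G : orderedGroupType.
Implicit Types x y z : G.

Lemma oleD2l z x y : (z + x <= z + y) = (x <= y).
Proof.
apply/idP/idP; last exact: og_leD2l.
by move=> /(og_leD2l (- z)); rewrite !addKr.
Qed.

Lemma oltD2l z x y : (z + x < z + y) = (x < y).
Proof. by rewrite !lt_neqAle oleD2l (inj_eq (addrI z)). Qed.

Lemma addrr_eq0 x : x + x = 0 -> x = 0.
Proof.
move=> xx; case: (ltgtP x 0) => // x0.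
  have := oltD2l x x 0; rewrite xx addr0 x0 => /idP h.
  by have := lt_trans h x0; rewrite ltxx.
have := oltD2l x 0 x; rewrite xx addr0 x0 => /idP h.
by have := lt_trans x0 h; rewrite ltxx.
Qed.

End OrderedGroupTheory.

(* The set G together with a largest, absorbing element. *)
Definition with_infty (G : orderedGroupType) : Type := option G.

Definition Fin (G : orderedGroupType) (x : G) : with_infty G := Some x.
Definition infty {G : orderedGroupType} : with_infty G := None.

Section Ext.
Variable G : orderedGroupType.
Implicit Types x y z : with_infty G.

HB.instance Definition _ := Choice.on (with_infty G).

Definition ext_le x y : bool :=
  match x, y with
  | _, None => true
  | None, Some _ => false
  | Some a, Some b => a <= b
  end.

Definition ext_add x y : with_infty G :=
  match x, y with
  | Some a, Some b => Fin (a + b)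
  | _, _ => infty
  end.

Fact ext_le_refl : reflexive ext_le.
Proof. by case=> /=. Qed.

Fact ext_le_anti : antisymmetric ext_le.
Proof. by case=> [x|] [y|] //= /le_anti ->. Qed.

Fact ext_le_trans : transitive ext_le.
Proof. by case=> [x|] [y|] [z|] //=; apply: le_trans. Qed.

HB.instance Definition _ := Order.Le_isPOrder.Build ring_display (with_infty G)
  ext_le_refl ext_le_anti ext_le_trans.

Fact ext_le_total : total (<=%O : rel (with_infty G)).
Proof. by case=> [x|] [y|] //=; apply: le_total. Qed.

HB.instance Definition _ := Order.POrder_isTotal.Build ring_display (with_infty G)
  ext_le_total.

Fact ext_addA : associative ext_add.
Proof. by case=> [x|] [y|] [z|] //=; rewrite addrA. Qed.

Fact ext_addC : commutative ext_add.
Proof. by case=> [x|] [y|] //=; rewrite addrC. Qed.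

Fact ext_add0 : left_id (Fin 0) ext_add.
Proof. by case=> [x|] //=; rewrite add0r. Qed.

HB.instance Definition _ := GRing.isNmodule.Build (with_infty G)
  ext_addA ext_addC ext_add0.

Lemma lee_infty x : x <= infty.
Proof. by case: x. Qed.

Lemma FinD (a b : G) : Fin (a + b) = Fin a + Fin b.
Proof. by []. Qed.

Lemma lee_Fin (a b : G) : (Fin a <= Fin b) = (a <= b).
Proof. by []. Qed.

Lemma lte_Fin (a b : G) : (Fin a < Fin b) = (a < b).
Proof. by rewrite !lt_neqAle lee_Fin. Qed.

Lemma leeD x x' y y' : x <= y -> x' <= y' -> x + x' <= y + y'.
Proof.
move: x x' y y' => [x|] [x'|] [y|] [y'|] //= h h'.
change (x + x' <= y + y'); apply: (@le_trans _ _ (x + y')).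
  by rewrite oleD2l.
by rewrite ![_ + y']addrC oleD2l.
Qed.

Lemma lteD_Fin (a b : G) x y : Fin a <= x -> Fin b < y -> Fin (a + b) < x + y.
Proof.
case: x => [x|]; case: y => [y|] //.
rewrite -[Some y]/(Fin y) -[Some x]/(Fin x) -FinD !lte_Fin lee_Fin => ax bb.
apply: (@le_lt_trans _ _ (x + b)); last by rewrite oltD2l.
by rewrite ![_ + b]addrC oleD2l.
Qed.

End Ext.

Record valuation (F : fieldType) (G : orderedGroupType) := Valuation {
  valuation_fun :> F -> with_infty G;
  valuation_eq_infty : forall x, valuation_fun x = infty <-> x = 0;
  valuationM : forall x y, valuation_fun (x * y) = valuation_fun x + valuation_fun y;
  valuationD : forall x y, Num.min (valuation_fun x) (valuation_fun y) <= valuation_fun (x + y)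
}.

Record value_function (F : fieldType) (G : orderedGroupType)
    (v : valuation F G) (V : lmodType F) := ValueFunction {
  vf_fun :> V -> with_infty G;
  vf_eq_infty : forall x, vf_fun x = infty <-> x = 0;
  vfZ : forall a x, vf_fun (a *: x) = vf_fun x + v a;
  vfD : forall x y, Num.min (vf_fun x) (vf_fun y) <= vf_fun (x + y)
}.

Section ValuationTheory.
Variables (F : fieldType) (G : orderedGroupType) (v : valuation F G).

Lemma valuation1 : v 1 = 0.
Proof.
have := valuationM v 1 1; rewrite mulr1.
case E: (v 1) => [a|]; last first.
  by have /valuation_eq_infty/eqP := E; rewrite oner_eq0.
by move=> -[] /(congr1 (fun x => x - a)); rewrite addrK subrr => <-.
Qed.

Lemma valuationN1 : v (-1) = 0.
Proof.
have := valuationM v (-1) (-1); rewrite mulrNN mulr1 valuation1.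
by case: (v (-1)) => [a|] // -[] /esym /addrr_eq0 ->.
Qed.

Lemma valuation0 : v 0 = infty.
Proof. exact/valuation_eq_infty. Qed.

Lemma valuationN x : v (- x) = v x.
Proof. by rewrite -mulN1r valuationM valuationN1 add0r. Qed.

Lemma vfN (V : lmodType F) (alpha : value_function v V) x :
  alpha (- x) = alpha x.
Proof. by rewrite -scaleN1r vfZ valuationN1 addr0. Qed.

Lemma valuationV x : x != 0 -> v x + v x^-1 = 0.
Proof. by move=> x0; rewrite -valuationM mulfV // valuation1. Qed.

End ValuationTheory.

(* Valuations and value functions both give filtrations; the graded pieces are
   built once, for filtrations. *)
Record filtration (M : zmodType) (G : orderedGroupType) := Filtration {
  filt_fun :> M -> with_infty G;
  filt0 : filt_fun 0 = infty;
  filtB : forall x y, Num.min (filt_fun x) (filt_fun y) <= filt_fun (x - y)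
}.

Section Filtrations.
Variables (F : fieldType) (G : orderedGroupType) (v : valuation F G).

Fact valuation_filtB x y : Num.min (v x) (v y) <= v (x - y).
Proof. by rewrite -(valuationN v y) valuationD. Qed.

Definition valuation_filtration : filtration F G :=
  Filtration (valuation0 v) valuation_filtB.

Variables (V : lmodType F) (alpha : value_function v V).

Fact vf_filt0 : alpha 0 = infty.
Proof. exact/vf_eq_infty. Qed.

Fact vf_filtB x y : Num.min (alpha x) (alpha y) <= alpha (x - y).
Proof. by rewrite -(vfN alpha y) vfD. Qed.

Definition vf_filtration : filtration V G := Filtration vf_filt0 vf_filtB.

End Filtrations.

Coercion valuation_filtration : valuation >-> filtration.
Coercion vf_filtration : value_function >-> filtration.

Section GradedPieces.
Variables (M : zmodType) (G : orderedGroupType) (f : filtration M G) (g : G).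

Definition filt_ge_pred : {pred M} := fun x => Fin g <= f x.

Fact filt_ge_closed : zmod_closed filt_ge_pred.
Proof.
split=> [|x y]; rewrite ?unfold_in ?filt0 ?lee_infty // => gx gy.
by apply: le_trans (filtB f x y); rewrite le_min gx gy.
Qed.

HB.instance Definition _ := GRing.isZmodClosed.Build M filt_ge_pred
  filt_ge_closed.

Record filt_ge := FiltGe { filt_ge_val : M; _ : filt_ge_val \in filt_ge_pred }.

HB.instance Definition _ := [isSub for filt_ge_val].
HB.instance Definition _ := [Choice of filt_ge by <:].
HB.instance Definition _ := [SubChoice_isSubZmodule of filt_ge by <:].

Definition filt_gt_pred : {pred filt_ge} := fun x => Fin g < f (val x).

Fact filt_gt_closed : zmod_closed filt_gt_pred.
Proof.
split=> [|x y]; rewrite ?unfold_in ?raddf0 ?filt0 // => gx gy.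
by rewrite raddfB; apply: lt_le_trans (filtB f _ _); rewrite lt_min gx gy.
Qed.

HB.instance Definition _ := GRing.isZmodClosed.Build filt_ge filt_gt_pred
  filt_gt_closed.

Definition gr_piece := Quotient.quot filt_gt_pred.

HB.instance Definition _ := GRing.Zmodule.on gr_piece.
HB.instance Definition _ := EqQuotient.on gr_piece.

(* The class of x in the piece of degree g, meaningful when g <= f x. *)
Definition gr_class (x : M) : gr_piece := \pi_gr_piece%qT (insubd 0 x).

Definition gr_repr (c : gr_piece) : M := val (repr c).

End GradedPieces.

Section GradedPiecesTheory.
Variables (M : zmodType) (G : orderedGroupType) (f : filtration M G) (g : G).

Lemma gr_repr_ge (c : gr_piece f g) : Fin g <= f (gr_repr c).
Proof. exact: (valP (repr c)). Qed.

Lemma gr_reprK (c : gr_piece f g) : gr_class f g (gr_repr c) = c.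
Proof. by rewrite /gr_class /gr_repr valKd reprK. Qed.

Lemma gr_classE (x y : M) : Fin g <= f x -> Fin g <= f y ->
  (gr_class f g x == gr_class f g y) = (Fin g < f (x - y)).
Proof.
move=> gx gy; rewrite /gr_class -Quotient.idealrBE !unfold_in raddfB /=.
by rewrite !insubdK.
Qed.

Lemma gr_class_eq0 (x : M) : Fin g <= f x ->
  (gr_class f g x == 0) = (Fin g < f x).
Proof.
move=> gx; have -> : (0 : gr_piece f g) = gr_class f g 0.
  rewrite /gr_class; set u := insubd _ _; have -> : u = 0.
    by apply: val_inj; rewrite val_insubd; case: ifP.
  by rewrite piE.
by rewrite gr_classE ?subr0 // filt0 lee_infty.
Qed.

Lemma gr_repr_class (x : M) : Fin g <= f x ->
  Fin g < f (gr_repr (gr_class f g x) - x).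
Proof. by move=> gx; rewrite -gr_classE ?gr_repr_ge // gr_reprK. Qed.

End GradedPiecesTheory.

Section DirectSum.
Variables (I : choiceType) (A : I -> zmodType).

Local Open Scope classical_set_scope.

Record dsum := DSum {
  ds_fun :> forall i, A i;
  ds_finite : finite_set [set i | ds_fun i != 0]
}.

Definition ds_supp (u : dsum) : set I := [set i | u i != 0].

Lemma dsumP (u w : dsum) : (forall i, u i = w i) -> u = w.
Proof.
case: u w => [u Pu] [w Pw] /= uw.
have E : u = w by apply: functional_extensionality_dep.
by case: _ / E Pw => Pw; congr DSum; apply: Prop_irrelevance.
Qed.

HB.instance Definition _ := gen_eqMixin dsum.
HB.instance Definition _ := gen_choiceMixin dsum.

Fact ds_zero_subproof : finite_set [set i | (0 : A i) != 0].
Proof.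
by rewrite [X in finite_set X](_ : _ = set0) // -subset0 => i /=; rewrite eqxx.
Qed.

Fact ds_opp_subproof (u : dsum) : finite_set [set i | - u i != 0].
Proof.
by apply: sub_finite_set (ds_finite u) => i /=; rewrite oppr_eq0.
Qed.

Fact ds_add_subproof (u w : dsum) : finite_set [set i | u i + w i != 0].
Proof.
apply: (@sub_finite_set _ _ (ds_supp u `|` ds_supp w)).
  move=> i /= uw; have [ui0|] := eqVneq (u i) 0; last by left.
  by right; move: uw; rewrite ui0 add0r.
by rewrite finite_setU; split; apply: ds_finite.
Qed.

Definition ds_zero := DSum ds_zero_subproof.
Definition ds_opp u := DSum (ds_opp_subproof u).
Definition ds_add u w := DSum (ds_add_subproof u w).

Fact ds_addA : associative ds_add.
Proof. by move=> u w z; apply: dsumP => i /=; rewrite addrA. Qed.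

Fact ds_addC : commutative ds_add.
Proof. by move=> u w; apply: dsumP => i /=; rewrite addrC. Qed.

Fact ds_add0 : left_id ds_zero ds_add.
Proof. by move=> u; apply: dsumP => i /=; rewrite add0r. Qed.

Fact ds_addN : left_inverse ds_zero ds_opp ds_add.
Proof. by move=> u; apply: dsumP => i /=; rewrite addNr. Qed.

HB.instance Definition _ := GRing.isZmodule.Build dsum
  ds_addA ds_addC ds_add0 ds_addN.

Fact ds_homog_subproof i (x : A i) :
  finite_set [set j | dfwith (fun k => 0 : A k) x j != 0].
Proof.
apply: (@sub_finite_set _ _ [set i]); last exact: finite_set1.
by move=> j /= /eqP h; apply: contrapT => /eqP ji; apply: h;
  rewrite dfwith_out // eq_sym.
Qed.

Definition ds_homog i (x : A i) : dsum := DSum (ds_homog_subproof x).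

End DirectSum.

Definition gr (M : zmodType) (G : orderedGroupType) (f : filtration M G) :=
  dsum (gr_piece f).

HB.instance Definition _ M G f := GRing.Zmodule.on (@gr M G f).

Section ResidueField.
Variables (F : fieldType) (G : orderedGroupType) (v : valuation F G).

Definition val_ring_pred : {pred F} := fun x => Fin 0 <= v x.

Fact val_ring_closed : subring_closed val_ring_pred.
Proof.
split=> [|x y|x y]; rewrite ?unfold_in ?valuation1 // => x0 y0.
  by apply: le_trans (valuation_filtB v x y); rewrite le_min x0 y0.
by rewrite valuationM -[leLHS]add0r leeD.
Qed.

HB.instance Definition _ := GRing.isSubringClosed.Build F val_ring_pred
  val_ring_closed.

Record val_ring :=
  ValRing { val_ring_val : F; _ : val_ring_val \in val_ring_pred }.

HB.instance Definition _ := [isSub for val_ring_val].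
HB.instance Definition _ := [Choice of val_ring by <:].
HB.instance Definition _ := [SubChoice_isSubComNzRing of val_ring by <:].

Definition max_ideal_pred : {pred val_ring} := fun x => Fin 0 < v (val x).

Fact max_ideal_closed : idealr_closed max_ideal_pred.
Proof.
split=> [||a x y]; rewrite ?unfold_in ?raddf0 ?valuation0 ?rmorph1 ?valuation1
  ?ltxx // => x0 y0.
rewrite [val _](_ : _ = val a * val x + val y) //.
have ax : Fin 0 < v (val a * val x).
  by rewrite valuationM; have := lteD_Fin (valP a : Fin 0 <= v (val a)) x0;
    rewrite addr0.
by apply: lt_le_trans (valuationD v _ _); rewrite lt_min ax y0.
Qed.

HB.instance Definition _ := isIdealr.Build val_ring max_ideal_pred
  max_ideal_closed.

Definition residue_field := Quotient.quot max_ideal_pred.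

HB.instance Definition _ := GRing.ComNzRing.on residue_field.
HB.instance Definition _ := EqQuotient.on residue_field.

(* The residue class of x, meaningful when v x is non-negative. *)
Definition residue (x : F) : residue_field := \pi_residue_field%qT (insubd 0 x).

Definition residue_inv (c : residue_field) : residue_field :=
  if c == 0 then 0 else residue (val (repr c))^-1.

Fact residue_mulVf c : c != 0 -> residue_inv c * c = 1.
Proof.
move=> c0; rewrite /residue_inv (negPf c0).
have u0 : v (val (repr c)) = Fin 0.
  apply/eqP; rewrite eq_le [X in _ && X](valP (repr c)) andbT leNgt.
  apply: contra c0 => h; rewrite -[c]reprK.
  have -> : (0 : residue_field) = \pi_residue_field%qT 0 by rewrite piE.
  by rewrite -Quotient.idealrBE unfold_in subr0.
have x0 : val (repr c) != 0.
  by apply/eqP => x0; move: u0; rewrite x0 valuation0.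
have w0 : v (val (repr c))^-1 = Fin 0.
  by have := valuationV v x0; rewrite u0; case: (v _^-1) => // a; rewrite add0r.
rewrite -[X in _ * X]reprK; apply/eqP.
have -> : (1 : residue_field) = \pi_residue_field%qT 1 by rewrite piE.
rewrite /residue -(rmorphM \pi_residue_field%qT).
set a := insubd _ _; suff -> : a * repr c = 1 by [].
apply: val_inj; rewrite [val _](_ : _ = val a * val (repr c)) //.
by rewrite insubdK ?mulVf // -[_ \in _]/(Fin 0 <= v _) w0.
Qed.

Fact residue_inv0 : residue_inv 0 = 0.
Proof. by rewrite /residue_inv eqxx. Qed.

HB.instance Definition _ := GRing.ComNzRing_isField.Build residue_field
  residue_mulVf residue_inv0.

End ResidueField.

Section Extensions.
Variable G : orderedGroupType.

Definition extends (F K : fieldType) (iota : F -> K)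
    (v : valuation F G) (w : valuation K G) :=
  forall a, w (iota a) = v a.

Definition algebraic_extension (F K : fieldType) (iota : {rmorphism F -> K}) :=
  forall z : K, algebraicOver iota z.

(* As G is divisible in all uses below, it contains the values of every
   extension of v to an algebraic extension. *)
Definition henselian (F : fieldType) (v : valuation F G) :=
  forall (K : fieldType) (iota : {rmorphism F -> K}),
    algebraic_extension iota ->
    exists2 w : valuation K G, extends iota v w
      & forall w' : valuation K G, extends iota v w' -> w' =1 w.

Definition value_group (F : fieldType) (v : valuation F G) : set G :=
  [set g | exists x, v x = Fin g]%classic.

(* (A : B) = e, for subgroups B of A *)
Definition has_index (A B : set G) (e : nat) :=
  exists2 r : 'I_e -> G, forall i, A (r i)
    & forall g, A g -> exists! i, B (g - r i).

(* E presents the residue field of w as a finite extension of that of v. *)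
Definition tame_finite (F : fieldType) (v : valuation F G)
    (L : fieldExtType F) (w : valuation L G) :=
  exists (E : fieldExtType (residue_field v))
         (phi : {rmorphism E -> residue_field w}) (e : nat),
    [/\ bijective phi
          /\ (forall a, Fin 0 <= v a -> phi (residue v a)%:A = residue w a%:A),
        separable 1 {:E},
        has_index (value_group w) (value_group v) e,
        forall p, p \in [pchar residue_field v] -> ~~ (p %| e)%N
      & \dim {:L} = (\dim {:E} * e)%N].

(* The finite subextensions are the finite extensions L with an F-embedding
   into K. *)
Definition tame_extension (F : fieldType) (v : valuation F G)
    (K : fieldType) (iota : {rmorphism F -> K}) :=
  algebraic_extension iota /\
  forall (L : fieldExtType F) (j : {rmorphism L -> K}),
    (forall a, j a%:A = iota a) ->
    exists2 w : valuation L G, extends (GRing.in_alg L) v w & tame_finite v w.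

End Extensions.

Definition polar (U N : zmodType) (q : U -> N) (x y : U) : N :=
  q (x + y) - q x - q y.

Definition nondegenerate_pairing (U N : zmodType) (b : U -> U -> N) :=
  forall x, (forall y, b x y = 0) -> x = 0.

Definition quadratic_form (F : fieldType) (V : lmodType F) (q : V -> F) :=
  [/\ forall a x, q (a *: x) = a ^+ 2 * q x,
      forall y, scalar (polar q ^~ y)
    & forall x, scalar (polar q x)].

(* q is isometric to an orthogonal sum of m hyperbolic planes. *)
Definition hyperbolic (K : fieldType) (W : lmodType K) (q : W -> K) :=
  exists (m : nat) (f : {linear ('rV[K]_m * 'rV[K]_m)%type -> W}),
    bijective f /\ forall x y, q (f (x, y)) = \sum_(i < m) x 0 i * y 0 i.

Section BaseChange.
Variables (F K : fieldType) (iota : {rmorphism F -> K}) (V : vectType F).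
Variable q : V -> F.

Let e := vbasis {:V}.

(* The form on V (x) K, in the coordinates given by the basis e (x) 1. *)
Definition base_change (x : 'rV[K]_(\dim {:V})) : K :=
  let n := \dim {:V} in
  \sum_(i < n) iota (q e`_i) * x 0 i ^+ 2
  + \sum_(i < n) \sum_(j < n | (i < j)%N)
      iota (polar q e`_i e`_j) * x 0 i * x 0 j.

Hypothesis hq : quadratic_form q.

Lemma qform_sum (u : nat -> V) n :
  q (\sum_(i < n) u i) = \sum_(i < n) q (u i)
    + \sum_(i < n) \sum_(j < n | (i < j)%N) polar q (u i) (u j).
Proof.
have [qZ bl br] := hq.
have q0 : q 0 = 0 by rewrite -(scale0r 0) qZ expr0n mul0r.
have bD y : {morph polar q ^~ y : x z / x + z}.
  by move=> x z; have := bl y 1 x z; rewrite scale1r mul1r.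
have b0 y : polar q 0 y = 0 by rewrite /polar add0r q0 subr0 subrr.
elim: n => [|n IH]; first by rewrite !big_ord0 q0 addr0.
rewrite !big_ord_recr /= [X in _ = _ + (_ + X)]big1 => [|j]; last first.
  by rewrite ltnNge -ltnS ltn_ord.
rewrite addr0.
have -> (s t : V) : q (s + t) = q s + q t + polar q s t.
  by rewrite /polar -[X in _ = _ + X]addrA -opprD [RHS]addrC subrK.
rewrite IH (big_morph (polar q ^~ (u n)) (bD _) (b0 _)).
under [X in _ = _ + X]eq_bigr => i _ do
  rewrite big_mkcond big_ord_recr /= ltn_ord -big_mkcond.
by rewrite [X in _ = _ + X]big_split /= [RHS]addrACA [RHS]addrA.
Qed.

Lemma base_changeE (x : V) :
  base_change (\row_i iota (coord e i x)) = iota (q x).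
Proof.
have [qZ bl br] := hq.
have bZl a y z : polar q (a *: y) z = a * polar q y z.
  have p0 : polar q 0 z = 0.
    by rewrite /polar add0r -(scale0r 0) qZ expr0n mul0r subr0 subrr.
  by have := bl z a y 0; rewrite addr0 p0 addr0.
have bZr a y z : polar q y (a *: z) = a * polar q y z.
  have p0 : polar q y 0 = 0.
    by rewrite /polar addr0 -(scale0r 0) qZ expr0n mul0r subr0 subrr.
  by have := br y a z 0; rewrite addr0 p0 addr0.
pose u k := if insub k is Some i then coord e i x *: e`_i else 0.
have uE (i : 'I_(\dim {:V})) : u i = coord e i x *: e`_i by rewrite /u valK.
have xE : x = \sum_(i < \dim {:V}) u i.
  rewrite {1}(coord_vbasis (memvf x)).
  by apply: eq_bigr => i _; rewrite uE.
rewrite {2}xE qform_sum rmorphD !rmorph_sum /base_change; congr (_ + _).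
  by apply: eq_bigr => i _; rewrite mxE uE qZ rmorphM rmorphXn mulrC.
apply: eq_bigr => i _; rewrite rmorph_sum; apply: eq_bigr => j _.
rewrite !mxE !uE bZl bZr !rmorphM -!mulrA mulrC -!mulrA.
by congr (_ * _).
Qed.

End BaseChange.

Section GradedForm.
Variables (F : fieldType) (G : orderedGroupType) (v : valuation F G).
Variables (V : vectType F) (q : V -> F) (alpha : value_function v V).

Definition v_norm :=
  exists2 e : (\dim {:V}).-tuple V, basis_of {:V} e
    & forall c : 'I_(\dim {:V}) -> F,
        alpha (\sum_(i < \dim {:V}) c i *: e`_i)
        = \big[Num.min/infty]_(i < \dim {:V}) alpha (c i *: e`_i).

Definition norm_prec :=
  (forall x y, alpha x + alpha y <= v (polar q x y))
  /\ (forall x, alpha x *+ 2 <= v (q x)).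

(* For norm_prec alpha this does not depend on the representatives: see
   gr_polar_homogE. *)
Definition gr_polar_homog (g d : G) (x : gr_piece alpha g)
    (y : gr_piece alpha d) : gr_piece v (g + d) :=
  gr_class v (g + d) (polar q (gr_repr x) (gr_repr y)).

(* The bilinear extension of the maps gr_polar_homog to all of gr alpha. *)
Definition gr_polar (x y : gr alpha) : gr v :=
  \sum_(g \in ds_supp x) \sum_(d \in ds_supp y)
    ds_homog (gr_polar_homog (x g) (y d)).

Definition tame_compatible_norm :=
  [/\ v_norm, norm_prec & nondegenerate_pairing gr_polar].

Lemma gr_polar_homogE (g d : G) (x y : V) : quadratic_form q -> norm_prec ->
  Fin g <= alpha x -> Fin d <= alpha y ->
  gr_polar_homog (gr_class alpha g x) (gr_class alpha d y)
  = gr_class v (g + d) (polar q x y).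
Proof.
move=> [_ bl br] [bge _] gx dy.
have bBl x1 x2 y' : polar q (x1 - x2) y' = polar q x1 y' - polar q x2 y'.
  have := bl y' (-1) x2 x1; rewrite scaleN1r mulN1r => h.
  by rewrite addrC h addrC.
have bBr x' y1 y2 : polar q x' (y1 - y2) = polar q x' y1 - polar q x' y2.
  have := br x' (-1) y2 y1; rewrite scaleN1r mulN1r => h.
  by rewrite addrC h addrC.
have b_ge s t : Fin g <= alpha s -> Fin d <= alpha t ->
    Fin (g + d) <= v (polar q s t).
  by move=> gs dt; apply: le_trans (bge s t); rewrite FinD leeD.
apply/eqP; rewrite gr_classE ?b_ge ?gr_repr_ge //.
set x' := gr_repr _; set y' := gr_repr _.
have -> : polar q x' y' - polar q x y
    = polar q x' (y' - y) - polar q (x - x') y.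
  by rewrite bBr bBl opprB addrA subrK.
apply: lt_le_trans (valuation_filtB v _ _); rewrite lt_min; apply/andP; split.
  apply: lt_le_trans (bge _ _); apply: lteD_Fin; first exact: gr_repr_ge.
  exact: gr_repr_class.
apply: lt_le_trans (bge _ _); rewrite [g + d]addrC [alpha _ + _]addrC.
apply: lteD_Fin => //; rewrite -(vfN alpha) opprB.
exact: gr_repr_class.
Qed.

End GradedForm.

(* Main.v *)
(* A tame norm amounts to a basis [e] with values [gam] such that the Gram matrix
   of [q] and its inverse satisfy the bounds of [tame_family]; in this form
   tameness is visibly preserved by every valued extension.

   (a) => (b).  Take a maximal tame family over [F] and let [V2] be its
   orthogonal.  If the residue characteristic is not 2, any anisotropic line of
   [V2] would enlarge the family, so [V2 = 0].  If it is 2, maximality gives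
   [v (q x) + v (q y) < 2 v (b (x, y))] on [V2].  A tame extension [L] has an
   [F]-basis splitting its valuation whose squares also split it (its residue
   extension is separable and its ramification index odd), and expanding along
   this basis carries the strict inequality over to [L].  But over the extension
   [q] is hyperbolic, hence self-dual for some norm, and removing a tame family
   leaves an orthogonal in which the reverse inequality is attained, unless
   [V2 = 0].

   (b) => (a).  Inside the orthogonal of the hyperbolic planes already split off,
   an isotropic vector appears after adjoining a root of [X^2 + X + c] with [c]
   integral (residue characteristic 2) or of [X^2 - a]; self-duality completes it
   to a hyperbolic plane.  In such a tower [M] of quadratic extensions the unique
   extension of the valuation is controlled by a functional [psi : M -> F] with
   [psi 1 = 1] and [w z <= v (psi z)].  Its existence passes to subextensions and
   forces [[L : F] = e f], whence every finite subextension is tame. *)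
From HB Require Import structures.
Require Import Defs.
From mathcomp Require Import all_boot all_order all_algebra all_field.
From mathcomp Require Import boolp classical_sets cardinality fsbigop ring.

Set Implicit Arguments.
Unset Strict Implicit.
Unset Printing Implicit Defensive.

Import Order.TTheory GRing.Theory.

Local Open Scope ring_scope.

(** * Values and filtrations *)

(** Here [henselian] provides exactly one extension of [v] to each algebraic extension, and no
    lifting of roots. All information on tame or quadratic extensions is therefore drawn from
    uniqueness: a restriction of a valuation, or its pullback by a conjugation, has to be the
    valuation already known. In the direction from hyperbolicity, the norm found over the extension
    is unrelated to the tame family chosen over [F], so it cannot simply be restricted to the
    orthogonal of that family. The remedy is an inequality between values of the form alone: it
    survives the passage to a subquotient by a totally isotropic subspace, and the orthogonal of the
    family is such a subquotient of a larger self-dual space. Squares of a basis [l] matter because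
    [q] of a combination of vectors [x a] with coefficients [l a] is the sum of the
    [l a ^+ 2 * q (x a)] up to cross terms. In the converse direction the trace cannot serve as
    [psi]: its value at 1 is the degree, a power of 2, which is not a unit in residue characteristic
    2. The first coordinate along each quadratic step replaces it. *)

Section ExtendedValues.
Variable G : orderedGroupType.
Implicit Types (a b g : G) (x y z : with_infty G).

Lemma leD2l_Fin g x y : (Fin g + x <= Fin g + y) = (x <= y).
Proof.
case: x y => [x|] [y|] //.
by rewrite -![Some _]/(Fin _) -!FinD !lee_Fin oleD2l.
Qed.

Lemma leD2r_Fin g x y : (x + Fin g <= y + Fin g) = (x <= y).
Proof. by rewrite ![_ + Fin g]addrC leD2l_Fin. Qed.

Lemma ltD2l_Fin g x y : (Fin g + x < Fin g + y) = (x < y).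
Proof. by rewrite !ltNge leD2l_Fin. Qed.

Lemma ltD2r_Fin g x y : (x + Fin g < y + Fin g) = (x < y).
Proof. by rewrite !ltNge leD2r_Fin. Qed.

Lemma FinDN g : Fin g + Fin (- g) = 0.
Proof. by rewrite -FinD subrr. Qed.

Lemma lee_FinBr g x y : (x <= y + Fin (- g)) = (x + Fin g <= y).
Proof. by rewrite -(leD2r_Fin g) -addrA [Fin (- g) + _]addrC FinDN addr0. Qed.

Lemma lte_leD x x' y y' : x < y -> x' <= y' -> x' != infty -> x + x' < y + y'.
Proof.
case: x' => [a|//] xy ay' _.
apply: (@lt_le_trans _ _ (y + Fin a)); last exact: leeD.
by rewrite ltD2r_Fin.
Qed.

Lemma lteD x x' y y' : x < y -> x' < y' -> x + x' < y + y'.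
Proof.
move=> xy xy'; apply: lte_leD xy (ltW xy') _.
by apply: contraTneq xy' => ->; rewrite -leNgt lee_infty.
Qed.

Lemma le_double x y : (x + x <= y + y) = (x <= y).
Proof.
apply/idP/idP => [|xy]; last exact: leeD.
by apply: contraTT; rewrite -!ltNge => yx; apply: lteD.
Qed.

Lemma lt_double x y : (x + x < y + y) = (x < y).
Proof. by rewrite !ltNge le_double. Qed.

Lemma lte_infty x : (x < infty) = (x != infty).
Proof. by rewrite lt_neqAle lee_infty andbT. Qed.

Lemma neq_infty x : x != infty -> exists g, x = Fin g.
Proof. by case: x => // g _; exists g. Qed.

Lemma half_exists : divisible G -> forall g, exists h, h + h = g.
Proof. by move=> dG g; have [h <-] := dG 2 g isT; exists h; rewrite mulr2n. Qed.

Lemma finite_argmin (n : nat) (f : 'I_n -> with_infty G) :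
  (0 < n)%N -> exists i, forall j, f i <= f j.
Proof.
case: n f => // n f _; exists [arg min_(i < ord0) f i]%O.
by case: arg_minP => // i _ h j; apply: h.
Qed.

End ExtendedValues.

Section FiltrationTheory.
Variables (M : zmodType) (G : orderedGroupType) (f : filtration M G).

Lemma filtN x : f (- x) = f x.
Proof.
apply/le_anti/andP; split.
  by have := filtB f 0 (- x); rewrite filt0 opprK add0r minEle; case: ifP => //;
    case: (f _) (f x) => [?|] [?|].
have := filtB f 0 x; rewrite filt0 add0r minEle; case: ifP => //.
by case: (f _) (f x) => [?|] [?|].
Qed.

Lemma filtD x y : Num.min (f x) (f y) <= f (x + y).
Proof. by rewrite -(filtN y) -{2}[y]opprK filtB. Qed.

Lemma filtD_ge g x y : g <= f x -> g <= f y -> g <= f (x + y).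
Proof. by move=> gx gy; apply: le_trans (filtD x y); rewrite le_min gx gy. Qed.

Lemma filtB_ge g x y : g <= f x -> g <= f y -> g <= f (x - y).
Proof. by move=> gx gy; apply: filtD_ge; rewrite ?filtN. Qed.

Lemma filtD_gt g x y : g < f x -> g < f y -> g < f (x + y).
Proof. by move=> gx gy; apply: lt_le_trans (filtD x y); rewrite lt_min gx gy. Qed.

Lemma filt_sum_ge (I : Type) (r : seq I) (P : pred I) (x : I -> M) g :
  (forall i, P i -> g <= f (x i)) -> g <= f (\sum_(i <- r | P i) x i).
Proof.
move=> h; elim/big_rec: _ => [|i y Pi gy]; first by rewrite filt0 lee_infty.
by apply: filtD_ge => //; apply: h.
Qed.

Lemma filt_sum_gt (I : Type) (r : seq I) (P : pred I) (x : I -> M) g :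
  g != infty ->
  (forall i, P i -> g < f (x i)) -> g < f (\sum_(i <- r | P i) x i).
Proof.
move=> g_fin h; elim/big_rec: _ => [|i y Pi gy]; first by rewrite filt0 lte_infty.
by apply: filtD_gt => //; apply: h.
Qed.

Lemma filt_dom x y : f x < f y -> f (x + y) = f x.
Proof.
move=> xy; apply/le_anti/andP; split; last by apply: filtD_ge => //; apply: ltW.
rewrite leNgt; apply/negP => h.
have : f x < f (x + y - y) by apply: filtD_gt => //; rewrite filtN.
by rewrite addrK ltxx.
Qed.

(** Ties are allowed only at infinity, so a term of least finite value strictly dominates all the
    others, and the sum inherits its value. *)
Lemma filt_sum_distinct (I : finType) (x : I -> M) (i : I) :
  (forall j k, j != k -> f (x j) = f (x k) -> f (x j) = infty) ->
  f (\sum_j x j) <= f (x i).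
Proof.
move=> dist; pose m := [arg min_(j < i) f (x j)]%O.
have mP j : f (x m) <= f (x j) by rewrite /m; case: arg_minP => // k _; apply.
have [m_inf|m_fin] := eqVneq (f (x m)) infty.
  by have := mP i; rewrite m_inf; case: (f (x i)) => // _; rewrite lee_infty.
rewrite (bigD1 m) //=; apply: le_trans (mP i).
rewrite filt_dom //; apply: filt_sum_gt => // j jm.
rewrite lt_neqAle mP andbT; apply: contra m_fin => /eqP E.
by rewrite (dist _ _ _ E) // eq_sym.
Qed.

End FiltrationTheory.

Section ValuationMore.
Variables (F : fieldType) (G : orderedGroupType) (v : valuation F G).
Implicit Types a b : F.

Lemma val_fin a : a != 0 -> exists g, v a = Fin g.
Proof.
move=> a0; apply: neq_infty; apply: contra a0 => /eqP.
by move=> /valuation_eq_infty ->.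
Qed.

Lemma val_neq_infty a : (v a != infty) = (a != 0).
Proof.
by congr (~~ _); apply/eqP/eqP => [/valuation_eq_infty|->]; rewrite ?valuation0.
Qed.

Lemma val_neq0 a g : v a = Fin g -> a != 0.
Proof. by move=> E; rewrite -val_neq_infty E. Qed.

Lemma valV a g : v a = Fin g -> v a^-1 = Fin (- g).
Proof.
move=> E; have := valuationV v (val_neq0 E); rewrite E.
case: (v a^-1) => [h|] //; rewrite -[Some h]/(Fin h) -FinD => -[] gh.
by congr Fin; apply: (addrI g); rewrite gh subrr.
Qed.

Lemma valX2 a : v (a ^+ 2) = v a + v a.
Proof. by rewrite expr2 valuationM. Qed.

Lemma val_dom a b : v a < v b -> v (a + b) = v a.
Proof. exact: (filt_dom (f := v)). Qed.

Lemma val_nat_ge0 n : Fin 0 <= v n%:R.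
Proof.
elim: n => [|n IH]; first by rewrite mulr0n valuation0 lee_infty.
by rewrite -natr1; apply: (filtD_ge (f := v)); rewrite /= ?valuation1.
Qed.

End ValuationMore.

(** * Self-dual value functions *)

Section BigMin.
Variable G : orderedGroupType.
Implicit Types (x y : with_infty G).

Lemma le_bigmin_infty (I : finType) (f : I -> with_infty G) x :
  (forall i, x <= f i) -> x <= \big[Num.min/infty]_i f i.
Proof.
move=> h; elim/big_rec: _ => [|i y _ xy]; first exact: lee_infty.
by rewrite le_min h.
Qed.

Lemma bigmin_infty_le (I : finType) (f : I -> with_infty G) i :
  \big[Num.min/infty]_i f i <= f i.
Proof. by rewrite (bigmin_le_cond infty f (P := xpredT)). Qed.

Lemma bigmin_attained (I : finType) (f : I -> with_infty G) :
  \big[Num.min/infty]_i f i != infty ->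
  exists i, \big[Num.min/infty]_i f i = f i.
Proof.
elim/big_rec: _ => [|i x _ IH]; first by rewrite eqxx.
by rewrite minEle; case: ifP => // _ _; exists i.
Qed.

End BigMin.

Section QuadraticForms.
Variables (F : fieldType) (V : lmodType F) (q : V -> F).
Hypothesis hq : quadratic_form q.
Implicit Types (a : F) (x y z : V).

Lemma qformZ a x : q (a *: x) = a ^+ 2 * q x.
Proof. by case: hq. Qed.

Lemma qform0 : q 0 = 0.
Proof. by rewrite -(scale0r 0) qformZ expr0n mul0r. Qed.

Lemma qformN x : q (- x) = q x.
Proof. by rewrite -scaleN1r qformZ sqrrN expr1n mul1r. Qed.

Lemma qformD x y : q (x + y) = q x + q y + polar q x y.
Proof. by rewrite /polar; ring. Qed.

Lemma polarC x y : polar q x y = polar q y x.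
Proof. by rewrite /polar [x + y]addrC; ring. Qed.

Lemma polar0r x : polar q x 0 = 0.
Proof. by rewrite /polar addr0 qform0; ring. Qed.

Lemma polar0l x : polar q 0 x = 0.
Proof. by rewrite polarC polar0r. Qed.

Lemma polarDr x y z : polar q x (y + z) = polar q x y + polar q x z.
Proof. by case: hq => _ _ /(_ x 1 y z); rewrite scale1r mul1r. Qed.

Lemma polarZr a x y : polar q x (a *: y) = a * polar q x y.
Proof.
by case: hq => _ _ /(_ x a y 0); rewrite addr0 polar0r addr0.
Qed.

Lemma polarDl x y z : polar q (x + y) z = polar q x z + polar q y z.
Proof. by rewrite ![polar q _ z]polarC polarDr. Qed.

Lemma polarZl a x y : polar q (a *: x) y = a * polar q x y.
Proof. by rewrite ![polar q _ y]polarC polarZr. Qed.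

Lemma polarNr x y : polar q x (- y) = - polar q x y.
Proof. by rewrite -scaleN1r polarZr mulN1r. Qed.

Lemma polarNl x y : polar q (- x) y = - polar q x y.
Proof. by rewrite ![polar q _ y]polarC polarNr. Qed.

Lemma polarBr x y z : polar q x (y - z) = polar q x y - polar q x z.
Proof. by rewrite polarDr polarNr. Qed.

Lemma polarBl x y z : polar q (x - y) z = polar q x z - polar q y z.
Proof. by rewrite polarDl polarNl. Qed.

Lemma polarxx x : polar q x x = 2%:R * q x.
Proof. by rewrite /polar -mulr2n -scaler_nat qformZ; ring. Qed.

Lemma polar_sumr (I : Type) (r : seq I) (P : pred I) (y : I -> V) x :
  polar q x (\sum_(i <- r | P i) y i) = \sum_(i <- r | P i) polar q x (y i).
Proof. exact: (big_morph (polar q x) (polarDr x) (polar0r x)). Qed.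

Lemma polar_suml (I : Type) (r : seq I) (P : pred I) (y : I -> V) x :
  polar q (\sum_(i <- r | P i) y i) x = \sum_(i <- r | P i) polar q (y i) x.
Proof.
rewrite polarC polar_sumr; apply: eq_bigr => i _; exact: polarC.
Qed.

Lemma polar_sumZl (I : finType) (c : I -> F) (y : I -> V) x :
  polar q (\sum_i c i *: y i) x = \sum_i c i * polar q (y i) x.
Proof. by rewrite polar_suml; apply: eq_bigr => i _; rewrite polarZl. Qed.

Lemma polar_sumZr (I : finType) (c : I -> F) (y : I -> V) x :
  polar q x (\sum_i c i *: y i) = \sum_i c i * polar q x (y i).
Proof. by rewrite polar_sumr; apply: eq_bigr => i _; rewrite polarZr. Qed.

End QuadraticForms.

Lemma quadratic_form_of (F : fieldType) (V : lmodType F) (q : V -> F) :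
  (forall a x, q (a *: x) = a ^+ 2 * q x) ->
  (forall x y z, polar q x (y + z) = polar q x y + polar q x z) ->
  (forall a x y, polar q x (a *: y) = a * polar q x y) ->
  quadratic_form q.
Proof.
move=> qZ qD pZ; split=> // [y a x z|x a y z]; rewrite ?qD ?pZ //.
have C u t : polar q u t = polar q t u by rewrite /polar [u + t]addrC addrAC.
by rewrite C qD pZ !(C y).
Qed.

Lemma quadratic_form_comp (F : fieldType) (U V : lmodType F)
  (f : {linear U -> V}) (q : V -> F) :
  quadratic_form q -> quadratic_form (q \o f).
Proof.
move=> hq; have pE x y : polar (q \o f) x y = polar q (f x) (f y).
  by rewrite /polar /= raddfD.
apply: quadratic_form_of => [a x|x y z|a x y]; rewrite ?pE /=.
- by rewrite linearZ (qformZ hq).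
- by rewrite raddfD (polarDr hq).
- by rewrite linearZ (polarZr hq).
Qed.

Section SelfDual.
Variables (F : fieldType) (G : orderedGroupType) (v : valuation F G).
Variables (V : vectType F) (q : V -> F).
Hypothesis hq : quadratic_form q.
Variable beta : value_function v V.
Hypothesis prec : norm_prec q beta.
Implicit Types (X : V -> Prop) (x y z u : V).

Definition linear_pred X := forall a x y, X x -> X y -> X (a *: x + y).

(* Nondegeneracy of the graded polar form, read on representatives. *)
Definition self_dual_on X := forall z, X z -> z != 0 ->
  exists y, [/\ X y, polar q z y != 0 & v (polar q z y) <= beta z + beta y].

Definition orth_pair u y X x := [/\ X x, polar q x u = 0 & polar q x y = 0].

Lemma linear_pred_pair X u y : linear_pred X -> linear_pred (orth_pair u y X).
Proof.
move=> lX a x z [Xx xu xy] [Xz zu zy]; split; first exact: lX.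
- by rewrite (polarDl hq) (polarZl hq) xu zu mulr0 addr0.
- by rewrite (polarDl hq) (polarZl hq) xy zy mulr0 addr0.
Qed.

Lemma qform_ge x : beta x + beta x <= v (q x).
Proof. by rewrite -mulr2n; case: prec. Qed.

Lemma vf_fin x : x != 0 -> exists g, beta x = Fin g.
Proof.
by move=> x0; apply: neq_infty; apply: contra x0 => /eqP /vf_eq_infty ->.
Qed.

Lemma linear_predZ X a x : linear_pred X -> X x -> X (a *: x).
Proof.
move=> lX Xx; have X0 : X 0 by have := lX (-1) x x Xx Xx; rewrite scaleN1r addNr.
by have := lX a x 0 Xx X0; rewrite addr0.
Qed.

Lemma linear_predB X x y : linear_pred X -> X x -> X y -> X (x - y).
Proof. by move=> lX Xx Xy; have := lX (-1) y x Xy Xx; rewrite scaleN1r addrC. Qed.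

(** A self-duality witness, scaled to pair to 1 with [u], becomes isotropic after subtraction of a
    multiple of [u]. With [h] the value of [u], the scaled vector has value at least [- h], and the
    correction at least [h - 2 h = - h], so the bound survives. *)
Lemma isotropic_partner X u : linear_pred X -> self_dual_on X ->
  X u -> u != 0 -> q u = 0 ->
  exists y, [/\ X y, q y = 0, polar q u y = 1 & Fin 0 <= beta u + beta y].
Proof.
move=> lX sdX Xu u0 qu; have [y [Xy b0 vb]] := sdX _ Xu u0.
set b := polar q u y in b0 vb.
have [g vg] := val_fin v b0; have vVg := valV vg.
pose y1 := b^-1 *: y.
have by1 : polar q u y1 = 1 by rewrite (polarZr hq) mulVf.
have buy1 : Fin 0 <= beta u + beta y1.
  by rewrite vfZ vVg addrA lee_FinBr -vg add0r.
have [h uh] := vf_fin u0.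
have y1h : Fin (- h) <= beta y1.
  by rewrite -(leD2l_Fin h) FinDN -uh.
exists (- q y1 *: u + y1); split.
- by apply: (lX) => //; apply: linear_predZ.
- by rewrite qformD (qformZ hq) qu mulr0 add0r (polarZl hq) by1 mulr1 subrr.
- by rewrite (polarDr hq) (polarZr hq) (polarxx hq) qu by1 !mulr0 add0r.
- rewrite uh -[Fin 0](FinDN h) leD2l_Fin.
  apply: (filtD_ge (f := beta)) => //=; rewrite vfZ valuationN uh.
  have -> : Fin (- h) = Fin h + (Fin (- h) + Fin (- h)).
    by rewrite addrA FinDN add0r.
  by rewrite leD2l_Fin; apply: le_trans (qform_ge y1); apply: leeD.
Qed.

(** A witness [t] is projected onto the orthogonal of the plane of [u] and [y]. The correction terms
    have value at least [beta t] because [beta u + beta y] is non-negative: the projection does not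
    lower [beta]. *)
Lemma self_dual_pair X u y : linear_pred X -> self_dual_on X ->
  X u -> X y -> q u = 0 -> q y = 0 -> polar q u y = 1 ->
  Fin 0 <= beta u + beta y -> self_dual_on (orth_pair u y X).
Proof.
move=> lX sdX Xu Xy qu qy uy buy z [Xz zu zy] z0.
have [t [Xt b0 vb]] := sdX z Xz z0.
pose t' := t - (polar q t y *: u + polar q t u *: y).
have zt' : polar q z t' = polar q z t.
  by rewrite (polarBr hq) (polarDr hq) !(polarZr hq) zu zy !mulr0 addr0 subr0.
have bt' : beta t <= beta t'.
  apply: (filtB_ge (f := beta)) => //=.
  have E x : beta x <= Fin 0 + beta x by rewrite add0r.
  apply: (filtD_ge (f := beta)) => //=; rewrite vfZ.
    apply: le_trans (E t) _; rewrite (le_trans (leeD buy (lexx (beta t)))) //.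
    by rewrite -addrA leeD // addrC; case: prec => + _; apply.
  apply: le_trans (E t) _; rewrite [beta u + _]addrC in buy.
  rewrite (le_trans (leeD buy (lexx (beta t)))) //.
  by rewrite -addrA leeD // addrC; case: prec => + _; apply.
exists t'; split; last by rewrite zt' (le_trans vb) // leeD.
- split.
  + by apply: linear_predB => //; apply: (lX) => //; apply: linear_predZ.
  + rewrite (polarBl hq) (polarDl hq) !(polarZl hq) (polarxx hq) qu !mulr0 add0r.
    by rewrite [polar q y u]polarC uy mulr1 subrr.
  + rewrite (polarBl hq) (polarDl hq) !(polarZl hq) (polarxx hq) qy !mulr0 addr0.
    by rewrite uy mulr1 subrr.
- by rewrite zt'.
Qed.

(** Together with the line of [u] the sheared list still spans everything, so it cannot have lost a
    dimension. *)
Lemma free_shear (u : V) (f : V -> F) (L : seq V) :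
  free (u :: L) -> free [seq x - f x *: u | x <- L].
Proof.
rewrite /free size_map /= => /eqP uL.
rewrite eqn_leq -{1}(size_map (fun x => x - f x *: u) L) dim_span -ltnS -uL.
have sub : (<<u :: L>> <= <[u]> + <<[seq x - f x *: u | x <- L]>>)%VS.
  apply/span_subvP => x; rewrite inE => /orP[/eqP->|xL].
    by apply: (subvP (addvSl _ _)); rewrite memv_line.
  rewrite -[x](subrK (f x *: u)) addrC memv_add ?memvZ ?memv_line //.
  by apply/memv_span/map_f.
apply: leq_trans (dimvS sub) _; apply: leq_trans (dimv_add_leqif _ _) _.
by rewrite -add1n leq_add2r dim_vline leq_b1.
Qed.

(** Self-duality for the orthogonal of [us] modulo its span; freeness of [z :: us] says that [z] is
    nonzero there. The conclusion mentions [q] only, not [beta], because the isometries [pi] used to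
    remove the vectors of [us] one by one do not preserve [beta]. *)
Lemma isotropic_reduction X (us : seq V) z :
  linear_pred X -> self_dual_on X -> (forall u, u \in us -> X u /\ q u = 0) ->
  (forall u u', u \in us -> u' \in us -> polar q u u' = 0) ->
  X z -> (forall u, u \in us -> polar q z u = 0) -> free (z :: us) ->
  exists t, [/\ X t, forall u, u \in us -> polar q t u = 0, polar q z t != 0
    & v (polar q z t) + v (polar q z t) <= v (q z) + v (q t)].
Proof.
move: {2}(size us) (erefl (size us)) => n.
elim: n us X z => [|n IH] [|u us] X z //=.
  move=> _ lX sdX _ _ Xz _; rewrite seq1_free => z0.
  have [t [Xt b0 vb]] := sdX _ Xz z0; exists t; split=> //.
  apply: le_trans (leeD vb vb) _; rewrite addrACA.
  by apply: leeD; apply: qform_ge.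
move=> [us_n] lX sdX us_iso us_orth Xz z_orth zus_free.
have us_in x : x \in us -> x \in u :: us by rewrite inE orbC => ->.
have u_in : u \in u :: us by rewrite mem_head.
have [Xu qu] := us_iso u u_in.
have uz_free : free (u :: z :: us).
  by rewrite (perm_free (Y := z :: u :: us)) // (perm_catCA [:: u] [:: z]).
have u0 : u != 0.
  by apply: contraTneq uz_free => ->; rewrite free_cons mem0v.
have [y [Xy qy uy buy]] := isotropic_partner lX sdX Xu u0 qu.
(* [pi] moves vectors by multiples of the isotropic [u], hence preserves [q] and its polar form on
   the orthogonal of [u]; the multiple is chosen to reach the orthogonal of [y] as well. *)
pose pi x := x - polar q x y *: u.
have pi_pair x : X x -> polar q x u = 0 -> orth_pair u y X (pi x).
  move=> Xx xu; split; first by apply: linear_predB => //; apply: linear_predZ.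
  - by rewrite (polarBl hq) (polarZl hq) xu (polarxx hq) qu !mulr0 subr0.
  - by rewrite (polarBl hq) (polarZl hq) uy mulr1 subrr.
have pi_polar x x' : polar q x u = 0 -> polar q u x' = 0 ->
    polar q (pi x) (pi x') = polar q x x'.
  move=> xu ux'; rewrite (polarBl hq) !(polarBr hq) !(polarZl hq) !(polarZr hq).
  by rewrite xu ux' (polarxx hq) qu !mulr0 !subr0.
have pi_q x : polar q x u = 0 -> q (pi x) = q x.
  move=> xu; rewrite qformD (qformN hq) (qformZ hq) (polarNr hq) (polarZr hq).
  by rewrite xu qu !mulr0 addr0 oppr0 addr0.
have us_u x : x \in us -> polar q x u = 0 by move=> /us_in xus; apply: us_orth.
have u_us x : x \in us -> polar q u x = 0 by move=> /us_in xus; apply: us_orth.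
have zu : polar q z u = 0 by apply: z_orth.
have [||||||t [Xt t_orth b0 vb]] := IH (map pi us) _ (pi z) _
    (@linear_pred_pair X u y lX) (self_dual_pair lX sdX Xu Xy qu qy uy buy).
- by rewrite size_map.
- move=> _ /mapP[x xus ->]; split; last first.
    by rewrite pi_q ?us_u //; case: (us_iso x (us_in _ xus)).
  by apply: pi_pair; [case: (us_iso x (us_in _ xus))|exact: us_u].
- move=> _ _ /mapP[x xus ->] /mapP[x' xus' ->].
  by rewrite pi_polar ?us_u ?u_us //; apply: us_orth; apply: us_in.
- exact: pi_pair.
- move=> _ /mapP[x xus ->].
  by rewrite pi_polar ?u_us //; apply/z_orth/us_in.
- exact: (free_shear (polar q ^~ y) uz_free).
case: Xt => Xt tu ty; exists t; split=> //.
- move=> x; rewrite inE => /orP[/eqP-> //|xus].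
  have := t_orth _ (map_f pi xus).
  by rewrite (polarBr hq) (polarZr hq) tu mulr0 subr0.
- by move: b0; rewrite (polarBl hq) (polarZl hq) [polar q u t]polarC tu mulr0 subr0.
- move: vb; rewrite (polarBl hq) (polarZl hq) [polar q u t]polarC tu mulr0 subr0.
  by rewrite pi_q.
Qed.

End SelfDual.

(** * Tame families *)

Definition gram (F : fieldType) (V : lmodType F) (q : V -> F) (k : nat)
    (e : 'I_k -> V) : 'M[F]_k := \matrix_(i, j) polar q (e i) (e j).

(* [gam i] plays the role of the value of [e i]; the bounds on the inverse of the
   Gram matrix say that the graded polar form is nondegenerate on the span. *)
Definition tame_family (F : fieldType) (G : orderedGroupType)
    (v : valuation F G) (V : lmodType F) (q : V -> F) (k : nat)
    (e : 'I_k -> V) (gam : 'I_k -> G) :=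
  [/\ forall i, Fin (gam i + gam i) <= v (q (e i)),
      forall i j, Fin (gam i + gam j) <= v (polar q (e i) (e j))
    & exists2 C : 'M[F]_k, gram q e *m C = 1%:M
      & forall i j, Fin (- gam i - gam j) <= v (C i j)].

Section TameFamily.
Variables (F : fieldType) (G : orderedGroupType) (v : valuation F G).
Variables (V : vectType F) (q : V -> F).
Hypothesis hq : quadratic_form q.
Variables (k : nat) (e : 'I_k -> V) (gam : 'I_k -> G).
Hypothesis tame_e : tame_family v q e gam.
Hypothesis full_e : forall z, (forall i, polar q z (e i) = 0) -> z = 0.

(** The dual of the norm that gives [e i] the value [gam i], transported to [V] by the polar form.
    The bounds on the Gram matrix and on its inverse make it coincide with that norm, but this
    formula needs no coordinates and is visibly compatible with extension of scalars. *)
Definition dual_value (z : V) : with_infty G :=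
  \big[Num.min/infty]_i (v (polar q z (e i)) + Fin (- gam i)).

Fact dual_value_eq_infty z : dual_value z = infty <-> z = 0.
Proof.
split=> [z_inf|->]; last first.
  apply/le_anti; rewrite lee_infty; apply: le_bigmin_infty => i.
  by rewrite (polar0l hq) valuation0.
apply: full_e => i; apply/(valuation_eq_infty v)/le_anti; rewrite lee_infty.
have := bigmin_infty_le (fun i => v (polar q z (e i)) + Fin (- gam i)) i.
by rewrite -/(dual_value z) z_inf /=; case: (v _).
Qed.

Fact dual_valueZ a z : dual_value (a *: z) = dual_value z + v a.
Proof.
rewrite /dual_value (big_morph (fun x => x + v a) (id1 := infty)
  (op1 := Num.min)) => [|x y|//].
  by apply: eq_bigr => i _; rewrite (polarZl hq) valuationM -addrA addrC.
case: (v a) => [g|]; last by rewrite minEle; case: ifP; case: x y => [?|] [?|].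
by rewrite !minEle -[Some g]/(Fin g) leD2r_Fin; case: ifP.
Qed.

Fact dual_valueD x y : Num.min (dual_value x) (dual_value y) <= dual_value (x + y).
Proof.
apply: le_bigmin_infty => i; rewrite (polarDl hq) lee_FinBr.
set m := Num.min _ _.
have h z : m <= dual_value z -> m + Fin (gam i) <= v (polar q z (e i)).
  move=> mz; rewrite -lee_FinBr; apply: le_trans mz _.
  exact: (bigmin_infty_le (fun i => v (polar q z (e i)) + Fin (- gam i))).
by apply: (filtD_ge (f := v)); apply: h; rewrite ge_min lexx ?orbT.
Qed.

Definition dual_norm : value_function v V :=
  ValueFunction dual_value_eq_infty dual_valueZ dual_valueD.

Lemma dual_norm_le z i : dual_norm z + Fin (gam i) <= v (polar q z (e i)).
Proof.
rewrite -lee_FinBr.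
exact: (bigmin_infty_le (fun i => v (polar q z (e i)) + Fin (- gam i))).
Qed.

Lemma dual_norm_base i : Fin (gam i) <= dual_norm (e i).
Proof.
apply: le_bigmin_infty => j; rewrite lee_FinBr -FinD.
by case: tame_e.
Qed.

Lemma tame_coordinates z : exists2 t : 'I_k -> F, z = \sum_i t i *: e i
  & forall i, dual_norm z <= v (t i) + Fin (gam i).
Proof.
have [_ _ [C BC vC]] := tame_e; have CB := mulmx1C BC.
(* The coordinates are read off with the inverse Gram matrix, and the bounds on [C] are exactly what
   bounds their values. *)
exists (fun i => \sum_j polar q z (e j) * C j i).
  apply/subr0_eq/full_e => l; rewrite (polarBl hq) (polar_sumZl hq).
  under eq_bigr => i _ do rewrite big_distrl /=.
  rewrite exchange_big /=.
  under eq_bigr => j _.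
    under eq_bigr => i _ do rewrite -mulrA.
    rewrite -big_distrr /=.
    over.
  have BCE (j : 'I_k) : \sum_i C j i * polar q (e i) (e l) = (j == l)%:R.
    have /matrixP/(_ j l) := CB; rewrite !mxE => <-.
    by apply: eq_bigr => i _; rewrite mxE.
  under eq_bigr => j _ do rewrite BCE.
  rewrite (bigD1 l) //= eqxx mulr1 big1 ?addr0 ?subrr // => j /negPf ->.
  by rewrite mulr0.
move=> i; rewrite -[gam i]opprK lee_FinBr.
apply: (filt_sum_ge (f := v)) => j _ /=; rewrite valuationM.
apply: le_trans (leeD (dual_norm_le z j) (vC j i)).
by rewrite -addrA -FinD addrA subrr add0r.
Qed.

Lemma qform_sum_ge (I : Type) (r : seq I) (P : pred I) (x : I -> V)
    (g : with_infty G) :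
  (forall i, P i -> g + g <= v (q (x i))) ->
  (forall i j, P i -> P j -> g + g <= v (polar q (x i) (x j))) ->
  g + g <= v (q (\sum_(i <- r | P i) x i)).
Proof.
move=> gq gb; suff : g + g <= v (q (\sum_(i <- r | P i) x i)) /\
    forall j, P j -> g + g <= v (polar q (x j) (\sum_(i <- r | P i) x i)).
  by case.
elim/big_rec: _ => [|i y Pi [gy gyb]].
  rewrite (qform0 hq) valuation0 lee_infty; split=> // j _.
  by rewrite (polar0r hq) valuation0 lee_infty.
split=> [|j Pj].
  rewrite qformD; apply: (filtD_ge (f := v)); last exact: gyb.
  by apply: (filtD_ge (f := v)) => //; apply: gq.
by rewrite (polarDr hq); apply: (filtD_ge (f := v)); [apply: gb|apply: gyb].
Qed.

Lemma dual_norm_prec : norm_prec q dual_norm.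
Proof.
have [vq vb _] := tame_e; split=> [x y|x].
  have [t xE vt] := tame_coordinates x; rewrite {2}xE (polar_sumZl hq).
  apply: (filt_sum_ge (f := v)) => i _ /=; rewrite valuationM polarC.
  apply: le_trans (leeD (vt i) (lexx _)) _; rewrite -addrA leeD // addrC.
  exact: dual_norm_le.
have [t xE vt] := tame_coordinates x; rewrite {2}xE mulr2n.
apply: qform_sum_ge => [i _|i j _ _].
  rewrite (qformZ hq) valuationM valX2.
  apply: le_trans (leeD (vt i) (vt i)) _; rewrite addrACA leeD //.
  exact: vq.
rewrite (polarZl hq) (polarZr hq) !valuationM addrA.
apply: le_trans (leeD (vt i) (vt j)) _; rewrite addrACA leeD //.
exact: vb.
Qed.

(** The vector [e i] whose index attains the minimum defining [dual_value z] is the witness. *)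
Lemma dual_norm_self_dual : self_dual_on q dual_norm (fun=> True).
Proof.
move=> z _ z0; have [i iz] : exists i,
    dual_norm z = v (polar q z (e i)) + Fin (- gam i).
  apply: bigmin_attained; apply: contra z0 => /eqP z_inf.
  by apply/eqP/dual_value_eq_infty.
exists (e i); split=> //.
  by apply: contra z0 => /eqP b0; apply/eqP/dual_value_eq_infty;
    rewrite -/(dual_norm z) [LHS]iz b0 valuation0.
rewrite iz; apply: le_trans (leeD (lexx _) (dual_norm_base i)).
by rewrite -addrA -FinD addNr addr0.
Qed.

End TameFamily.

Section TameFree.
Variables (F : fieldType) (V : lmodType F) (q : V -> F).
Hypothesis hq : quadratic_form q.

Lemma gram_free k (e : 'I_k -> V) (C : 'M[F]_k) (c : 'I_k -> F) :
  gram q e *m C = 1%:M -> (forall j, polar q (\sum_i c i *: e i) (e j) = 0) ->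
  forall i, c i = 0.
Proof.
move=> BC ce i; suff : \row_i c i = 0 by move=> /rowP/(_ i); rewrite !mxE.
have cB : \row_i c i *m gram q e = 0.
  apply/rowP => j; rewrite !mxE -[RHS](ce j) (polar_sumZl hq).
  by apply: eq_bigr => l _; rewrite !mxE.
by rewrite -[\row_i _]mulmx1 -BC mulmxA cB mul0mx.
Qed.

End TameFree.

Section TameSplitting.
Variables (F : fieldType) (G : orderedGroupType) (v : valuation F G).
Variables (V : vectType F) (q : V -> F).
Hypothesis hq : quadratic_form q.

Lemma dual_norm_splitting (k : nat) (e : 'I_k -> V) (gam : 'I_k -> G)
  (tame_e : tame_family v q e gam)
  (full_e : forall z, (forall i, polar q z (e i) = 0) -> z = 0) (c : 'I_k -> F) :
  let beta := dual_norm v hq gam full_e in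
  beta (\sum_i c i *: e i) = \big[Num.min/infty]_i beta (c i *: e i).
Proof.
move=> beta; apply/le_anti/andP; split; last first.
  by apply: (filt_sum_ge (f := beta)) => i _; apply: bigmin_infty_le.
apply: le_bigmin_infty => i; rewrite vfZ.
have [t tE vt] := tame_coordinates hq tame_e full_e (\sum_i c i *: e i).
have [_ _ [C BC _]] := tame_e.
have -> : c i = t i.
  apply/subr0_eq; apply: (gram_free hq (c := fun i => c i - t i) BC) => j.
  have -> : \sum_i (c i - t i) *: e i = 0.
    under eq_bigr do rewrite scalerBl.
    by rewrite sumrB {1}tE subrr.
  exact: (polar0l hq).
by rewrite addrC; apply: le_trans (vt i) _; rewrite leeD // dual_norm_base.
Qed.

End TameSplitting.

(** * Differences of quadratic forms and cancellation of a tame part *)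

Section ProductForms.
Variables (F : fieldType) (G : orderedGroupType) (v : valuation F G).
Variables (V W : vectType F).

Section ProductValue.
Variables (alpha : value_function v V) (beta : value_function v W).

Definition pair_value (x : V * W) : with_infty G :=
  Num.min (alpha x.1) (beta x.2).

Fact pair_value_eq_infty x : pair_value x = infty <-> x = 0.
Proof.
case: x => x y; rewrite /pair_value /=; split=> [|[-> ->]].
  move=> xy_inf.
  have /andP[] : (infty <= alpha x) && (infty <= beta y) by rewrite -le_min xy_inf.
  move=> h1 h2; congr (_, _).
    by apply/(vf_eq_infty alpha)/le_anti; rewrite lee_infty.
  by apply/(vf_eq_infty beta)/le_anti; rewrite lee_infty.
by rewrite (vf_filt0 alpha) (vf_filt0 beta) minxx.
Qed.

Fact pair_valueZ a x : pair_value (a *: x) = pair_value x + v a.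
Proof.
case: x => x y; rewrite /pair_value /= !vfZ.
case: (v a) => [g|].
  by rewrite !minEle -[Some g]/(Fin g) leD2r_Fin; case: ifP.
by rewrite !minEle; case: ifP; case: ifP; case: (alpha x) (beta y) => [?|] [?|].
Qed.

Fact pair_valueD x y :
  Num.min (pair_value x) (pair_value y) <= pair_value (x + y).
Proof.
rewrite /pair_value le_min; apply/andP; split.
  by apply: le_trans (vfD alpha _ _); rewrite le_min !ge_min !lexx ?orbT.
by apply: le_trans (vfD beta _ _); rewrite le_min !ge_min !lexx ?orbT.
Qed.

Definition pair_norm : value_function v (V * W)%type :=
  ValueFunction pair_value_eq_infty pair_valueZ pair_valueD.

End ProductValue.

Variables (q : V -> F) (r : W -> F).
Hypotheses (hq : quadratic_form q) (hr : quadratic_form r).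
Variables (alpha : value_function v V) (beta : value_function v W).
Hypotheses (qa : norm_prec q alpha) (rb : norm_prec r beta).
Hypotheses (sda : self_dual_on q alpha (fun=> True)).
Hypotheses (sdb : self_dual_on r beta (fun=> True)).

Definition pair_form (x : V * W) : F := q x.1 - r x.2.

Lemma pair_form_polar x y :
  polar pair_form x y = polar q x.1 y.1 - polar r x.2 y.2.
Proof. by rewrite /polar /pair_form /=; ring. Qed.

Lemma pair_form_quadratic : quadratic_form pair_form.
Proof.
apply: quadratic_form_of => [a [x y]|[x x'] [y y'] [z z']|a [x x'] [y y']];
  rewrite ?pair_form_polar /pair_form /=.
- by rewrite (qformZ hq) (qformZ hr); ring.
- by rewrite (polarDr hq) (polarDr hr); ring.
- by rewrite (polarZr hq) (polarZr hr); ring.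
Qed.

Lemma pair_norm_prec : norm_prec pair_form (pair_norm alpha beta).
Proof.
have [qa1 qa2] := qa; have [rb1 rb2] := rb; split=> [[x x'] [y y']|[x x']].
  rewrite pair_form_polar; apply: (filtB_ge (f := v)) => /=.
    by apply: le_trans (qa1 x y); rewrite leeD // ge_min lexx.
  by apply: le_trans (rb1 x' y'); rewrite leeD // ge_min lexx ?orbT.
rewrite mulr2n; apply: (filtB_ge (f := v)) => /=; rewrite /pair_value /=.
  by apply: le_trans (qa2 x); rewrite mulr2n leeD // ge_min lexx.
by apply: le_trans (rb2 x'); rewrite mulr2n leeD // ge_min lexx ?orbT.
Qed.

Lemma pair_norm_self_dual :
  self_dual_on pair_form (pair_norm alpha beta) (fun=> True).
Proof.
move=> [x y] _ xy0; have [ab|ba] := leP (alpha x) (beta y).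
  have x0 : x != 0.
    apply: contra xy0 => /eqP x0; move: ab; rewrite x0 (vf_filt0 alpha).
    case E: (beta y) => // _; apply/eqP; congr (_, _); exact/(vf_eq_infty beta).
  have [t [_ b0 vb]] := sda I x0; exists (t, 0); split=> //;
    rewrite pair_form_polar /= (polar0r hr) subr0 //.
  rewrite /pair_value /= (vf_filt0 beta) !minEle ab lee_infty.
  exact: vb.
have y0 : y != 0.
  by apply: contraTneq ba => ->; rewrite (vf_filt0 beta) -leNgt lee_infty.
have [t [_ b0 vb]] := sdb I y0; exists (0, t); split=> //;
  rewrite pair_form_polar /= (polar0r hq) sub0r ?oppr_eq0 // valuationN.
rewrite /pair_value /= (vf_filt0 alpha) !minElt [alpha x < _]ltNge (ltW ba) /=.
by rewrite ltNge lee_infty.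
Qed.

End ProductForms.

Section Cancellation.
Variables (F : fieldType) (G : orderedGroupType) (v : valuation F G).
Variables (V : vectType F) (q : V -> F).
Hypothesis hq : quadratic_form q.
Variable beta : value_function v V.
Hypotheses (prec : norm_prec q beta) (sd : self_dual_on q beta (fun=> True)).
Variables (k : nat) (e : 'I_k -> V) (gam : 'I_k -> G).
Hypothesis tame_e : tame_family v q e gam.

Definition comb (y : 'rV[F]_k) : V := \sum_i y 0 i *: e i.

Fact comb_linear : linear comb.
Proof.
move=> a x y; rewrite /comb scaler_sumr -big_split /=; apply: eq_bigr => i _.
by rewrite !mxE scalerA scalerDl.
Qed.

HB.instance Definition _ := GRing.isLinear.Build F 'rV[F]_k V _ comb comb_linear.

Lemma comb_delta i : comb (delta_mx 0 i) = e i.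
Proof.
rewrite /comb (bigD1 i) //= big1 => [|j ji]; rewrite !mxE eqxx /=.
  by rewrite eqxx scale1r addr0.
by rewrite (negPf ji) scale0r.
Qed.

(* With [r] the form of the span of [e], the diagonal copies of the [e i] in
   [q] minus [r] are totally isotropic, and their orthogonal modulo their span
   is the orthogonal of [e] in [q]. *)
Lemma orthogonal_partner z : z != 0 -> (forall i, polar q z (e i) = 0) ->
  exists t, [/\ forall i, polar q t (e i) = 0, polar q z t != 0
    & v (polar q z t) + v (polar q z t) <= v (q z) + v (q t)].
Proof.
move=> z0 ze; pose r := q \o comb.
have hr : quadratic_form r by apply: quadratic_form_comp.
have polar_r x y : polar r x y = polar q (comb x) (comb y).
  by rewrite /polar /r /= raddfD.
pose d i : 'rV[F]_k := delta_mx 0 i.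
have [vq vb [C BC vC]] := tame_e.
have gramE : gram r d = gram q e.
  by apply/matrixP => i j; rewrite !mxE polar_r !comb_delta.
have tame_d : tame_family v r d gam.
  split=> [i|i j|]; rewrite ?polar_r /r /= ?comb_delta ?vq ?vb //.
  by exists C; rewrite ?gramE.
have full_d y : (forall i, polar r y (d i) = 0) -> y = 0.
  move=> yd; apply/rowP => i; rewrite mxE; apply: (gram_free hq BC) => j.
  by rewrite -/(comb y) -(comb_delta j) -polar_r.
have hQ := pair_form_quadratic hq hr.
have precQ := pair_norm_prec prec (dual_norm_prec hr tame_d full_d).
have sdQ := pair_norm_self_dual hq hr sd (dual_norm_self_dual hr tame_d full_d).
pose us := [tuple (e i, d i) | i < k].
have usE (i : 'I_k) : us`_i = (e i, d i) by rewrite -tnth_nth tnth_mktuple.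
have lT : linear_pred (fun _ : V * 'rV[F]_k => True) by [].
have [|||||[a y] [_ ae b0 vab]] :=
    isotropic_reduction hQ precQ (us := us) (z := (z, 0)) lT sdQ.
- move=> _ /mapP[i _ ->]; split=> //.
  by rewrite /pair_form /r /= comb_delta subrr.
- move=> _ _ /mapP[i _ ->] /mapP[j _ ->].
  by rewrite pair_form_polar /= polar_r !comb_delta subrr.
- by [].
- move=> _ /mapP[i _ ->].
  by rewrite pair_form_polar /= ze (polar0l hr) subr0.
- apply/(@freeP _ _ _ [tuple of (z, 0) :: us]) => c; rewrite big_ord_recl /= => cE.
  have c_fst : c ord0 *: z + \sum_i c (lift ord0 i) *: e i = 0.
    have := congr1 fst cE; rewrite /= (raddf_sum fst) /= => cE1.
    rewrite -[RHS]cE1; congr (_ + _); apply: eq_bigr => i _.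
    exact: (congr1 (fun p => _ *: p.1) (esym (usE i))).
  have c_snd : \sum_i c (lift ord0 i) *: d i = 0.
    have := congr1 snd cE; rewrite /= (raddf_sum snd) /= scaler0 add0r => cE2.
    rewrite -[RHS]cE2; apply: eq_bigr => i _.
    exact: (congr1 (fun p => _ *: p.2) (esym (usE i))).
  have c0 i : c (lift ord0 i) = 0.
    have /rowP/(_ i) := c_snd; rewrite summxE (bigD1 i) //= big1 => [|j ji].
      by rewrite !mxE !eqxx addr0 mulr1.
    by rewrite !mxE eqxx /= eq_sym (negPf ji) mulr0.
  move=> i; case: (unliftP ord0 i) => [j ->|->]; first exact: c0.
  move: c_fst; rewrite big1 => [|j _]; last by rewrite c0 scale0r.
  by rewrite addr0 => /eqP; rewrite scaler_eq0 (negPf z0) orbF => /eqP.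
(* Orthogonality to the diagonal vectors means that [a] and [comb y] pair equally with every [e i].
   So [a - comb y] is orthogonal to [e], and its value under [q] is the value of the difference form
   at [(a, y)]. *)
have ayE i : polar q a (e i) = polar q (comb y) (e i).
  apply/subr0_eq; have := ae (e i, d i); rewrite pair_form_polar /= polar_r.
  by rewrite comb_delta => ->//; apply/mapP; exists i; rewrite ?mem_enum.
have zy : polar q z (comb y) = 0.
  by rewrite (polar_sumZr hq) big1 // => i _; rewrite ze mulr0.
have zaE : polar q z (a - comb y) = polar q z a by rewrite (polarBr hq) zy subr0.
have qE : q (a - comb y) = q a - r y.
  have : polar q (a - comb y) (comb y) = 0.
    rewrite (polar_sumZr hq) big1 // => i _.
    by rewrite (polarBl hq) ayE subrr mulr0.
  by have := qformD q (a - comb y) (comb y); rewrite subrK => -> ->; rewrite addr0 addrK.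
exists (a - comb y); split=> [i||].
- by rewrite (polarBl hq) ayE subrr.
- by move: b0; rewrite pair_form_polar /= (polar0l hr) subr0 zaE.
- move: vab; rewrite pair_form_polar /= (polar0l hr) subr0 zaE qE.
  by rewrite /pair_form /= (qform0 hr) subr0.
Qed.

End Cancellation.

(** * Construction and maximality of tame families *)

Lemma common_kernel (F : fieldType) (V : vectType F) (I : finType)
    (g : I -> V -> F) : (forall i, scalar (g i)) -> (#|I| < \dim {:V})%N ->
  exists2 z, z != 0 & forall i, g i z = 0.
Proof.
move=> g_lin k_lt; pose f z : 'rV[F]_#|I| := \row_i g (enum_val i) z.
have f_lin : linear f by move=> a x y; apply/rowP => i; rewrite !mxE g_lin.
pose fM := GRing.isLinear.Build _ _ _ _ f f_lin.
pose fL : {linear V -> 'rV[F]_#|I|} := HB.pack f fM.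
have : (0 < \dim (lker (linfun fL)))%N.
  have := limg_ker_dim (linfun fL) fullv; rewrite capfv => dimE.
  rewrite lt0n; apply: contraL k_lt => /eqP ker0; rewrite -leqNgt.
  rewrite -dimE ker0 add0n; apply: leq_trans (dimvS (subvf _)) _.
  by rewrite dimvf /dim /= mul1n.
rewrite lt0n dimv_eq0 => ker0; exists (vpick (lker (linfun fL))).
  by rewrite vpick0.
move=> i; have := memv_pick (lker (linfun fL)).
by rewrite memv_ker lfunE /= => /eqP/rowP/(_ (enum_rank i)); rewrite !mxE enum_rankK.
Qed.

Lemma orthogonal_vector (F : fieldType) (V : vectType F) (q : V -> F)
    (k : nat) (e : 'I_k -> V) :
  quadratic_form q -> (k < \dim {:V})%N ->
  exists2 z, z != 0 & forall i, polar q z (e i) = 0.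
Proof.
move=> hq k_lt; apply: (common_kernel (g := fun i z => polar q z (e i))).
  by move=> i; case: hq.
by rewrite card_ord.
Qed.

Section TameConstructions.
Variables (F : fieldType) (G : orderedGroupType) (v : valuation F G).
Variables (V : vectType F) (q : V -> F).
Hypothesis hq : quadratic_form q.

Lemma tame_family_free k (e : 'I_k -> V) gam :
  tame_family v q e gam -> free [tuple e i | i < k].
Proof.
move=> [_ _ [C BC _]]; apply/freeP => c c0; apply: (gram_free hq BC) => j.
suff -> : \sum_i c i *: e i = 0 by exact: (polar0l hq).
rewrite -[RHS]c0; apply: eq_bigr => i _.
by rewrite -tnth_nth tnth_mktuple.
Qed.

Lemma tame_family_size k (e : 'I_k -> V) gam :
  tame_family v q e gam -> (k <= \dim {:V})%N.
Proof.
move=> /tame_family_free; rewrite /free size_tuple => /eqP eE.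
by have := dimvS (subvf <<[tuple e i | i < k]>>); rewrite eE.
Qed.

Lemma tame_family_empty (e : 'I_0 -> V) gam : tame_family v q e gam.
Proof.
split=> [[]//|[]//|]; exists 1%:M => [|[]//].
by apply/matrixP => -[].
Qed.

Lemma tame_family_cat k l (e : 'I_k -> V) gam (f : 'I_l -> V) del :
  tame_family v q e gam -> tame_family v q f del ->
  (forall i j, polar q (e i) (f j) = 0) ->
  exists (g : 'I_(k + l) -> V) eps, tame_family v q g eps.
Proof.
move=> [eq1 eb [C BC vC]] [fq fb [D BD vD]] ef.
have fe i j : polar q (f i) (e j) = 0 by rewrite polarC.
pose cas T (x : 'I_k -> T) (y : 'I_l -> T) (i : 'I_(k + l)) :=
  match split i with inl j => x j | inr j => y j end.
have casl T x y i : cas T x y (lshift l i) = x i.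
  by rewrite /cas; case: splitP => [j /= /val_inj -> //|j /= E];
    have := ltn_ord i; rewrite E ltnNge leq_addr.
have casr T x y i : cas T x y (rshift k i) = y i.
  rewrite /cas; case: splitP => [j /= E|j /= /addnI /val_inj -> //].
  by have := ltn_ord j; rewrite -E ltnNge leq_addr.
exists (cas _ e f), (cas _ gam del); split=> [i|i j|].
- by case: (split_ordP i) => j ->; rewrite ?casl ?casr.
- case: (split_ordP i) => i' ->; case: (split_ordP j) => j' ->;
    rewrite ?casl ?casr ?ef ?fe ?valuation0 ?lee_infty //.
- exists (block_mx C 0 0 D).
    have -> : gram q (cas _ e f) = block_mx (gram q e) 0 0 (gram q f).
      apply/matrixP => i j; rewrite mxE.
      case: (split_ordP i) => i' ->; case: (split_ordP j) => j' ->;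
        by rewrite ?casl ?casr ?block_mxEul ?block_mxEur ?block_mxEdl
          ?block_mxEdr mxE ?ef ?fe.
    by rewrite mulmx_block !mulmx0 !mul0mx !addr0 !add0r BC BD -scalar_mx_block.
  move=> i j; case: (split_ordP i) => i' ->; case: (split_ordP j) => j' ->;
    rewrite ?casl ?casr ?block_mxEul ?block_mxEur ?block_mxEdl ?block_mxEdr //;
    by rewrite mxE valuation0 lee_infty.
Qed.

(** When 2 is a unit, [polar q x x] has the same value as [q x], so the one-by-one Gram matrix is
    unimodular once [x] receives half of that value; divisibility of [G] provides the half. *)
Lemma tame_line (x : V) : divisible G -> v 2%:R = Fin 0 -> q x != 0 ->
  exists gam, tame_family v q (fun _ : 'I_1 => x) gam.
Proof.
move=> dG v2 qx0; have [g vg] := val_fin v qx0.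
have [h hE] := half_exists dG g; exists (fun=> h).
have vb : v (polar q x x) = Fin g by rewrite (polarxx hq) valuationM v2 vg -FinD add0r.
split=> [i|i j|]; rewrite ?hE ?vg ?vb //.
exists (polar q x x)^-1%:M.
  apply/matrixP => i j; rewrite mxE big_ord1 !mxE !ord1 eqxx !mulr1n mulfV //.
  by rewrite -(val_neq_infty v) vb.
by move=> i j; rewrite !ord1 mxE eqxx mulr1n (valV vb) -hE opprD.
Qed.

Lemma ord2P (i : 'I_2) : i = ord0 \/ i = lift ord0 ord0.
Proof. by case: (unliftP ord0 i) => [j ->|->]; [right; rewrite ord1|left]. Qed.

Definition pairfun T (x y : T) (i : 'I_2) : T := if i == ord0 then x else y.

Lemma tame_plane (x y : V) : divisible G -> Fin 0 < v 2%:R ->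
  polar q x y != 0 ->
  v (polar q x y) + v (polar q x y) <= v (q x) + v (q y) ->
  exists gam, tame_family v q (pairfun x y) gam.
Proof.
move=> dG v2; set b := polar q x y => b0 vb; have [g vg] := val_fin v b0.
(* Half of [v (q x)] goes to [x] and the rest of [g] to [y]; the hypothesis [vb] makes the rest
   small enough. If [q x = 0] the roles are exchanged, and if [q y = 0] too any splitting of [g]
   works. *)
have [a [c [ac qa qc]]] : exists a c, [/\ a + c = g,
    Fin (a + a) <= v (q x) & Fin (c + c) <= v (q y)].
  move: vb; rewrite vg; case Ex : (v (q x)) => [h|] vb; last first.
    case Ey : (v (q y)) => [h|]; last first.
      by exists 0, g; rewrite add0r !lee_infty.
    have [c cE] := half_exists dG h; exists (g - c), c.
    by rewrite subrK lee_infty cE lexx.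
  have [a aE] := half_exists dG h; exists a, (g - a); rewrite aE lexx.
  split=> //; first by rewrite addrCA subrr addr0.
  rewrite -(leD2l_Fin h); apply: le_trans vb; rewrite -!FinD -aE.
  by rewrite addrACA !(addrCA a) !subrr !addr0.
have vbE : v b = Fin (a + c) by rewrite ac.
have v2xx z : v (2%:R * q z) = v (q z) + v 2%:R by rewrite valuationM addrC.
(* The Gram determinant. Its first term has value above twice that of [b], because of the factor 4
   with [v 2%:R] positive, so [- b ^+ 2] dominates. *)
pose d := (2%:R * q x) * (2%:R * q y) - b ^+ 2.
have vd : v d = Fin ((a + c) + (a + c)).
  have vb2 : v (- b ^+ 2) = Fin ((a + c) + (a + c)).
    by rewrite valuationN valX2 vbE FinD.
  rewrite /d addrC val_dom ?vb2 //.
  have -> : 2%:R * q x * (2%:R * q y) = q x * q y * 2%:R * 2%:R :> F by ring.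
  rewrite -[X in Fin X]addr0 -[X in Fin (X + _)]addr0.
  have h1 : Fin (a + c + (a + c)) <= v (q x * q y).
    by rewrite valuationM addrACA FinD leeD.
  rewrite valuationM; apply: (lteD_Fin _ v2); rewrite valuationM FinD.
  by apply: leeD => //; apply: ltW.
have d0 : d != 0 := val_neq0 vd.
have vVd := valV vd.
exists (pairfun a c); split.
- by move=> i; rewrite /pairfun; case: ifP.
- move=> i j; rewrite /pairfun; case: ifP; case: ifP => _ _.
  + by rewrite (polarxx hq) v2xx -[Fin _]addr0; apply: leeD => //; apply: ltW.
  + by rewrite -/b vbE.
  + by rewrite polarC -/b vbE addrC.
  + by rewrite (polarxx hq) v2xx -[Fin _]addr0; apply: leeD => //; apply: ltW.
(* The adjugate of the Gram matrix divided by its determinant. *)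
exists (\matrix_(i, j) (d^-1 * (if i == j then 2%:R * q (pairfun y x i) else - b))).
  have yx : polar q y x = b by rewrite polarC.
  have keyE (A B C D : F) :
      A * (d^-1 * B) + (C * (d^-1 * D) + 0) = d^-1 * (A * B + C * D) by ring.
  have key1 (A B C D : F) : A * B + C * D = d ->
      A * (d^-1 * B) + (C * (d^-1 * D) + 0) = 1.
    by move=> E; rewrite keyE E mulVf.
  have key0 (A B C D : F) : A * B + C * D = 0 ->
      A * (d^-1 * B) + (C * (d^-1 * D) + 0) = 0.
    by move=> E; rewrite keyE E mulr0.
  apply/matrixP => i j; rewrite mxE !big_ord_recl big_ord0 !mxE /pairfun /=.
  case: (ord2P i) => ->; case: (ord2P j) => ->;
    rewrite ?eqxx /= ?(polarxx hq) -/b ?yx;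
    first [apply: key1 | apply: key0]; rewrite /d; ring.
have side z t : Fin (t + t) <= v (q z) ->
    Fin (- (a + c + (a + c)) + (t + t)) <= v (d^-1 * (2%:R * q z)).
  move=> tz; rewrite valuationM vVd FinD leD2l_Fin v2xx.
  by rewrite -[X in Fin X]addr0 FinD leeD // ltW.
have ac_c : - (a + c) + c = - a by rewrite opprD subrK.
have ac_a : - (a + c) + a = - c by rewrite opprD addrAC addNr add0r.
move=> i j; rewrite mxE /pairfun; case: (eqVneq i j) => [<-|].
  case: eqP => _.
    by have := side _ _ qc; rewrite opprD addrACA ac_c.
  by have := side _ _ qa; rewrite opprD addrACA ac_a.
rewrite valuationM vVd valuationN vbE -FinD opprD addrNK.
case: (ord2P i) => ->; case: (ord2P j) => ->;
  rewrite ?eqxx //= => _; rewrite opprD // addrC //.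
Qed.

Lemma maximal_tame_family : exists k (e : 'I_k -> V) gam,
  tame_family v q e gam /\ forall l (f : 'I_l -> V) del,
    tame_family v q f del -> (forall i j, polar q (e i) (f j) = 0) -> l = 0%N.
Proof.
pose P k := `[< exists (e : 'I_k -> V) gam, tame_family v q e gam >].
have exP : exists k, P k.
  exists 0%N; apply/asboolP; exists (fun=> 0), (fun=> 0).
  exact: tame_family_empty.
have leP k : P k -> (k <= \dim {:V})%N.
  by move=> /asboolP[e [gam /tame_family_size]].
case: (ex_maxnP exP leP) => k /asboolP[e [gam tame_e]] kmax.
exists k, e, gam; split=> // l f del tame_f ef.
have [g [eps tame_g]] := tame_family_cat tame_e tame_f ef.
have /kmax : P (k + l)%N by apply/asboolP; exists g, eps.
by rewrite -{2}[k]addn0 leq_add2l leqn0 => /eqP.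
Qed.

End TameConstructions.

(** * The graded polar form *)

Section DirectSumTheory.
Variables (I : choiceType) (A : I -> zmodType).

Lemma ds_homogE i (x : A i) : ds_homog x i = x.
Proof. by rewrite /ds_homog /= dfwith_in. Qed.

Lemma ds_homog_out i (x : A i) j : j != i -> ds_homog x j = 0.
Proof. by move=> ji; rewrite /ds_homog /= dfwith_out // eq_sym. Qed.

Lemma ds_supp_homog i (x : A i) : x != 0 -> ds_supp (ds_homog x) = [set i]%classic.
Proof.
move=> x0; apply/seteqP; split=> j => [xj|->]; last first.
  by change (ds_homog x i != 0); rewrite ds_homogE.
have [-> //|ji] := eqVneq j i; have : ds_homog x j != 0 := xj.
by rewrite ds_homog_out // eqxx.
Qed.

Lemma ds_homog0 i : ds_homog (0 : A i) = 0.
Proof.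
apply: dsumP => j; have [->|ji] := eqVneq j i; first exact: ds_homogE.
exact: ds_homog_out.
Qed.

Lemma ds_sumE (T : Type) (r : seq T) (f : T -> dsum A) i :
  (\sum_(t <- r) f t) i = \sum_(t <- r) f t i.
Proof. by apply: (big_morph (fun u : dsum A => u i)). Qed.

End DirectSumTheory.

Section GradedDuality.
Variables (F : fieldType) (G : orderedGroupType) (v : valuation F G).
Variables (V : vectType F) (q : V -> F).
Hypothesis hq : quadratic_form q.
Variable alpha : value_function v V.
Hypothesis prec : norm_prec q alpha.

(** Graded nondegeneracy is applied to the homogeneous class of [x]. A nonzero pairing is already
    nonzero against one homogeneous component, and any representative of that component is a
    witness. *)
Lemma gr_self_dual : nondegenerate_pairing (gr_polar q (alpha := alpha)) ->
  self_dual_on q alpha (fun=> True).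
Proof.
move=> nd x _ x0; have [g xg] := vf_fin alpha x0.
have xg_le : Fin g <= alpha x by rewrite xg.
pose c : gr_piece alpha g := gr_class alpha g x.
have c0 : c != 0 by rewrite gr_class_eq0 //= xg ltxx.
pose X : gr alpha := ds_homog c.
have X0 : X <> 0.
  move=> /(congr1 (fun u : gr alpha => u g)); rewrite /X ds_homogE => /eqP.
  by rewrite (negPf c0).
have [Y XY] : exists Y, gr_polar q X Y <> 0.
  apply: contrapT => h; apply: X0; apply: nd => Y.
  by apply: contrapT => XY; apply: h; exists Y.
have [d Yd] : exists d, gr_polar_homog q c (Y d) != 0.
  apply: contrapT => h; apply: XY; rewrite /gr_polar ds_supp_homog // fsbig_set1.
  rewrite fsbig1 // => d _; rewrite ds_homogE.
  suff -> : gr_polar_homog q c (Y d) = 0 by exact: ds_homog0.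
  by apply/eqP; apply: contrapT => /negP E; apply: h; exists d.
pose y := gr_repr (Y d); have yd : Fin d <= alpha y := gr_repr_ge (Y d).
have YdE : Y d = gr_class alpha d y by rewrite gr_reprK.
move: Yd; rewrite YdE gr_polar_homogE //.
have vxy : Fin (g + d) <= v (polar q x y).
  by apply: le_trans (prec.1 x y); rewrite FinD leeD.
rewrite gr_class_eq0 //= -leNgt => vxy'.
exists y; split=> //.
  by rewrite -(val_neq_infty v); apply: contraTneq vxy' => ->.
by apply: le_trans vxy' _; rewrite FinD leeD.
Qed.

(** A nonzero component of [X], of degree [g], is tested against the class of a self-duality
    witness, of degree [d]. In degree [g + d] only the component of degree [g] contributes, so
    nothing can cancel. *)
Lemma self_dual_gr : self_dual_on q alpha (fun=> True) ->
  nondegenerate_pairing (gr_polar q (alpha := alpha)).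
Proof.
move=> sd X X_orth; apply: dsumP => g; apply: contrapT => /eqP Xg0.
pose x := gr_repr (X g); have xg : Fin g <= alpha x := gr_repr_ge (X g).
have XgE : X g = gr_class alpha g x by rewrite gr_reprK.
have xgE : alpha x = Fin g.
  apply/le_anti; rewrite xg andbT leNgt.
  by move: Xg0; rewrite XgE gr_class_eq0.
have x0 : x != 0.
  by apply/eqP => x0; move: xgE; rewrite x0 (vf_filt0 alpha).
have [y [_ b0 vb]] := sd x I x0.
have y0 : y != 0 by apply: contraNneq b0 => ->; rewrite (polar0r hq).
have [d yd] := vf_fin alpha y0.
have yd' : Fin d <= alpha y by rewrite yd.
pose c : gr_piece alpha d := gr_class alpha d y.
have c0 : c != 0 by rewrite gr_class_eq0 //= yd ltxx.
have := X_orth (ds_homog c) => /(congr1 (fun u : gr v => u (g + d))).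
rewrite /gr_polar.
rewrite (eq_fsbigr (fun h => ds_homog (gr_polar_homog q (X h) c))); last first.
  by move=> h _; rewrite ds_supp_homog // fsbig_set1 ds_homogE.
rewrite fsbig_finite; last exact: ds_finite.
rewrite ds_sumE (bigD1_seq g); last 2 first.
- rewrite in_fset_set ?inE //; exact: ds_finite.
- exact: finmap.fset_uniq.
rewrite ds_homogE big1 => [|h hg]; last first.
  by rewrite ds_homog_out // (inj_eq (addIr d)) eq_sym.
rewrite /= addr0 XgE gr_polar_homogE // => /eqP; apply/negP.
rewrite gr_class_eq0 /=; last by rewrite FinD -xgE -yd; apply: prec.1.
by rewrite -leNgt FinD -xgE -yd.
Qed.

(** The rows of the inverse Gram matrix are the coordinates of the dual basis [es]. Self-duality at
    [es i] gives a [y] whose [i]-th coordinate is the pairing; comparing values and cancelling that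
    of the coordinate leaves [- gam i <= alpha (es i)], which the splitting basis turns into bounds
    on the entries. *)
Lemma tame_family_of_norm : nondegenerate_pairing (polar q) ->
  self_dual_on q alpha (fun=> True) -> v_norm alpha ->
  exists (e : 'I_(\dim {:V}) -> V) gam, tame_family v q e gam.
Proof.
move=> nd sd [e0 e0_basis split_e0]; pose e (i : 'I_(\dim {:V})) := e0`_i.
have e0_free := basis_free e0_basis.
have comb_free (c : 'I_(\dim {:V}) -> F) : \sum_i c i *: e i = 0 -> forall i, c i = 0.
  by move: c; apply/freeP.
have e_neq0 i : e i != 0.
  apply/eqP => ei0; suff /(_ i)/eqP : forall j, (j == i)%:R = 0 :> F.
    by rewrite eqxx oner_eq0.
  apply: comb_free; rewrite (bigD1 i) //= ei0 scaler0 add0r big1 // => j /negPf ->.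
  by rewrite scale0r.
have [gam gamE] : {gam : 'I_(\dim {:V}) -> G | forall i, alpha (e i) = Fin (gam i)}.
  exists (fun i => if alpha (e i) is Some g then g else 0) => i.
  by have [g ->] := vf_fin alpha (e_neq0 i).
have e_coord y : exists c : 'I_(\dim {:V}) -> F, y = \sum_i c i *: e i.
  by exists (fun i => coord e0 i y); apply: coord_basis e0_basis (memvf y).
have splitE c i : alpha (\sum_i c i *: e i) <= Fin (gam i) + v (c i).
  rewrite split_e0; apply: le_trans (bigmin_infty_le _ i) _.
  by rewrite vfZ -/(e i) gamE.
pose B := gram q e.
have B_unit : B \in unitmx.
  rewrite -row_free_unit -kermx_eq0; apply/rowV0P => c /sub_kermxP cB.
  apply/rowP => i; rewrite mxE; apply: (comb_free (fun i => c 0 i)).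
  apply: nd => y; have [d ->] := e_coord y.
  rewrite (polar_sumZr hq) big1 // => j _; rewrite (polar_sumZl hq).
  have /rowP/(_ j) := cB; rewrite !mxE => cBj.
  suff -> : \sum_l c 0 l * polar q (e l) (e j) = 0 by rewrite mulr0.
  by rewrite -[RHS]cBj; apply: eq_bigr => l _; rewrite !mxE.
pose C := invmx B; pose es i := \sum_l C i l *: e l.
have esE i j : polar q (es i) (e j) = (i == j)%:R.
  have /matrixP/(_ i j) := mulVmx B_unit; rewrite !mxE => <-.
  by rewrite (polar_sumZl hq); apply: eq_bigr => l _; rewrite mxE.
have es_ge i : Fin (- gam i) <= alpha (es i).
  have es0 : es i != 0.
    apply/eqP => es0; have := esE i i; rewrite es0 (polar0l hq) eqxx => /eqP.
    by rewrite eq_sym oner_eq0.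
  have [y [_ b0 vb]] := sd _ I es0; have [c yE] := e_coord y.
  have bE : polar q (es i) y = c i.
    rewrite yE (polar_sumZr hq) (bigD1 i) //= esE eqxx mulr1 big1 ?addr0 //.
    by move=> j ji; rewrite esE eq_sym (negPf ji) mulr0.
  rewrite bE in b0 vb; have [g vg] := val_fin v b0.
  have vy := splitE c i; rewrite -yE vg in vy.
  have := le_trans vb (leeD (lexx _) vy); rewrite vg addrA.
  by rewrite -{1}[Fin g]add0r leD2r_Fin -[Fin (- _) <= _](leD2r_Fin (gam i)) -FinD addNr.
exists e, gam; split=> [i|i j|].
- by rewrite FinD -!gamE -mulr2n; apply: prec.2.
- by rewrite FinD -!gamE; apply: prec.1.
exists C; first exact: mulmxV.
move=> i j; rewrite -(leD2l_Fin (gam j)) -FinD addrCA subrr addr0.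
exact: le_trans (es_ge i) (splitE _ j).
Qed.

End GradedDuality.

(** * Residue fields and splitting families *)

Lemma algebraic_minimal (F K : fieldType) (iota : {rmorphism F -> K}) (x : K) :
  algebraicOver iota x ->
  exists p : {poly F}, [/\ p != 0, root (map_poly iota p) x & forall r,
    root (map_poly iota r) x -> r != 0 -> (size p <= size r)%N].
Proof.
move=> [p p0 px].
pose P n := `[< exists p : {poly F},
  [/\ p != 0, root (map_poly iota p) x & size p = n] >].
have exP : exists n, P n by exists (size p); apply/asboolP; exists p.
case: (ex_minnP exP) => n /asboolP[r [r0 rx rn]] nmin.
exists r; split=> // s sx s0; rewrite rn; apply: nmin.
by apply/asboolP; exists s.
Qed.

(** Tameness of [K] speaks of abstract finite extensions embedded in [K]; this puts the coordinates
    of a vector over [K] into the image of one of them. It also presents residue fields as finite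
    extensions. *)
Lemma finite_subextension (F K : fieldType) (iota : {rmorphism F -> K})
    (s : seq K) : (forall x, x \in s -> algebraicOver iota x) ->
  exists (L : fieldExtType F) (j : {rmorphism L -> K}),
    (forall a, j a%:A = iota a) /\ forall x, x \in s -> exists y, j y = x.
Proof.
elim: s => [|x s IH] alg.
  exists (F^o : fieldExtType F), (iota : {rmorphism F^o -> K}).
  by split=> // a; congr (iota _); apply: mulr1.
have [|L [j [jF js]]] := IH.
  by move=> y ys; apply: alg; rewrite inE ys orbT.
have alg_x : algebraicOver j x.
  have [p p0 px] := alg x (mem_head _ _); exists (map_poly (in_alg L) p).
    by rewrite map_poly_eq0.
  rewrite -map_poly_comp (eq_map_poly (g := iota)) // => a /=; exact: jF.
have [p [p0 px pmin]] := algebraic_minimal alg_x.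
have irr_p : irreducible_poly p by apply/(subfx_irreducibleP px p0).
pose M : fieldExtType L := SubFieldExtType px irr_p.
pose h : {rmorphism baseFieldType M -> K} := @subfx_inj L K j x p.
exists (baseFieldType M : fieldExtType F), h; split.
  move=> a; rewrite baseField_scaleE; rewrite -jF; exact: subfx_inj_base.
move=> y; rewrite inE => /orP[/eqP->|/js[t <-]].
  by exists (subfx_root j x p); apply: subfx_inj_root.
by exists (t%:A : M); apply: subfx_inj_base.
Qed.

Section Residues.
Variables (F : fieldType) (G : orderedGroupType) (v : valuation F G).
Implicit Types (a b : F) (c : residue_field v).

Let integral a (h : Fin 0 <= v a) : val_ring v := @ValRing F G v a h.

Let residueE a (h : Fin 0 <= v a) :
  residue v a = (\pi_(residue_field v) (integral h))%qT.
Proof. by congr (\pi_(residue_field v) _)%qT; apply: val_inj; rewrite insubdK. Qed.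

Lemma residueD a b : Fin 0 <= v a -> Fin 0 <= v b ->
  residue v (a + b) = residue v a + residue v b.
Proof.
move=> ha hb; have hab : Fin 0 <= v (a + b) by apply: (filtD_ge (f := v)).
rewrite !residueE -(rmorphD \pi_(residue_field v)%qT).
by congr (\pi_(residue_field v) _)%qT; apply: val_inj.
Qed.

Lemma residueM a b : Fin 0 <= v a -> Fin 0 <= v b ->
  residue v (a * b) = residue v a * residue v b.
Proof.
move=> ha hb; have hab : Fin 0 <= v (a * b).
  by rewrite valuationM -[Fin 0](addr0 (Fin 0)); apply: leeD.
rewrite !residueE -(rmorphM \pi_(residue_field v)%qT).
by congr (\pi_(residue_field v) _)%qT; apply: val_inj.
Qed.

Lemma residue1 : residue v 1 = 1.
Proof.
have h1 : Fin 0 <= v 1 by rewrite valuation1.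
rewrite (residueE h1) -(rmorph1 \pi_(residue_field v)%qT).
by congr (\pi_(residue_field v) _)%qT; apply: val_inj.
Qed.

Lemma residue_eq0 a : Fin 0 <= v a -> (residue v a == 0) = (Fin 0 < v a).
Proof.
move=> ha; rewrite (residueE ha).
have -> : (0 : residue_field v) = (\pi_(residue_field v) 0)%qT by rewrite piE.
by rewrite -Quotient.idealrBE unfold_in subr0.
Qed.

Lemma residue0 : residue v 0 = 0.
Proof. by apply/eqP; rewrite residue_eq0 valuation0 ?lee_infty. Qed.

Lemma residueN a : Fin 0 <= v a -> residue v (- a) = - residue v a.
Proof.
move=> ha; have hNa : Fin 0 <= v (- a) by rewrite valuationN.
by apply/eqP; rewrite -addr_eq0 -residueD // addNr residue0.
Qed.

Lemma residue_sum (I : Type) (r : seq I) (P : pred I) (f : I -> F) :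
  (forall i, P i -> Fin 0 <= v (f i)) ->
  residue v (\sum_(i <- r | P i) f i) = \sum_(i <- r | P i) residue v (f i).
Proof.
move=> h; suff [] : Fin 0 <= v (\sum_(i <- r | P i) f i) /\
  residue v (\sum_(i <- r | P i) f i) = \sum_(i <- r | P i) residue v (f i) by [].
elim/big_rec2: _ => [|i y x Pi [vx xy]].
  by rewrite valuation0 residue0 lee_infty.
rewrite residueD ?h // xy; split=> //.
by apply: (filtD_ge (f := v)) => //; apply: h.
Qed.

Lemma val_integralX a n : Fin 0 <= v a -> Fin 0 <= v (a ^+ n).
Proof.
move=> va; elim: n => [|n IH]; first by rewrite expr0 valuation1.
by rewrite exprS valuationM -[Fin 0](addr0 (Fin 0)); apply: leeD.
Qed.

Lemma val_integralM a b : Fin 0 <= v a -> Fin 0 <= v b -> Fin 0 <= v (a * b).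
Proof.
by move=> va vb; rewrite valuationM -[Fin 0](addr0 (Fin 0)); apply: leeD.
Qed.

Lemma residueX a n : Fin 0 <= v a -> residue v (a ^+ n) = residue v a ^+ n.
Proof.
move=> va; elim: n => [|n IH]; first by rewrite !expr0 residue1.
by rewrite !exprS residueM ?IH //; apply: val_integralX.
Qed.

Lemma residue_surj c : exists2 a, Fin 0 <= v a & residue v a = c.
Proof.
exists (val (repr c)); first exact: (valP (repr c)).
by rewrite /residue valKd reprK.
Qed.

Definition residue_lift c : F := sval (cid2 (residue_surj c)).

Lemma residue_lift_ge c : Fin 0 <= v (residue_lift c).
Proof. by rewrite /residue_lift; case: cid2. Qed.

Lemma residue_liftK c : residue v (residue_lift c) = c.
Proof. by rewrite /residue_lift; case: cid2. Qed.

Lemma residue_nat n : residue v n%:R = n%:R.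
Proof.
elim: n => [|n IH]; first by rewrite residue0.
rewrite -natr1 residueD ?IH ?residue1 ?natr1 //; first exact: val_nat_ge0.
by rewrite valuation1.
Qed.

Lemma residue_pchar2 : (2 \in [pchar (residue_field v)]) = (Fin 0 < v 2%:R).
Proof. by rewrite inE /= -residue_nat residue_eq0 // val_nat_ge0. Qed.

End Residues.

Section ResidueMap.
Variables (G : orderedGroupType) (F L : fieldType) (j : {rmorphism F -> L}).
Variables (v : valuation F G) (w : valuation L G).
Hypothesis vw : extends j v w.

Let rho (c : residue_field v) : residue_field w := residue w (j (residue_lift c)).

Let rhoE a : Fin 0 <= v a -> rho (residue v a) = residue w (j a).
Proof.
move=> va; rewrite /rho; set b := residue_lift _.
have vb : Fin 0 <= v b := residue_lift_ge _.
have vab : Fin 0 <= v (b - a) by apply: (filtB_ge (f := v)).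
apply/eqP; rewrite -subr_eq0 -residueN ?vw // -residueD ?valuationN ?vw //.
rewrite -rmorphB residue_eq0 vw // -residue_eq0 // residueD ?valuationN //.
by rewrite residueN // residue_liftK subrr.
Qed.

Lemma residue_map : exists r : {rmorphism residue_field v -> residue_field w},
  forall a, Fin 0 <= v a -> r (residue v a) = residue w (j a).
Proof.
have rho_zmod : zmod_morphism rho.
  move=> x y; have [a va <-] := residue_surj x; have [b vb <-] := residue_surj y.
  rewrite -residueN // -residueD ?valuationN // !rhoE //.
    by rewrite rmorphB residueD ?residueN ?valuationN ?vw.
  by apply: (filtB_ge (f := v)).
have rho_mon : monoid_morphism rho.
  split; first by rewrite -(residue1 v) rhoE ?valuation1 // rmorph1 residue1.
  move=> x y; have [a va <-] := residue_surj x; have [b vb <-] := residue_surj y.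
  by rewrite -residueM // !rhoE ?val_integralM // rmorphM residueM ?vw.
pose m1 := GRing.isZmodMorphism.Build _ _ rho rho_zmod.
pose m2 := GRing.isMonoidMorphism.Build _ _ rho rho_mon.
pose r : {rmorphism residue_field v -> residue_field w} := HB.pack rho m1 m2.
by exists r.
Qed.

End ResidueMap.

Section Splitting.
Variables (G : orderedGroupType) (F L : fieldType) (j : {rmorphism F -> L}).
Variables (v : valuation F G) (w : valuation L G).
Hypothesis vw : extends j v w.

(** Linear independence of the residues over the residue field of [v], phrased with integral
    representatives. *)
Definition residue_independent f (X : 'I_f -> L) :=
  (forall i, Fin 0 <= w (X i)) /\
  forall c : 'I_f -> F, (forall i, Fin 0 <= v (c i)) ->
    Fin 0 < w (\sum_i j (c i) * X i) -> forall i, Fin 0 < v (c i).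

(** The values of the [Y a] represent pairwise distinct cosets of the value group of [v]. *)
Definition coset_distinct e (Y : 'I_e -> L) :=
  (forall a, Y a != 0) /\
  forall a b t, a != b -> t != 0 -> w (Y a) <> w (Y b) + v t.

Lemma residue_independent_le f (X : 'I_f -> L) c i :
  residue_independent X -> w (\sum_i j (c i) * X i) <= v (c i).
Proof.
move=> [_ indep]; have f_gt0 : (0 < f)%N := leq_ltn_trans (leq0n i) (ltn_ord i).
have [i0 i0min] := finite_argmin (fun i => v (c i)) f_gt0.
apply: le_trans (i0min i); case E : (v (c i0)) => [g|]; last exact: lee_infty.
have c0 := val_neq0 E; have vV := valV E.
rewrite leNgt; apply/negP => gt_g.
suff /(_ i0) : forall i, Fin 0 < v ((c i0)^-1 * c i).
  by rewrite mulVf // valuation1 ltxx.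
have vVE : Fin (- g) + Fin g = Fin 0 by rewrite -FinD addNr.
apply: indep => [k|].
  by rewrite valuationM vV -vVE leD2l_Fin -[Fin g]E.
have -> : \sum_k j ((c i0)^-1 * c k) * X k = j (c i0)^-1 * \sum_k j (c k) * X k.
  by rewrite mulr_sumr; apply: eq_bigr => k _; rewrite rmorphM mulrA.
by rewrite valuationM vw vV -vVE ltD2l_Fin.
Qed.

Lemma residue_independent_val f (X : 'I_f -> L) c :
  residue_independent X -> exists t, w (\sum_i j (c i) * X i) = v t.
Proof.
move=> indep; have [f_gt0|] := ltnP 0 f; last first.
  rewrite leqn0 => /eqP f0; exists 0; rewrite valuation0 big1 ?valuation0 //.
  by case=> i lti; exfalso; move: lti; rewrite f0.
have [i imin] := finite_argmin (fun i => v (c i)) f_gt0.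
exists (c i); apply/le_anti; rewrite residue_independent_le //=.
apply: (filt_sum_ge (f := w)) => k _ /=; rewrite valuationM vw.
by apply: le_trans (imin k) _; rewrite -[leLHS]addr0; apply: leeD; [exact: lexx|exact: (indep.1 k)].
Qed.

(** By residue independence each inner sum over [i] has a value attained by [v]. Multiplication by
    the [Y a] moves these values into different cosets, so the outer sum has no ties among finite
    values. *)
Lemma splitting_product f e (X : 'I_f -> L) (Y : 'I_e -> L)
    (c : 'I_f -> 'I_e -> F) i a :
  residue_independent X -> coset_distinct Y ->
  w (\sum_a \sum_i j (c i a) * X i * Y a) <= v (c i a) + w (Y a).
Proof.
move=> indep [Y0 dist].
under eq_bigr => b _ do rewrite -mulr_suml.
have le_a : w ((\sum_i j (c i a) * X i) * Y a) <= v (c i a) + w (Y a).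
  by rewrite valuationM leeD // (@residue_independent_le _ _ (fun i => c i a)).
apply: le_trans le_a.
apply: (filt_sum_distinct (f := w) (x := fun b => (\sum_i j (c i b) * X i) * Y b)).
move=> b b' bb' /=; rewrite !valuationM.
have [t ->] := residue_independent_val (fun i => c i b) indep.
have [s ->] := residue_independent_val (fun i => c i b') indep.
have [-> |t0] := eqVneq t 0; first by rewrite valuation0.
have [-> |s0] := eqVneq s 0.
  rewrite valuation0 => E; exact: E.
have [g gE] := val_fin v t0; have gV := valV gE => E.
have ts0 : s * t^-1 != 0 by rewrite mulf_neq0 ?invr_neq0.
exfalso; apply: (dist b b' (s * t^-1) bb' ts0).
rewrite valuationM gV addrA [w (Y b') + _]addrC -E gE addrAC -FinD subrr.
by rewrite [RHS]add0r.
Qed.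

Lemma residue_independent_unit f (X : 'I_f -> L) i :
  residue_independent X -> w (X i) = Fin 0.
Proof.
move=> indep; apply/le_anti; rewrite [X in _ && X](indep.1 i) andbT.
have := residue_independent_le (fun k => (k == i)%:R) i indep.
rewrite eqxx valuation1 (bigD1 i) //= eqxx rmorph1 mul1r big1 ?addr0 //.
by move=> k /negPf ->; rewrite rmorph0 mul0r.
Qed.

End Splitting.

Section ResidueLifts.
Variables (G : orderedGroupType) (F L : fieldType) (j : {rmorphism F -> L}).
Variables (v : valuation F G) (w : valuation L G).
Hypothesis vw : extends j v w.
Variables (E : fieldExtType (residue_field v)).
Variable phi : {rmorphism E -> residue_field w}.
Hypothesis phiE : forall a, Fin 0 <= v a -> phi (residue v a)%:A = residue w (j a).
Variables (f : nat) (X : 'I_f -> L) (b : 'I_f -> E).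
Hypotheses (X_ge : forall i, Fin 0 <= w (X i)).
Hypothesis Xb : forall i, residue w (X i) = phi (b i).

Lemma residue_comb (c : 'I_f -> F) : (forall i, Fin 0 <= v (c i)) ->
  residue w (\sum_i j (c i) * X i) = phi (\sum_i residue v (c i) *: b i).
Proof.
move=> vc; rewrite residue_sum => [|i _]; last by rewrite val_integralM ?vw.
rewrite rmorph_sum; apply: eq_bigr => i _.
by rewrite residueM ?vw // Xb -phiE // -rmorphM mulr_algl.
Qed.

Lemma lift_residue_independent :
  (forall c, \sum_i c i *: b i = 0 -> forall i, c i = 0) ->
  residue_independent j v w X.
Proof.
move=> b_free; split=> // c vc pos i.
have sum_ge : Fin 0 <= w (\sum_i j (c i) * X i) by apply: ltW.
rewrite -residue_eq0 //; apply/eqP/(b_free (fun i => residue v (c i))).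
by apply/eqP; rewrite -(fmorph_eq0 phi) -residue_comb // residue_eq0.
Qed.

Lemma lift_residue_spanning : (forall y, exists c, y = \sum_i c i *: b i) ->
  bijective phi -> forall x, Fin 0 <= w x ->
  exists2 c : 'I_f -> F, (forall i, Fin 0 <= v (c i))
    & Fin 0 < w (x - \sum_i j (c i) * X i).
Proof.
move=> b_span [psi _ phiK] x wx; have [c cE] := b_span (psi (residue w x)).
exists (fun i => residue_lift (c i)) => [i|]; first exact: residue_lift_ge.
have c_ge i : Fin 0 <= v (residue_lift (c i)) := residue_lift_ge _.
have sum_ge : Fin 0 <= w (\sum_i j (residue_lift (c i)) * X i).
  by apply: (filt_sum_ge (f := w)) => i _; rewrite /= val_integralM ?vw.
rewrite -residue_eq0; last exact: (filtB_ge (f := w)).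
rewrite residueD ?valuationN // residueN // residue_comb //.
under eq_bigr do rewrite residue_liftK.
by rewrite -cE phiK subrr.
Qed.

End ResidueLifts.

(** * Cosets of odd index and splitting bases stable under squaring *)

Lemma even_fixfree_involution (T : finType) (s : T -> T) :
  involutive s -> (forall x, s x != x) -> ~~ odd #|T|.
Proof.
move=> sK sx.
pose A := [set x | (enum_rank x < enum_rank (s x))%N].
have cardC : #|~: A| = #|A|.
  rewrite -(card_imset A (inv_inj sK)); congr #|pred_of_set _|.
  apply/setP => x; apply/idP/imsetP => [|[y]].
    rewrite !inE -leqNgt leq_eqVlt => /orP[/eqP/val_inj/enum_rank_inj E|lt].
      by have := sx x; rewrite E eqxx.
    by exists (s x); rewrite ?inE sK.
  by rewrite !inE => lt ->; rewrite sK -leqNgt ltnW.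
by rewrite -(cardsC A) cardC addnn odd_double.
Qed.

(** Otherwise translation by [g] would permute the [e] cosets as an involution without fixed points,
    and [e] would be even. *)
Lemma odd_index_double (G : orderedGroupType) (A B : classical_sets.set G) e g :
  (forall x y, A x -> A y -> A (x + y)) ->
  (forall x y, B x -> B y -> B (x + y)) -> (forall x, B x -> B (- x)) ->
  has_index A B e -> odd e -> A g -> B (g + g) -> B g.
Proof.
move=> AD BD BN [r Ar idx] odd_e Ag Bgg; apply: contrapT => nBg.
have sex i : exists k, B (r i + g - r k).
  by have [k [kP _]] := idx _ (AD _ _ (Ar i) Ag); exists k.
pose s i := sval (cid (sex i)).
have sP i : B (r i + g - r (s i)) by rewrite /s; case: cid.
have uniq x i k : A x -> B (x - r i) -> B (x - r k) -> i = k.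
  by move=> Ax Bi Bk; have [l [_ lP]] := idx x Ax; rewrite -(lP i Bi) -(lP k Bk).
suff : ~~ odd e by rewrite odd_e.
rewrite -[e]card_ord; apply: (@even_fixfree_involution _ s) => [i|i].
  apply/esym; apply: (uniq (r i)); first exact: Ar.
    have B0 : B (g + g - (g + g)) by apply: BD => //; apply: BN.
    by rewrite !subrr in B0 *.
  have h := BD _ _ (BD _ _ (sP i) (sP (s i))) (BN _ Bgg).
  suff <- : r i + g - r (s i) + (r (s i) + g - r (s (s i))) - (g + g)
    = r i - r (s (s i)) by [].
  set a := r i; set b := r (s i); set c := r (s (s i)).
  have -> : a + g - b + (b + g - c) = a - c + (g + g).
    by rewrite !addrA subrK -!addrA; congr (_ + _); rewrite addrA addrC.
  by rewrite addrK.
apply/eqP => E; apply: nBg; have := sP i; rewrite E.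
by rewrite addrAC subrr add0r.
Qed.

Section TameSplittingBasis.
Variables (G : orderedGroupType) (F : fieldType) (L : fieldExtType F).
Variables (v : valuation F G) (w : valuation L G).
Hypothesis vw : extends (GRing.in_alg L) v w.

(** The half of the norm condition that the ultrametric inequality does not supply. *)
Definition splitting (I : finType) (l : I -> L) :=
  forall (c : I -> F) i, w (\sum_i c i *: l i) <= v (c i) + w (l i).

Lemma splitting_free (I : finType) (l : I -> L) : (forall i, l i != 0) ->
  splitting l -> free [tuple l (enum_val i) | i < #|I|].
Proof.
move=> l0 spl; apply/freeP => c c0 i; apply/(valuation_eq_infty v)/eqP.
have := spl (fun i => c (enum_rank i)) (enum_val i).
have -> : \sum_i c (enum_rank i) *: l i = 0.
  rewrite (reindex _ (onW_bij _ (enum_val_bij _))) -[RHS]c0.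
  by apply: eq_bigr => k _; rewrite enum_valK -tnth_nth tnth_mktuple.
rewrite valuation0 enum_valK; have [g ->] := val_fin w (l0 (enum_val i)).
by case: (v (c i)).
Qed.

Lemma splitting_spanning (I : finType) (l : I -> L) : (forall i, l i != 0) ->
  splitting l -> (\dim {:L} <= #|I|)%N ->
  forall z, exists c : I -> F, z = \sum_i c i *: l i.
Proof.
move=> l0 spl dimL z; pose X := [tuple l (enum_val i) | i < #|I|].
have X_basis : basis_of fullv X.
  by rewrite basisEfree splitting_free // subvf size_tuple.
exists (fun i => coord X (enum_rank i) z).
rewrite {1}(coord_basis X_basis (memvf z)).
rewrite [RHS](reindex _ (onW_bij _ (enum_val_bij _))).
by apply: eq_bigr => i _; rewrite enum_valK -tnth_nth tnth_mktuple.
Qed.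

Lemma splitting_card (I : finType) (l : I -> L) : (forall i, l i != 0) ->
  splitting l -> (#|I| <= \dim {:L})%N.
Proof.
move=> l0 spl; have := dimvS (subvf <<[tuple l (enum_val i) | i < #|I|]>>).
by have := splitting_free l0 spl; rewrite /free size_tuple => /eqP ->.
Qed.

Lemma splitting_pairs f e (X : 'I_f -> L) (Y : 'I_e -> L) :
  residue_independent (GRing.in_alg L) v w X -> coset_distinct v w Y ->
  splitting (fun p : 'I_f * 'I_e => X p.1 * Y p.2).
Proof.
move=> X_indep Y_dist c [i a] /=.
rewrite valuationM (residue_independent_unit vw i X_indep) add0r.
have := splitting_product vw (fun i a => c (i, a)) i a X_indep Y_dist.
rewrite exchange_big pair_bigA /=; congr (_ <= _); congr (valuation_fun w _).
by apply: eq_bigr => -[k d] _ /=; rewrite -mulrA mulr_algl.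
Qed.

Lemma value_groupD x y : value_group v x -> value_group v y -> value_group v (x + y).
Proof. by move=> [a va] [b vb]; exists (a * b); rewrite valuationM va vb. Qed.

Lemma value_groupN x : value_group v x -> value_group v (- x).
Proof. by move=> [a va]; exists a^-1; apply: valV. Qed.

End TameSplittingBasis.

(* In residual characteristic 2, separability of the residue extension and
   oddness of the ramification index make squaring preserve splitting bases. *)
Lemma tame_splitting_squares (G : orderedGroupType) (F : fieldType)
    (L : fieldExtType F) (v : valuation F G) (w : valuation L G) :
  extends (GRing.in_alg L) v w -> Fin 0 < v 2%:R -> tame_finite v w ->
  exists (I : finType) (l : I -> L), [/\ forall i, l i != 0, splitting v w l,
    splitting v w (fun i => l i ^+ 2)
    & forall z, exists c : I -> F, z = \sum_i c i *: l i].
Proof.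
move=> vw v2 [E [phi [e [[phi_bij phiE] sep idx pe dimL]]]].
have [psi phiK psiK] := phi_bij.
have p2 : 2 \in [pchar residue_field v] by rewrite residue_pchar2.
have odd_e : odd e by have := pe _ p2; rewrite dvdn2 negbK.
pose f : nat := \dim {:E}; pose b (i : 'I_f) := (vbasis {:E})`_i.
have b_free (c : 'I_f -> _) : \sum_i c i *: b i = 0 -> forall i, c i = 0.
  by move: c; apply/freeP/basis_free/vbasisP.
have b_span y : exists c : 'I_f -> _, y = \sum_i c i *: b i.
  by exists (fun i => coord (vbasis {:E}) i y); apply: coord_vbasis (memvf y).
have p2E : 2 \in [pchar E] by rewrite pchar_lalg.
pose b2 := [tuple b i ^+ 2 | i < f].
have b2_span (y : E) : y \in <<b2>>%VS.
  have sq_mem (z : E) : z ^+ 2 \in <<b2>>%VS.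
    have [c ->] := b_span z; rewrite -(pFrobenius_autE p2E) rmorph_sum.
    apply: memv_suml => i _; rewrite /= pFrobenius_autE exprZn memvZ //.
    by apply: memv_span; apply/mapP; exists i; rewrite ?mem_enum.
  (* In characteristic 2, separability places [y] in the field generated by [y ^+ 2], so [y] is a
     combination of squares, and Frobenius expands each square over the squares of the basis. *)
  have : separable_element 1 y by move/separableP: sep; apply; apply: memvf.
  rewrite (pcharf_p_separable 1 y 0 p2E) => /Fadjoin_polyP[p /polyOverP p1 ->].
  rewrite horner_coef; apply: memv_suml => i _.
  have /vlineP[a ->] := p1 i; rewrite -scalerAl mul1r memvZ // -exprM mulnC.
  by rewrite exprM.
have b2_free (c : 'I_f -> _) : \sum_i c i *: b i ^+ 2 = 0 -> forall i, c i = 0.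
  have T_basis : basis_of fullv b2.
    by rewrite basisEdim size_tuple leqnn andbT; apply/subvP => y _.
  have /freeP b2_free := basis_free T_basis.
  move=> c0; apply: b2_free; rewrite -[RHS]c0.
  by apply: eq_bigr => i _; rewrite -tnth_nth tnth_mktuple.
pose X i := residue_lift (phi (b i)).
have X_ge i : Fin 0 <= w (X i) := residue_lift_ge _.
have X_indep : residue_independent (in_alg L) v w X.
  apply: (lift_residue_independent vw phiE) b_free => // i.
  exact: residue_liftK.
have X2_indep : residue_independent (in_alg L) v w (fun i => X i ^+ 2).
  apply: (lift_residue_independent vw phiE) b2_free => i.
    exact: val_integralX.
  by rewrite residueX // residue_liftK rmorphXn.
have [r rL r_idx] := idx.
pose Y i := sval (cid (rL i)); have YE i : w (Y i) = Fin (r i).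
  by rewrite /Y; case: cid.
have Y0 i : Y i != 0 := val_neq0 (YE i).
have r_eq i k : value_group v (r i - r k) -> i = k.
  move=> ik; have [l [_ lP]] := r_idx (r i) (rL i); rewrite -(lP k ik).
  by apply/esym/lP; rewrite subrr; exists 1; rewrite valuation1.
have Y_dist : coset_distinct v w Y.
  split=> // i k t ik t0; rewrite !YE; have [g gE] := val_fin v t0.
  rewrite gE -FinD => -[] rE; move/eqP: ik; apply; apply: r_eq.
  by exists t; rewrite gE rE addrAC subrr add0r.
(* A coincidence of cosets after squaring puts twice [r i - r k] in the value group of [v]; the odd
   index then puts [r i - r k] itself there. *)
have Y2_dist : coset_distinct v w (fun i => Y i ^+ 2).
  split=> [i|i k t ik t0]; first by rewrite expf_neq0.
  rewrite !valX2 !YE; have [g gE] := val_fin v t0.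
  rewrite gE -!FinD => -[] rE; move/eqP: ik; apply; apply: r_eq.
  apply: (odd_index_double _ _ _ idx odd_e).
  - move=> x y [a va] [c vc]; exists (a * c); rewrite valuationM va vc //.
  - exact: value_groupD.
  - exact: value_groupN.
  - have [a va] := rL i; have [c vc] := rL k; exists (a * c^-1).
    by rewrite valuationM va (valV vc).
  - by exists t; rewrite gE addrACA -opprD rE addrAC subrr add0r.
exists ('I_f * 'I_e)%type, (fun p => X p.1 * Y p.2).
have X0 i : X i != 0 := val_neq0 (residue_independent_unit vw i X_indep).
have spl := splitting_pairs vw X_indep Y_dist.
have spl2 := splitting_pairs vw X2_indep Y2_dist.
split=> // [[i a]||] /=; first by rewrite mulf_neq0.
  move=> c p; have := spl2 c p; rewrite -exprMn; congr (_ <= _).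
  by congr (valuation_fun w _); apply: eq_bigr => s _; rewrite exprMn.
apply: (splitting_spanning _ spl) => [[i a]|]; first by rewrite mulf_neq0.
by rewrite dimL card_prod !card_ord.
Qed.

(** * From hyperbolicity to tame norms *)

Section BaseChangeForm.
Variables (F K : fieldType) (iota : {rmorphism F -> K}) (V : vectType F).
Variable q : V -> F.
Hypothesis hq : quadratic_form q.

Local Notation n := (\dim {:V}).
Local Notation qK := (base_change iota q).

(** An upper triangular matrix of the form, with [q] on the diagonal, instead of the symmetric Gram
    matrix: this works without dividing by 2. *)
Let M : 'M[K]_n := \matrix_(i, j) iota
  (if i == j then q (vbasis {:V})`_i
   else if (i < j)%N then polar q (vbasis {:V})`_i (vbasis {:V})`_j else 0).

Let base_change_mx x : qK x = (x *m M *m x^T) 0 0.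
Proof.
rewrite !mxE /base_change -big_split /=.
under [RHS]eq_bigr => j _ do rewrite !mxE mulr_suml.
rewrite exchange_big /=; apply: eq_bigr => i _.
rewrite [RHS](bigD1 i) //= !mxE eqxx; congr (_ + _); first by rewrite expr2; ring.
rewrite big_mkcond [RHS]big_mkcond; apply: eq_bigr => j _ /=.
rewrite !mxE; case: ltngtP => [ij|ji|/val_inj ->]; last by rewrite eqxx.
  have -> : j != i by apply: contraTneq ij => ->; rewrite ltnn.
  rewrite (_ : (i == j) = false); first by ring.
  by apply: contraTF ij => /eqP ->; rewrite ltnn.
rewrite (_ : (i == j) = false); first by case: ifP => // _; rewrite rmorph0; ring.
by apply: contraTF ji => /eqP ->; rewrite ltnn.
Qed.

Let base_change_polar x y :
  polar qK x y = (x *m M *m y^T) 0 0 + (y *m M *m x^T) 0 0.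
Proof.
rewrite /polar !base_change_mx linearD /= !mulmxDl !mulmxDr.
by rewrite ![(_ + _ : 'M_(_, _)) 0 0]mxE; ring.
Qed.

Lemma base_change_quadratic : quadratic_form qK.
Proof.
apply: quadratic_form_of => [a x|x y z|a x y].
- rewrite !base_change_mx linearZ /= -!scalemxAl -scalemxAr !mxE; ring.
- rewrite !base_change_polar linearD /= !mulmxDl !mulmxDr.
  by rewrite ![(_ + _ : 'M_(_, _)) 0 0]mxE; ring.
- rewrite !base_change_polar linearZ /= -!scalemxAl -scalemxAr.
  by rewrite ![(_ *: _ : 'M_(_, _)) 0 0]mxE; ring.
Qed.

Definition embed (x : V) : 'rV[K]_n := \row_i iota (coord (vbasis {:V}) i x).

Lemma embedD x y : embed (x + y) = embed x + embed y.
Proof. by apply/rowP => i; rewrite !mxE linearD rmorphD. Qed.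

Lemma embedZ a x : embed (a *: x) = iota a *: embed x.
Proof. by apply/rowP => i; rewrite !mxE linearZ rmorphM. Qed.

Lemma embed0 : embed 0 = 0.
Proof. by apply/rowP => i; rewrite !mxE linear0 rmorph0. Qed.

Lemma embed_sum (I : Type) (r : seq I) (P : pred I) (x : I -> V) :
  embed (\sum_(i <- r | P i) x i) = \sum_(i <- r | P i) embed (x i).
Proof. exact: (big_morph embed embedD embed0). Qed.

Lemma embed_eq0 x : embed x = 0 -> x = 0.
Proof.
move=> /rowP x0; rewrite (coord_vbasis (memvf x)) big1 // => i _.
by have := x0 i; rewrite !mxE => /eqP; rewrite fmorph_eq0 => /eqP ->; rewrite scale0r.
Qed.

Lemma embed_q x : qK (embed x) = iota (q x).
Proof. exact: base_changeE. Qed.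

Lemma embed_polar x y : polar qK (embed x) (embed y) = iota (polar q x y).
Proof. by rewrite /polar -embedD !embed_q !rmorphB. Qed.

Lemma embed_span (z : 'rV[K]_n) : z = \sum_i z 0 i *: embed (vbasis {:V})`_i.
Proof.
apply/rowP => k; rewrite summxE (bigD1 k) //= !mxE coord_free ?(basis_free (vbasisP _)) //.
rewrite eqxx rmorph1 mulr1 big1 ?addr0 // => i ik; rewrite !mxE.
by rewrite coord_free ?(basis_free (vbasisP _)) // (negPf ik) rmorph0 mulr0.
Qed.

Variables (G : orderedGroupType) (v : valuation F G) (w : valuation K G).
Hypothesis vw : extends iota v w.

Lemma embed_tame_family k (e : 'I_k -> V) gam : tame_family v q e gam ->
  tame_family w qK (fun i => embed (e i)) gam.
Proof.
move=> [eq1 eb [C BC vC]]; split=> [i|i j|].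
- by rewrite embed_q vw.
- by rewrite embed_polar vw.
exists (map_mx iota C) => [|i j]; last by rewrite mxE vw.
have -> : gram qK (fun i => embed (e i)) = map_mx iota (gram q e).
  by apply/matrixP => i j; rewrite !mxE embed_polar.
by rewrite -map_mxM BC map_mx1.
Qed.

End BaseChangeForm.

(** The standard symplectic-looking basis with all values 0 works: its Gram matrix is integral and
    its own inverse. *)
Lemma hyperbolic_tame (K : fieldType) (G : orderedGroupType) (w : valuation K G)
    (W : lmodType K) (q : W -> K) : quadratic_form q -> hyperbolic q ->
  exists k (e : 'I_k -> W) gam, tame_family w q e gam /\
    forall z, (forall i, polar q z (e i) = 0) -> z = 0.
Proof.
move=> hq [m [f [[g gK fK] fE]]].
have polE x y x' y' : polar q (f (x, y)) (f (x', y')) =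
    \sum_(i < m) (x 0 i * y' 0 i + x' 0 i * y 0 i).
  rewrite /polar -raddfD /= !fE -!sumrB; apply: eq_bigr => i _.
  by rewrite !mxE; ring.
pose d i : 'rV[K]_m := delta_mx 0 i.
have sum_d (c : 'rV[K]_m) i : \sum_k c 0 k * d i 0 k = c 0 i.
  rewrite (bigD1 i) //= mxE !eqxx mulr1 big1 ?addr0 // => k ki.
  by rewrite mxE eqxx (negPf ki) mulr0.
pose e (i : 'I_(m + m)) : W :=
  match split i with inl j => f (d j, 0) | inr j => f (0, d j) end.
have el i : e (lshift m i) = f (d i, 0).
  by rewrite /e; case: splitP => [j /= /val_inj -> //|j /= E];
    have := ltn_ord i; rewrite E ltnNge leq_addr.
have er i : e (rshift m i) = f (0, d i).
  rewrite /e; case: splitP => [j /= E|j /= /addnI /val_inj -> //].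
  by have := ltn_ord j; rewrite -E ltnNge leq_addr.
have pol_l x y i : polar q (f (x, y)) (e (lshift m i)) = y 0 i.
  rewrite el polE -[RHS]sum_d; apply: eq_bigr => k _.
  by rewrite [(0 : 'rV_m) _ _]mxE mulr0 add0r mulrC.
have pol_r x y i : polar q (f (x, y)) (e (rshift m i)) = x 0 i.
  rewrite er polE -[RHS]sum_d; apply: eq_bigr => k _.
  by rewrite [(0 : 'rV_m) _ _]mxE mul0r addr0.
have gramE : gram q e = block_mx 0 1%:M 1%:M 0.
  apply/matrixP => i j; rewrite mxE.
  case: (split_ordP i) => i' ->; case: (split_ordP j) => j' ->;
    rewrite ?block_mxEul ?block_mxEur ?block_mxEdl ?block_mxEdr.
  + by rewrite {1}el pol_l !mxE.
  + by rewrite {1}el pol_r !mxE eqxx eq_sym.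
  + by rewrite {1}er pol_l !mxE eqxx eq_sym.
  + by rewrite {1}er pol_r !mxE.
have v01 (b : bool) : Fin 0 <= w b%:R by apply: val_nat_ge0.
exists (m + m)%N, e, (fun=> 0); split; last first.
  move=> z ze; rewrite -[z]fK; case E : (g z) => [x y].
  have zE : z = f (x, y) by rewrite -E fK.
  have x0 : x = 0 by apply/rowP => i; rewrite mxE -(pol_r x y) -zE.
  have y0 : y = 0 by apply/rowP => i; rewrite mxE -(pol_l x y) -zE.
  by rewrite x0 y0 (_ : (0, 0) = 0) // raddf0.
split=> [i|i j|].
- rewrite addr0; case: (split_ordP i) => i' ->; rewrite ?el ?er fE big1 ?valuation0 //;
    by move=> k _; rewrite [(0 : 'rV_m) _ _]mxE ?mulr0 ?mul0r.
- have /matrixP/(_ i j) := gramE; rewrite mxE addr0 => ->.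
  case: (split_ordP i) => i' ->; case: (split_ordP j) => j' ->;
    by rewrite ?block_mxEul ?block_mxEur ?block_mxEdl ?block_mxEdr !mxE ?v01
       ?valuation0.
exists (block_mx 0 1%:M 1%:M 0).
  by rewrite gramE mulmx_block !mulmx0 !mul0mx !mul1mx !addr0 !add0r -scalar_mx_block.
move=> i j; rewrite subr0 oppr0.
case: (split_ordP i) => i' ->; case: (split_ordP j) => j' ->;
  by rewrite ?block_mxEul ?block_mxEur ?block_mxEdl ?block_mxEdr !mxE ?v01
     ?valuation0.
Qed.

Section ValuationPullback.
Variables (F K : fieldType) (j : {rmorphism F -> K}) (G : orderedGroupType).
Variable w : valuation K G.

Fact pullback_eq_infty x : w (j x) = infty <-> x = 0.
Proof.
split=> [/valuation_eq_infty/eqP|->]; first by rewrite fmorph_eq0 => /eqP.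
by rewrite rmorph0 valuation0.
Qed.

Fact pullbackM x y : w (j (x * y)) = w (j x) + w (j y).
Proof. by rewrite rmorphM valuationM. Qed.

Fact pullbackD x y : Num.min (w (j x)) (w (j y)) <= w (j (x + y)).
Proof. by rewrite rmorphD valuationD. Qed.

Definition valuation_pullback : valuation F G :=
  @Valuation F G (fun x => w (j x)) pullback_eq_infty pullbackM pullbackD.

End ValuationPullback.

Lemma fieldExt_algebraic (F : fieldType) (L : fieldExtType F) :
  algebraic_extension (GRing.in_alg L).
Proof.
move=> z; have /polyOver1P[p pE] := minPolyOver 1%AS z.
exists p; last by rewrite -pE root_minPoly.
by rewrite -(map_poly_eq0 (in_alg L)) -pE monic_neq0 // monic_minPoly.
Qed.

Section Orthogonal.
Variables (F : fieldType) (V : vectType F) (q : V -> F).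
Hypothesis hq : quadratic_form q.
Variables (k : nat) (e : 'I_k -> V) (C : 'M[F]_k).
Hypothesis BC : gram q e *m C = 1%:M.

Lemma orthogonal_projection y :
  exists t : 'I_k -> F, forall i, polar q (y - \sum_l t l *: e l) (e i) = 0.
Proof.
pose b : 'rV[F]_k := \row_i polar q y (e i).
have CB := mulmx1C BC.
exists (fun l => (b *m C) 0 l) => i.
rewrite (polarBl hq) (polar_sumZl hq).
have -> : \sum_l (b *m C) 0 l * polar q (e l) (e i) = b 0 i.
  rewrite -[b in RHS]mulmx1 -CB mulmxA [RHS]mxE.
  by apply: eq_bigr => l _; rewrite [gram _ _ _ _]mxE.
by rewrite mxE subrr.
Qed.

Lemma orthogonal_nondegenerate z : nondegenerate_pairing (polar q) ->
  z != 0 -> (forall i, polar q z (e i) = 0) ->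
  exists2 y, forall i, polar q y (e i) = 0 & polar q z y != 0.
Proof.
move=> nd z0 ze; have [y0 zy0] : exists y, polar q z y != 0.
  apply: contrapT => h; move/eqP: z0; apply; apply: nd => y.
  by apply/eqP; apply: contrapT => /negP zy; apply: h; exists y.
have [t tP] := orthogonal_projection y0; exists (y0 - \sum_l t l *: e l) => //.
rewrite (polarBr hq) (polar_sumZr hq) big1 ?subr0 // => l _.
by rewrite ze mulr0.
Qed.

End Orthogonal.

Lemma qform_cross_gt (F : fieldType) (G : orderedGroupType) (v : valuation F G)
    (V : lmodType F) (q : V -> F) (I : Type) (r : seq I) (u : I -> V)
    (g : with_infty G) : quadratic_form q -> g != infty ->
  (forall i k, g < v (polar q (u i) (u k))) ->
  g < v (q (\sum_(i <- r) u i) - \sum_(i <- r) q (u i)).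
Proof.
move=> hq g_fin gu; elim: r => [|i r IH].
  by rewrite !big_nil (qform0 hq) subrr valuation0 lte_infty.
rewrite !big_cons qformD.
set s := \sum_(k <- r) u k; set t := \sum_(k <- r) q (u k).
have -> : q (u i) + q s + polar q (u i) s - (q (u i) + t)
  = (q s - t) + polar q (u i) s by ring.
apply: (filtD_gt (f := v)) => //=; rewrite (polar_sumr hq).
by apply: (filt_sum_gt (f := v)) => // a _; apply: gu.
Qed.

(** * The wild part over a tame extension *)

Section WildPart.
Variables (G : orderedGroupType) (F : fieldType) (v : valuation F G).
Variables (V : vectType F) (q : V -> F).
Hypotheses (hen : henselian v) (hq : quadratic_form q).
Hypotheses (v2 : Fin 0 < v 2%:R).
Variables (k : nat) (e : 'I_k -> V) (gam : 'I_k -> G).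
Hypothesis tame_e : tame_family v q e gam.

Local Notation orth x := (forall i, polar q x (e i) = 0).

Hypothesis wild : forall x y, orth x -> orth y -> polar q x y != 0 ->
  v (q x) + v (q y) < v (polar q x y) + v (polar q x y).
Hypothesis aniso : forall x, orth x -> x != 0 -> q x != 0.

(** A partner [t] of [z] over [K] is written as a combination of vectors [x a] of [V] with
    coefficients in a splitting basis. The values of [q t] and of its pairing with [z] are then
    compared with those at a single [x a], where [wild] contradicts the inequality given by
    cancellation. *)
Lemma wild_not_hyperbolic (K : fieldType) (iota : {rmorphism F -> K}) z :
  tame_extension v iota -> hyperbolic (base_change iota q) -> orth z -> z = 0.
Proof.
move=> [alg tame] hyp ze; apply/eqP/negP => /negP z0.
have [w vw _] := hen alg.
pose qK := base_change iota q.
have hqK : quadratic_form qK by apply: base_change_quadratic.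
have [m [d [del [tame_d full_d]]]] := hyperbolic_tame w hqK hyp.
pose emb := embed iota (V := V).
have polE x y : polar qK (emb x) (emb y) = iota (polar q x y).
  exact: embed_polar.
have tame_eK : tame_family w qK (fun i => emb (e i)) gam.
  exact: embed_tame_family.
have emb_z0 : emb z != 0 by apply: contra z0 => /eqP /embed_eq0 ->.
have emb_ze i : polar qK (emb z) (emb (e i)) = 0 by rewrite polE ze rmorph0.
have [t [te zt0 zt_le]] := orthogonal_partner hqK
  (dual_norm_prec hqK tame_d full_d) (dual_norm_self_dual hqK tame_d full_d)
  tame_eK emb_z0 emb_ze.
have [L [j [jF js]]] := finite_subextension (s := [seq t 0 i | i <- enum 'I_(\dim {:V})])
  (fun x _ => alg x).
have [wL vwL tameL] := tame L j jF.
(* Tameness supplies its own valuation on [L]; uniqueness identifies it with the restriction of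
   [w]. *)
have wjE y : w (j y) = wL y.
  have [w0 _ uniq] := hen (@fieldExt_algebraic F L).
  have ext : extends (GRing.in_alg L) v (valuation_pullback j w).
    by move=> a; rewrite /= jF vw.
  by rewrite -[LHS]/(valuation_pullback j w y) (uniq _ ext) (uniq _ vwL).
have [I [l [l0 spl spl2 span]]] := tame_splitting_squares vwL v2 tameL.
have tj i : exists y, j y = t 0 i.
  by apply: js; apply/mapP; exists i; rewrite ?mem_enum.
pose y i := sval (cid (tj i)); have yE i : j (y i) = t 0 i by rewrite /y; case: cid.
pose c i := sval (cid (span (y i))).
have cE i : y i = \sum_a c i a *: l a by rewrite /c; case: cid.
pose x a := \sum_i c i a *: (vbasis {:V})`_i.
pose u a := j (l a) *: emb (x a).
have jZ a y0 : j (a *: y0) = iota a * j y0 by rewrite -mulr_algl rmorphM jF.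
have tE : t = \sum_a u a.
  rewrite (embed_span iota t) /u.
  under [RHS]eq_bigr => a _ do rewrite /x /emb embed_sum scaler_sumr.
  rewrite exchange_big; apply: eq_bigr => i _ /=.
  rewrite -yE cE rmorph_sum scaler_suml; apply: eq_bigr => a _.
  by rewrite jZ embedZ scalerA mulrC.
have sumE (s : I -> F) : \sum_a iota (s a) * j (l a) = j (\sum_a s a *: l a).
  rewrite rmorph_sum; apply: eq_bigr => a _.
  by rewrite jZ.
have pol_t s : polar qK (emb s) t = j (\sum_a polar q s (x a) *: l a).
  rewrite tE -sumE (polar_sumr hqK); apply: eq_bigr => a _.
  rewrite (polarZr hqK) polE; exact: mulrC.
(* Orthogonality of [t] to [e i] is a vanishing combination of the [l a] over [F], and a splitting
   family admits only the trivial one. *)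
have xe a : orth (x a).
  move=> i; apply/(valuation_eq_infty v)/eqP.
  have := spl (fun a => polar q (x a) (e i)) a.
  have -> : \sum_a polar q (x a) (e i) *: l a = 0.
    apply/eqP; rewrite -(fmorph_eq0 j); apply/eqP; rewrite -[RHS](te i) polarC pol_t.
    by congr (j _); apply: eq_bigr => b _; rewrite polarC.
  rewrite valuation0; have [g ->] := val_fin wL (l0 a).
  by case: (v _).
have qu a : qK (u a) = iota (q (x a)) * j (l a ^+ 2).
  have qE : qK (emb (x a)) = iota (q (x a)) by exact: embed_q.
  by rewrite [LHS](qformZ hqK) qE rmorphXn; apply: mulrC.
pose S := \sum_a qK (u a).
have SE : S = j (\sum_a q (x a) *: l a ^+ 2).
  rewrite rmorph_sum; apply: eq_bigr => a _.
  by rewrite qu jZ.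
(* Since the squares [l a ^+ 2] split the valuation, the terms of [S] cannot cancel. *)
have S_le a : w S <= v (q (x a)) + (wL (l a) + wL (l a)).
  by rewrite SE wjE -valX2; apply: spl2.
have S_fin : w S != infty.
  apply: contra zt0 => /eqP S_inf.
  suff -> : t = 0 by rewrite (polar0r hqK).
  rewrite tE big1 // => a _; rewrite /u; suff -> : x a = 0.
    by rewrite [emb _]embed0 scaler0.
  apply/eqP/negP => /negP xa0; have := S_le a; rewrite S_inf.
  have [g ->] := val_fin v (aniso (xe a) xa0).
  by have [h ->] := val_fin wL (l0 a).
(* Each cross term is compared with the terms of [S] of indices [a] and [b] through [wild]. As all
   cross terms lie strictly above [S], the values of [qK t] and [S] agree. *)
have cross a b : w S < w (polar qK (u a) (u b)).
  rewrite (polarZl hqK) (polarZr hqK) polE !valuationM vw !wjE.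
  have [->|ab0] := eqVneq (polar q (x a) (x b)) 0.
    rewrite valuation0 lt_neqAle; apply/andP; split; last first.
      by case: (wL (l b)) => *; case: (wL (l a)) => *; rewrite lee_infty.
    by case: (wL (l b)) => *; case: (wL (l a)).
  rewrite -lt_double; apply: le_lt_trans (leeD (S_le a) (S_le b)) _.
  have [g gE] := val_fin wL (l0 a); have [h hE] := val_fin wL (l0 b).
  have := wild (xe a) (xe b) ab0; rewrite gE hE.
  set p := v (polar q _ _); set qa := v (q (x a)); set qb := v (q (x b)).
  have -> : qa + (Fin g + Fin g) + (qb + (Fin h + Fin h))
    = Fin (g + g + (h + h)) + (qa + qb).
    by rewrite addrACA addrC -!FinD.
  have -> : Fin g + (Fin h + p) + (Fin g + (Fin h + p))
    = Fin (g + g + (h + h)) + (p + p).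
    have -> : Fin g + (Fin h + p) = Fin (g + h) + p by rewrite addrA.
    by rewrite addrACA -FinD [X in Fin X]addrACA.
  by rewrite ltD2l_Fin.
have wt : w (qK t) = w S.
  have -> : qK t = S + (qK t - S) by rewrite addrC subrK.
  by rewrite val_dom // tE; apply: qform_cross_gt.
(* A lower bound for the value of the pairing of [z] with [t]. The index attaining it is the one at
   which [wild] is contradicted. *)
pose mu := \big[Num.min/infty]_a (v (polar q z (x a)) + wL (l a)).
have mu_le : mu <= w (polar qK (emb z) t).
  rewrite pol_t wjE; apply: (filt_sum_ge (f := wL)) => a _ /=.
  rewrite -mulr_algl valuationM vwL.
  exact: (bigmin_infty_le (fun a => v (polar q z (x a)) + wL (l a))).
have mu_fin : mu != infty.
  by apply: contraTneq mu_le => ->; rewrite -ltNge lte_infty val_neq_infty.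
have [a mua] := bigmin_attained mu_fin; rewrite -/mu in mua.
have zxa0 : polar q z (x a) != 0.
  by apply: contra mu_fin => /eqP E; rewrite mua E valuation0.
have [g gE] := val_fin wL (l0 a).
have := le_trans (leeD mu_le mu_le) zt_le.
have qz : qK (emb z) = iota (q z) by exact: embed_q.
rewrite qz vw wt.
move=> /le_trans/(_ (leeD (lexx _) (S_le a))); apply/negP; rewrite -ltNge.
rewrite mua gE [ltLHS]addrA [ltRHS]addrACA -FinD ltD2r_Fin.
exact: wild.
Qed.

End WildPart.

Theorem tame_norm_of_hyperbolic (G : orderedGroupType) (F : fieldType)
    (v : valuation F G) (V : vectType F) (q : V -> F)
    (K : fieldType) (iota : {rmorphism F -> K}) :
  divisible G -> henselian v -> quadratic_form q ->
  nondegenerate_pairing (polar q) -> tame_extension v iota ->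
  hyperbolic (base_change iota q) ->
  exists alpha : value_function v V, tame_compatible_norm q alpha.
Proof.
move=> dG hen hq nd tame hyp.
have [k [e [gam [tame_e e_max]]]] := maximal_tame_family v hq.
have [eq1 eb [C BC vC]] := tame_e.
have e_full z : (forall i, polar q z (e i) = 0) -> z = 0.
  move=> ze; have [v2|v2] := boolP (Fin 0 < v 2%:R).
    have wild x y : (forall i, polar q x (e i) = 0) ->
        (forall i, polar q y (e i) = 0) -> polar q x y != 0 ->
        v (q x) + v (q y) < v (polar q x y) + v (polar q x y).
      move=> xe ye xy0; rewrite ltNge; apply/negP => le_xy.
      have [del tame_xy] := tame_plane hq dG v2 xy0 le_xy.
      suff : 2 = 0%N by [].
      apply: e_max tame_xy _ => i j.
      by rewrite /pairfun; case: ifP; rewrite polarC.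
    (* A nonzero isotropic [x] pairs nontrivially with some [y] of the orthogonal, and then the left
       side of [wild] is infinite. *)
    have aniso x : (forall i, polar q x (e i) = 0) -> x != 0 -> q x != 0.
      move=> xe x0; apply/eqP => qx.
      have [y ye xy0] := orthogonal_nondegenerate hq BC nd x0 xe.
      have := wild x y xe ye xy0; rewrite qx valuation0 ltNge.
      by case: (v (q y)) => [?|]; rewrite lee_infty.
    exact: (wild_not_hyperbolic hen hq v2 tame_e wild aniso tame hyp).
  apply/eqP/negP => /negP z0.
  have v2E : v 2%:R = Fin 0.
    by apply/le_anti; rewrite leNgt v2 val_nat_ge0.
  (* If [q] vanished at [z], [y] and [z + y], then [polar q z y] would be zero. *)
  have [x xe qx] : exists2 x, forall i, polar q x (e i) = 0 & q x != 0.
    have [y ye zy0] := orthogonal_nondegenerate hq BC nd z0 ze.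
    have [qz|qz] := eqVneq (q z) 0; last by exists z.
    have [qy|qy] := eqVneq (q y) 0; last by exists y.
    exists (z + y); first by move=> i; rewrite (polarDl hq) ze ye addr0.
    by rewrite qformD qz qy !add0r.
  have [del tame_x] := tame_line hq dG v2E qx.
  suff : 1%N = 0%N by [].
  by apply: e_max tame_x _ => i j; rewrite polarC.
have kE : k = \dim {:V}.
  apply/eqP; rewrite eqn_leq (tame_family_size hq tame_e) /= leqNgt.
  apply/negP => /(orthogonal_vector e hq)[z z0 ze].
  by move/eqP: z0; apply; apply: e_full.
subst k; exists (dual_norm v hq gam e_full); split.
- exists [tuple e i | i < \dim {:V}].
    by rewrite basisEfree (tame_family_free hq tame_e) subvf size_tuple /=.
  have eE (i : 'I_(\dim {:V})) : [tuple e i | i < \dim {:V}]`_i = e i.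
    by rewrite -tnth_nth tnth_mktuple.
  move=> c; under eq_bigr do rewrite eE.
  rewrite (dual_norm_splitting hq tame_e e_full c).
  by apply: eq_bigr => i _; rewrite eE.
- exact: dual_norm_prec.
- apply: self_dual_gr => //; [exact: dual_norm_prec|exact: dual_norm_self_dual].
Qed.

(** * Defectless extensions *)

Section DefectlessExtension.
Variables (G : orderedGroupType) (F : fieldType) (v : valuation F G).
Variables (L : fieldExtType F) (w : valuation L G).
Hypothesis vw : extends (GRing.in_alg L) v w.

(** The fundamental inequality: products of residue and coset representatives form a splitting
    family, which is free. It also bounds the maximal systems chosen below. *)
Lemma residue_coset_bound f e (X : 'I_f -> L) (Y : 'I_e -> L) :
  residue_independent (GRing.in_alg L) v w X -> coset_distinct v w Y ->
  (f * e <= \dim {:L})%N.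
Proof.
move=> X_indep Y_dist; rewrite -[f]card_ord -[e]card_ord -card_prod.
apply: (splitting_card _ (splitting_pairs vw X_indep Y_dist)) => -[i a] /=.
by rewrite mulf_neq0 ?Y_dist.1 // (val_neq0 (residue_independent_unit vw i X_indep)).
Qed.

Lemma residue_independent_1 :
  residue_independent (GRing.in_alg L) v w (fun _ : 'I_1 => 1).
Proof.
split=> [_|c _ + i]; first by rewrite valuation1.
by rewrite big_ord1 mulr1 vw (ord1 i).
Qed.

Lemma coset_distinct_1 : coset_distinct v w (fun _ : 'I_1 => 1).
Proof. by split=> [_|a b t]; rewrite ?oner_eq0 // !ord1 eqxx. Qed.

Definition consfun T n (x : T) (f : 'I_n -> T) (i : 'I_n.+1) : T :=
  if unlift ord0 i is Some k then f k else x.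

Lemma consfun0 T n (x : T) (f : 'I_n -> T) : consfun x f ord0 = x.
Proof. by rewrite /consfun unlift_none. Qed.

Lemma consfunS T n (x : T) (f : 'I_n -> T) i : consfun x f (lift ord0 i) = f i.
Proof. by rewrite /consfun liftK. Qed.

Lemma maximal_cosets : exists e (Y : 'I_e -> L), coset_distinct v w Y /\
  forall x, x != 0 -> exists i t, t != 0 /\ w x = w (Y i) + v t.
Proof.
pose P e := `[< exists Y : 'I_e -> L, coset_distinct v w Y >].
have exP : exists e, P e.
  by exists 1%N; apply/asboolP; exists (fun=> 1); apply: coset_distinct_1.
have leP e : P e -> (e <= \dim {:L})%N.
  move=> /asboolP[Y Y_dist]; rewrite -[e]mul1n.
  exact: residue_coset_bound residue_independent_1 Y_dist.
case: (ex_maxnP exP leP) => e /asboolP[Y [Y0 Y_dist]] e_max; exists e, Y.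
split=> // x x0; apply: contrapT => xP.
suff /e_max : P e.+1 by rewrite ltnn.
apply/asboolP; exists (consfun x Y); split=> [a|a b t].
  by case: (unliftP ord0 a) => [a' ->|->]; rewrite ?consfun0 ?consfunS.
case: (unliftP ord0 a) => [a' ->|->]; case: (unliftP ord0 b) => [b' ->|->];
  rewrite ?consfun0 ?consfunS ?eqxx //.
- by rewrite (inj_eq lift_inj); apply: Y_dist.
- move=> _ t0 E; apply: xP; exists a', t^-1; rewrite invr_eq0; split=> //.
  have [g gE] := val_fin v t0.
  by rewrite E gE (valV gE) -addrA FinDN addr0.
- by move=> _ t0 E; apply: xP; exists b', t.
Qed.

Lemma maximal_residues : exists f (X : 'I_f -> L),
  residue_independent (GRing.in_alg L) v w X /\
  forall x, Fin 0 <= w x -> exists2 c : 'I_f -> F, forall i, Fin 0 <= v (c i)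
    & Fin 0 < w (x - \sum_i (c i)%:A * X i).
Proof.
pose P f := `[< exists X : 'I_f -> L,
  residue_independent (GRing.in_alg L) v w X >].
have exP : exists f, P f.
  by exists 1%N; apply/asboolP; exists (fun=> 1); apply: residue_independent_1.
have leP f : P f -> (f <= \dim {:L})%N.
  move=> /asboolP[X X_indep]; rewrite -[f]muln1.
  exact: residue_coset_bound X_indep coset_distinct_1.
case: (ex_maxnP exP leP) => f /asboolP[X X_indep] f_max; exists f, X.
split=> // x wx; apply: contrapT => xP.
suff /f_max : P f.+1 by rewrite ltnn.
have [X_ge X_ind] := X_indep.
apply/asboolP; exists (consfun x X); split=> [a|c vc].
  by case: (unliftP ord0 a) => [a' ->|->]; rewrite ?consfun0 ?consfunS.
rewrite big_ord_recl consfun0; under eq_bigr do rewrite consfunS.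
set s := \sum_i _ => pos; have [c0|c0] := boolP (Fin 0 < v (c ord0)).
  have s_pos : Fin 0 < w s.
    have -> : s = - (in_alg L (c ord0) * x) + (in_alg L (c ord0) * x + s).
      by rewrite addKr.
    apply: (filtD_gt (f := w)) => //=; rewrite valuationN valuationM vw.
    by rewrite addrC -[Fin 0](addr0 (Fin 0)); apply: lteD_Fin.
  move=> i; case: (unliftP ord0 i) => [i' ->|-> //].
  exact: X_ind s_pos i'.
exfalso; apply: xP.
have vc0 : v (c ord0) = Fin 0 by apply/le_anti; rewrite leNgt c0 vc.
have c00 := val_neq0 vc0; have vV := valV vc0.
exists (fun i => - ((c ord0)^-1 * c (lift ord0 i))) => [i|].
  by rewrite valuationN valuationM vV oppr0 add0r.
have -> : x - \sum_i (- ((c ord0)^-1 * c (lift ord0 i)))%:A * X i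
    = in_alg L (c ord0)^-1 * (in_alg L (c ord0) * x + s).
  rewrite mulrDr mulrA -rmorphM mulVf // rmorph1 mul1r; congr (_ + _).
  rewrite /s mulr_sumr -sumrN; apply: eq_bigr => i _ /=.
  by rewrite -!in_algE rmorphN rmorphM mulNr opprK mulrA.
by rewrite valuationM vw vV oppr0 add0r.
Qed.

(** The powers of a lift [x] up to the exponent [\dim {:L}] are one too many to be residue
    independent. A failure of independence has some unit coefficient, so its reduction is a nonzero
    polynomial killing [c]. *)
Lemma residue_algebraic (rho : {rmorphism residue_field v -> residue_field w}) c :
  (forall a, Fin 0 <= v a -> rho (residue v a) = residue w a%:A) ->
  algebraicOver rho c.
Proof.
move=> rhoE; have [x wx <-] := residue_surj c.
pose n := \dim {:L}; pose X (i : 'I_n.+1) := x ^+ i.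
have X_ge i : Fin 0 <= w (X i) by apply: val_integralX.
have [c' vc [pos [i ci]]] : exists2 c' : 'I_n.+1 -> F,
    forall i, Fin 0 <= v (c' i) &
    Fin 0 < w (\sum_i (c' i)%:A * X i) /\ exists i, ~~ (Fin 0 < v (c' i)).
  apply: contrapT => h.
  suff X_ind : residue_independent (GRing.in_alg L) v w X.
    by have := residue_coset_bound X_ind coset_distinct_1; rewrite muln1 ltnn.
  split=> // c' vc pos i; apply/negP => /negP ci; apply: h.
  by exists c' => //; split=> //; exists i.
exists (\poly_(k < n.+1) residue v (c' (inord k))).
  apply/eqP => /polyP/(_ i)/eqP; rewrite coef_poly ltn_ord inord_val coef0.
  by rewrite residue_eq0 // (negPf ci).
rewrite /root; apply/eqP.
have -> : map_poly rho (\poly_(k < n.+1) residue v (c' (inord k)))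
    = \poly_(k < n.+1) residue w (c' (inord k))%:A.
  apply/polyP => k; rewrite coef_map !coef_poly; case: ifP => _.
    by rewrite /= rhoE.
  exact: rmorph0.
rewrite horner_poly.
have E k : Fin 0 <= w ((c' k)%:A) by rewrite vw.
transitivity (residue w (\sum_i (c' i)%:A * X i)).
  rewrite residue_sum => [|k _]; last exact: val_integralM.
  by apply: eq_bigr => k _; rewrite residueM // residueX // inord_val.
by apply/eqP; rewrite residue_eq0 // ltW.
Qed.

(** [E] is obtained by adjoining the residues of a maximal independent system; by maximality these
    span the residue field of [w], so the embedding [phi] is onto. *)
Lemma residue_extension : exists (E : fieldExtType (residue_field v))
    (phi : {rmorphism E -> residue_field w}), bijective phi /\
  forall a, Fin 0 <= v a -> phi (residue v a)%:A = residue w a%:A.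
Proof.
have [rho rhoE] := residue_map vw.
have [f [X [[X_ge X_ind] X_span]]] := maximal_residues.
have [E [phi [phi_rho phi_X]]] := finite_subextension
  (s := [seq residue w (X i) | i <- enum 'I_f])
  (fun c _ => residue_algebraic c rhoE).
exists E, phi; split; last by move=> a va; rewrite phi_rho rhoE.
suff surj c : exists y, phi y = c.
  exists (fun c => sval (cid (surj c))) => [y|c].
    by apply: (fmorph_inj phi); case: cid.
  by case: cid.
have [x wx <-] := residue_surj c; have [d vd pos] := X_span x wx.
have [b bE] : exists b : 'I_f -> E, forall i, phi (b i) = residue w (X i).
  have ex i : exists y, phi y = residue w (X i).
    by apply: phi_X; apply/mapP; exists i; rewrite ?mem_enum.
  by exists (fun i => sval (cid (ex i))) => i; case: cid.
exists (\sum_i residue v (d i) *: b i).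
have d_ge i : Fin 0 <= w ((d i)%:A) by rewrite vw.
have sum_ge : Fin 0 <= w (\sum_i (d i)%:A * X i).
  by apply: (filt_sum_ge (f := w)) => i _; apply: val_integralM.
have -> : phi (\sum_i residue v (d i) *: b i) = residue w (\sum_i (d i)%:A * X i).
  rewrite residue_sum => [|i _]; last exact: val_integralM.
  rewrite rmorph_sum; apply: eq_bigr => i _.
  by rewrite residueM // -bE -rhoE // -phi_rho -rmorphM mulr_algl.
apply/eqP; rewrite eq_sym -subr_eq0 -residueN // -residueD ?valuationN //.
by rewrite residue_eq0 // ltW.
Qed.

(* A functional [psi] normalized by [psi 1 = 1] and increasing the valuation
   witnesses that [L / F] is defectless: every functional is [psi (a * _)], and
   one vanishing on the span of the products of residue and coset
   representatives would contradict the density of that span near [a^-1]. *)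
Lemma defectless_invariants (psi : L -> F) : scalar psi -> psi 1 = 1 ->
  (forall z, w z <= v (psi z)) ->
  exists (E : fieldExtType (residue_field v))
         (phi : {rmorphism E -> residue_field w}) (e : nat),
    [/\ bijective phi
          /\ (forall a, Fin 0 <= v a -> phi (residue v a)%:A = residue w a%:A),
        has_index (value_group w) (value_group v) e
      & \dim {:L} = (\dim {:E} * e)%N].
Proof.
move=> psi_lin psi1 psi_le.
have [E [phi [phi_bij phiE]]] := residue_extension.
have [e [Y [Y_dist Y_cover]]] := maximal_cosets; exists E, phi, e.
pose f : nat := \dim {:E}; pose b (i : 'I_f) := (vbasis {:E})`_i.
have b_free (c : 'I_f -> _) : \sum_i c i *: b i = 0 -> forall i, c i = 0.
  by move: c; apply/freeP/basis_free/vbasisP.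
have b_span y : exists c : 'I_f -> _, y = \sum_i c i *: b i.
  by exists (fun i => coord (vbasis {:E}) i y); apply: coord_vbasis (memvf y).
pose X i := residue_lift (phi (b i)).
have X_ge i : Fin 0 <= w (X i) := residue_lift_ge _.
have Xb i : residue w (X i) = phi (b i) := residue_liftK _.
have X_indep := lift_residue_independent vw phiE X_ge Xb b_free.
have X_span := lift_residue_spanning vw phiE X_ge Xb b_span phi_bij.
split=> //.
  exists (fun i => if w (Y i) is Some g then g else 0) => [i|g [x xg]].
    by have [g gE] := val_fin w (Y_dist.1 i); exists (Y i); rewrite gE.
  have [i [t [t0 it]]] := Y_cover x (val_neq0 xg).
  have [y yE] := val_fin w (Y_dist.1 i); exists i; split=> [|k].
    rewrite yE; exists t; move: it; rewrite xg yE; case: (v t) => // s.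
    by rewrite -[Some s]/(Fin s) -FinD => -[->]; rewrite addrAC subrr add0r.
  have [z zE] := val_fin w (Y_dist.1 k); rewrite zE => -[s sE].
  apply/eqP; apply: contrapT => /negP ik; apply: (Y_dist.2 i k (s / t) ik).
    by rewrite mulf_neq0 ?invr_eq0 // (val_neq0 sE).
  have [u uE] := val_fin v t0.
  rewrite valuationM (valV uE) sE yE zE -!FinD; congr Fin.
  move: it; rewrite xg yE uE -FinD => -[->].
  by rewrite addrA addrCA subrr addr0 addrK.
apply/eqP; rewrite eqn_leq (residue_coset_bound X_indep Y_dist) andbT leqNgt.
apply/negP => lt_n.
(* If there were fewer products than the degree, the functionals attached to them would have a
   common zero [a]. *)
have [||a a0 a_ker] := @common_kernel F L ('I_f * 'I_e)%type
  (fun p z => psi (z * (X p.1 * Y p.2))).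
- by move=> p c x y; rewrite mulrDl -scalerAl psi_lin.
- by rewrite card_prod !card_ord.
have [i [t [t0 it]]] := Y_cover a^-1 (invr_neq0 a0).
have [u uE] := val_fin v t0; have [y yE] := val_fin w (Y_dist.1 i).
(* [d] is chosen with the value of [a^-1], so [a * d] is a unit whose inverse is approximated by a
   combination [z] of the [X k]. Then [1 - a * d * z] has positive value, although [psi] sends it to
   1. *)
pose d := t%:A * Y i; have d0 : d != 0.
  by rewrite mulf_neq0 ?Y_dist.1 // -in_algE fmorph_eq0.
have wd : w d = w a^-1 by rewrite it valuationM vw addrC.
have [s sE] := val_fin w (invr_neq0 a0).
have ad0 : w (a * d) = Fin 0.
  by rewrite valuationM wd addrC -valuationM mulVf ?valuation1.
have y_ge : Fin 0 <= w (a * d)^-1 by rewrite (valV ad0) oppr0.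
have [c vc pos] := X_span _ y_ge.
pose z := \sum_k in_alg L (c k) * X k.
have zE : a * d * z = \sum_k (t * c k) *: (a * (X k * Y i)).
  rewrite mulr_sumr; apply: eq_bigr => k _.
  by rewrite -[RHS]mulr_algl -in_algE rmorphM /d -in_algE; ring.
have psi_ker : psi (a * d * z) = 0.
  rewrite zE; apply: (big_ind (fun x => psi x = 0)) => [|x x' px px'|k _].
  - by have := psi_lin (-1) 0 0; rewrite scaler0 addr0 mulN1r addNr.
  - by have := psi_lin 1 x x'; rewrite scale1r mul1r px px' addr0.
  - have := psi_lin (t * c k) (a * (X k * Y i)) 0; rewrite addr0 => ->.
    have p0 : psi 0 = 0.
      by have := psi_lin (-1) 0 0; rewrite scaler0 addr0 mulN1r addNr.
    by rewrite (a_ker (k, i)) p0 mulr0 addr0.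
have adz : 1 - a * d * z = a * d * ((a * d)^-1 - z).
  by rewrite mulrBr mulfV // mulf_neq0.
have := psi_le (1 - a * d * z); rewrite adz valuationM ad0 -adz.
have -> : psi (1 - a * d * z) = 1.
  have := psi_lin (-1) (a * d * z) 1; rewrite psi_ker psi1 mulr0 add0r => <-.
  by rewrite scaleN1r addrC.
by rewrite valuation1 add0r leNgt pos.
Qed.

End DefectlessExtension.

(** * Separability through squares, and tameness of good extensions *)

Section SquareSpan.
Variables (k : fieldType) (E : fieldExtType k).
Hypothesis p2 : 2 \in [pchar E].

Lemma sqr_sum2 (I : Type) (r : seq I) (P : pred I) (x : I -> E) :
  (\sum_(i <- r | P i) x i) ^+ 2 = \sum_(i <- r | P i) x i ^+ 2.
Proof.
rewrite -(pFrobenius_autE p2) rmorph_sum.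
by apply: eq_bigr => i _; rewrite /= pFrobenius_autE.
Qed.

Definition sqrs (X : seq E) : seq E := [seq x ^+ 2 | x <- X].

Lemma sqr_span (X : seq E) y : y \in <<X>>%VS -> y ^+ 2 \in <<sqrs X>>%VS.
Proof.
move=> yX; rewrite (coord_span (X := in_tuple X) yX) sqr_sum2.
apply: memv_suml => i _; rewrite exprZn memvZ //.
by apply/memv_span/map_f/mem_nth.
Qed.

(** Since squares span, by counting the squares of any basis are free. Apply this to a basis
    extending one of the field generated by [x]: the squares of its first part lie in the field
    generated by [x ^+ 2], which therefore has the same dimension and contains [x]. *)
Lemma span_squares_separable :
  (forall y, y \in <<sqrs (vbasis {:E})>>%VS) -> separable 1 {:E}.
Proof.
move=> sq_span; apply/separableP => x _.
rewrite (pcharf_p_separable 1 x 0 p2) expn1.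
pose U := <<1; x>>%VS; pose K := <<1; x ^+ 2>>%VS.
pose T := vbasis U ++ vbasis U^C.
have T_span : <<T>>%VS = fullv.
  by rewrite span_cat !(span_basis (vbasisP _)) addv_complf.
have T2_span : <<sqrs T>>%VS = fullv.
  apply/vspaceP => y; rewrite memvf; apply: (subvP _ _ (sq_span y)).
  by apply/span_subvP => _ /mapP[z _ ->]; apply: sqr_span; rewrite T_span memvf.
have : free (sqrs T).
  rewrite /free T2_span size_map size_cat !size_tuple dimv_compl.
  by rewrite subnKC // dimvS ?subvf.
rewrite /sqrs map_cat => /catl_free U2_free.
have KU : (K <= U)%VS.
  by apply/FadjoinP; rewrite subv_adjoin rpredX // memv_adjoin.
have U2_K : (<<sqrs (vbasis U)>> <= K)%VS.
  apply/span_subvP => _ /mapP[u uU ->].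
  have /Fadjoin_polyP[p /polyOverP p1 ->] : u \in U by apply: vbasis_mem.
  rewrite horner_coef sqr_sum2; apply: memv_suml => i _.
  rewrite exprMn -exprM mulnC exprM; apply: rpredM.
    by apply: rpredX; apply: (subvP (subv_adjoin _ _)); apply: p1.
  by apply: rpredX; apply: memv_adjoin.
suff -> : <<1; x ^+ 2>>%VS = U by apply: memv_adjoin.
apply/eqP; rewrite eqEdim KU /=.
move: U2_free; rewrite /free => /eqP; rewrite size_map size_tuple => <-.
exact: dimvS.
Qed.

End SquareSpan.

(* Stable under towers of quadratic extensions, where it propagates
   separability of the residue extension in residual characteristic 2. *)
Definition square_generated (G : orderedGroupType) (F : fieldType)
    (v : valuation F G) (M : fieldExtType F) (w : valuation M G) :=
  forall P : M -> Prop,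
    (forall x y, P x -> P y -> P (x + y)) ->
    (forall x y, P x -> P y -> P (x * y)) ->
    (forall a, Fin 0 <= v a -> P a%:A) ->
    (forall y, Fin 0 <= w y -> P (y ^+ 2)) ->
    (forall y, Fin 0 < w y -> P y) ->
  forall x, Fin 0 <= w x -> P x.

Lemma square_generated_separable (G : orderedGroupType) (F : fieldType)
    (v : valuation F G) (M : fieldExtType F) (w : valuation M G)
    (E : fieldExtType (residue_field v)) (phi : {rmorphism E -> residue_field w}) :
  Fin 0 < v 2%:R -> square_generated v w ->
  extends (GRing.in_alg M) v w -> bijective phi ->
  (forall a, Fin 0 <= v a -> phi (residue v a)%:A = residue w a%:A) ->
  separable 1 {:E}.
Proof.
move=> v2 gen vw [psi phiK psiK] phiE.
have p2 : 2 \in [pchar E] by rewrite pchar_lalg residue_pchar2.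
apply: (span_squares_separable p2); set S := <<_>>%VS.
have sq_S y : y ^+ 2 \in S.
  by apply: (sqr_span p2); rewrite (span_basis (vbasisP _)) memvf.
have S1 a : a%:A \in S by rewrite -(expr1n _ 2) memvZ.
have SM y z : y \in S -> z \in S -> y * z \in S.
  move=> yS zS; rewrite /S (coord_span (X := in_tuple _) yS) mulr_suml.
  apply: memv_suml => i _; rewrite -scalerAl memvZ //.
  rewrite (coord_span (X := in_tuple _) zS) mulr_sumr.
  apply: memv_suml => l _; rewrite -scalerAr memvZ //.
  have sqr_nth (m : 'I_(size (sqrs (vbasis {:E})))) :
      exists u, (in_tuple (sqrs (vbasis {:E})))`_m = u ^+ 2.
    by have /mapP[u _ uE] := mem_nth 0 (ltn_ord m); exists u.
  have [s ->] := sqr_nth i; have [t ->] := sqr_nth l.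
  by rewrite -exprMn; apply: sq_S.
have psiM : {morph psi : x y / x * y}.
  by move=> x y; rewrite -{1}[x]psiK -{1}[y]psiK -rmorphM phiK.
have psiD : {morph psi : x y / x + y}.
  by move=> x y; rewrite -{1}[x]psiK -{1}[y]psiK -rmorphD phiK.
(* The span [S] of the squares is a subring containing the base field, so this property has all the
   closure properties required by [square_generated]. *)
pose P x := Fin 0 <= w x /\ psi (residue w x) \in S.
suff PT x : Fin 0 <= w x -> P x.
  move=> y; have [x wx xy] := residue_surj (phi y).
  by have [_] := PT x wx; rewrite xy phiK.
apply: gen => {x} [x y [wx Px] [wy Py]|x y [wx Px] [wy Py]|a va|y wy|y wy].
- split; first exact: (filtD_ge (f := w)).
  by rewrite residueD // psiD rpredD.
- split; first exact: val_integralM.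
  by rewrite residueM // psiM; apply: SM.
- by split; [rewrite vw|rewrite -phiE // phiK].
- split; first exact: val_integralX.
  by rewrite expr2 residueM // psiM -expr2.
- split; first exact: ltW.
  have /eqP -> : residue w y == 0 by rewrite residue_eq0 // ltW.
  by rewrite -(rmorph0 phi) phiK mem0v.
Qed.

Lemma subextension_degree (F : fieldType) (L M : fieldExtType F)
    (j : {rmorphism L -> M}) : (forall a, j a%:A = a%:A) ->
  (\dim {:L} %| \dim {:M})%N.
Proof.
move=> jF; have jZ : scalable j.
  by move=> a x; rewrite -mulr_algl rmorphM jF mulr_algl.
pose jZM := GRing.isScalable.Build _ _ _ _ j jZ.
pose jl : {lrmorphism L -> M} := HB.pack (j : L -> M) j jZM.
pose f : 'AHom(L, M) := linfun_ahom jl.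
have <- : \dim (f @: {:L}) = \dim {:L}.
  by apply: limg_dim_eq; rewrite (eqP (AHom_lker0 f)) capv0.
exact: field_dimS (subvf (f @: {:L})%AS).
Qed.

(** A minimal polynomial has degree a power of 2, nonzero in [k], so the leading term survives
    differentiation. *)
Lemma two_power_separable (k : fieldType) (E : fieldExtType k) s :
  2%:R != 0 :> k -> (\dim {:E} %| 2 ^ s)%N -> separable 1 {:E}.
Proof.
move=> k2 dimE; apply/separableP => y _; rewrite separable_nz_der.
have d_dvd : (adjoin_degree 1 y %| 2 ^ s)%N.
  apply: dvdn_trans dimE; rewrite adjoin_degreeE dimv1 divn1.
  exact: (field_dimS (subvf <<1; y>>%AS)).
have /(dvdn_pfactor _ _ (isT : prime 2))[t _ dE] := d_dvd.
apply/eqP => /polyP/(_ (adjoin_degree 1 y).-1); rewrite coef_deriv coef0.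
have d_gt0 : (0 < adjoin_degree 1 y)%N by rewrite dE expn_gt0.
have := monic_minPoly 1 y; rewrite monicE lead_coefE size_minPoly prednK //=.
move=> /eqP ->; rewrite dE natrX => /eqP; rewrite expf_eq0 => /andP[_].
have -> : 2%:R = in_alg E 2%:R by rewrite rmorph_nat.
by rewrite fmorph_eq0 (negPf k2).
Qed.

Section GoodExtensions.
Variables (G : orderedGroupType) (F : fieldType) (v : valuation F G).

(** The invariant carried up the tower. The functional and its bound restrict to subextensions.
    Outside residue characteristic 2 the degree alone settles separability and the ramification
    index; in residue characteristic 2 the last two clauses do. *)
Record good_extension (M : fieldExtType F) (w : valuation M G) : Prop :=
  GoodExtension {
    good_extends : extends (GRing.in_alg M) v w;
    good_defectless : exists psi : M -> F,
      [/\ scalar psi, psi 1 = 1 & forall z, w z <= v (psi z)];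
    good_degree : exists s, \dim {:M} = (2 ^ s)%N;
    good_unramified : Fin 0 < v 2%:R -> forall x, x != 0 -> exists a, v a = w x;
    good_square_generated : Fin 0 < v 2%:R -> square_generated v w
  }.

Lemma separable_subextension (E E' : fieldExtType (residue_field v))
    (K : fieldType) (phi : {rmorphism E -> K}) (phi' : {rmorphism E' -> K}) :
  (forall a, phi a%:A = phi' a%:A) -> bijective phi' ->
  separable 1 {:E'} -> separable 1 {:E}.
Proof.
move=> phiE [psi phiK psiK] sep; apply/separableP => y _.
have /separableP/(_ (psi (phi y)) (memvf _)) := sep.
set y' := psi (phi y) => /separable_elementP[f [/polyOver1P[p ->]]].
rewrite separable_map => py' sep_p; apply/separable_elementP.
exists (map_poly (in_alg E) p); rewrite separable_map; split=> //.
  by apply/polyOver1P; exists p.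
rewrite -(fmorph_root phi); move: py'; rewrite -(fmorph_root phi') psiK.
by rewrite -!map_poly_comp (eq_map_poly (phiE : phi \o in_alg E =1 phi' \o in_alg E')).
Qed.

Lemma good_extension_tame (M : fieldExtType F) (w : valuation M G) :
  good_extension w -> tame_extension v (in_alg M).
Proof.
move=> [vw [psi [psi_lin psi1 psi_le]] [s dimM] unram gen].
split=> [|L j jF]; first exact: fieldExt_algebraic.
exists (valuation_pullback j w); first by move=> a; rewrite /= jF vw.
set wL := valuation_pullback j w.
have vwL : extends (GRing.in_alg L) v wL by move=> a; rewrite /= jF vw.
(* Restricting [psi] along [j] makes the subextension defectless as well. *)
have psi_linL : scalar (psi \o j).
  by move=> a x y; rewrite /= rmorphD -mulr_algl rmorphM jF mulr_algl psi_lin.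
have psi1L : psi (j 1) = 1 by rewrite rmorph1.
have [E [phi [e [phiB idx dimL]]]] :=
  defectless_invariants vwL psi_linL psi1L (fun z => psi_le (j z)).
have dim_dvd : (\dim {:E} * e %| 2 ^ s)%N.
  by rewrite -dimL -dimM; apply: subextension_degree jF.
exists E, phi, e; split=> //; have [v2|v2] := boolP (Fin 0 < v 2%:R).
- have [EM [phiM [eM [[phiM_bij phiME] _ _]]]] :=
    defectless_invariants vw psi_lin psi1 psi_le.
  have sepM := square_generated_separable v2 (gen v2) vw phiM_bij phiME.
  have jw : extends j wL w by [].
  have [rho rhoE] := residue_map jw.
  have phi_rho (a : residue_field v) : (rho \o phi) a%:A = phiM a%:A.
    have [b vb <-] := residue_surj a.
    by rewrite /= phiB.2 // phiME // rhoE ?jF // vwL.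
  exact: (separable_subextension (phi := rho \o phi) phi_rho phiM_bij sepM).
- apply: (two_power_separable (s := s)); last exact: dvdn_trans (dvdn_mulr _ _) dim_dvd.
  by rewrite -residue_nat residue_eq0 ?val_nat_ge0.
- have [r rP r_idx] := idx.
  (* Every value of [L] is a value of [v], so two distinct indices would represent the same
     coset. *)
  have e_le1 : (e <= 1)%N.
    rewrite leqNgt; apply/negP => e_gt1.
    have rF i : value_group v (r i).
      have [x xE] := rP i; have [a aE] := unram v2 (j x) (val_neq0 (v := w) xE).
      by exists a; rewrite aE.
    pose i0 : 'I_e := Ordinal (ltnW e_gt1); pose i1 : 'I_e := Ordinal e_gt1.
    have [k [_ k_uniq]] := r_idx (r i0) (rP i0).
    suff : i0 = i1 by [].
    rewrite -(k_uniq i0) ?(k_uniq i1) //.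
      apply: value_groupD (rF i0) _; exact: value_groupN (rF i1).
    apply: value_groupD (rF i0) _; exact: value_groupN (rF i0).
  have e_eq1 : e = 1%N.
    apply/eqP; rewrite eqn_leq e_le1 /= lt0n; apply/eqP => e0.
    have : (0 < \dim {:L})%N by apply: (adim_gt0 {:L}%AS).
    by rewrite dimL e0 muln0.
  by move=> p /pcharf_prime p_prime; rewrite e_eq1 dvdn1 neq_ltn prime_gt1 ?orbT.
(* [e] divides a power of 2, so a residue characteristic dividing [e] would be 2. *)
- move=> p p_char; have p_prime := pcharf_prime p_char.
  apply/negP => pe; have : (p %| 2 ^ s)%N.
    exact: dvdn_trans (dvdn_trans pe (dvdn_mull _ _)) dim_dvd.
  rewrite Euclid_dvdX // => /andP[+ _]; rewrite dvdn_prime2 // => /eqP p2.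
  by move: p_char; rewrite p2 residue_pchar2 (negPf v2).
Qed.

End GoodExtensions.

(** * Quadratic extensions *)

Section QuadraticExtension.
Variables (M : fieldType) (N : fieldExtType M) (b c : M) (t : N).
Local Notation A := (in_alg N).
Hypothesis t_root : t ^+ 2 + A b * t + A c = 0.
Hypothesis no_root : forall x : M, x ^+ 2 + b * x + c != 0.
Hypothesis t_gen : <<1; t>>%VS = fullv.

Lemma quadratic_coord z : exists xy : M * M, z = A xy.1 + A xy.2 * t.
Proof.
have : z \in <<1; t>>%VS by rewrite t_gen memvf.
move=> /Fadjoin1_polyP[p ->].
elim/poly_ind: p => [|p a [[x y] /= E]].
  by exists (0, 0); rewrite rmorph0 horner0 /= !scale0r mul0r addr0.
exists (a - y * c, x - y * b).
rewrite rmorphD rmorphM /= map_polyX map_polyC hornerMXaddC E /=.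
rewrite -!in_algE !rmorphB !rmorphM.
have tt : t ^+ 2 = - (A b * t) - A c.
  by apply: subr0_eq; rewrite -[RHS]t_root; ring.
by rewrite mulrDl -mulrA -expr2 tt; ring.
Qed.

Lemma quadratic_coord_eq0 x y : A x + A y * t = 0 -> x = 0 /\ y = 0.
Proof.
move=> E; have y0 : y = 0.
  apply/eqP/negP => /negP y0; have := no_root (- (x / y)).
  have tE : t = A (- (x / y)).
    apply: (mulfI (x := A y)); first by rewrite fmorph_eq0.
    rewrite -rmorphM mulrN mulrCA mulfV // mulr1 rmorphN.
    by apply: subr0_eq; rewrite -[RHS]E; ring.
  have AE u : A (u ^+ 2 + b * u + c) = A u ^+ 2 + A b * A u + A c.
    by rewrite !rmorphD rmorphXn rmorphM.
  have /eqP := AE (- (x / y)); rewrite -tE t_root fmorph_eq0.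
  by move=> E0; rewrite E0.
split=> //; move/eqP: E.
by rewrite y0 rmorph0 mul0r addr0 fmorph_eq0 => /eqP.
Qed.

Definition quadratic_fst z : M := (sval (cid (quadratic_coord z))).1.
Definition quadratic_snd z : M := (sval (cid (quadratic_coord z))).2.

Lemma quadratic_eta z : z = A (quadratic_fst z) + A (quadratic_snd z) * t.
Proof. by rewrite /quadratic_fst /quadratic_snd; case: cid. Qed.

Lemma quadratic_coordE z x y : z = A x + A y * t ->
  quadratic_fst z = x /\ quadratic_snd z = y.
Proof.
move=> zE; have := quadratic_eta z; set x' := quadratic_fst z.
set y' := quadratic_snd z => zE'.
have [|/subr0_eq -> /subr0_eq -> //] := @quadratic_coord_eq0 (x' - x) (y' - y).
rewrite !rmorphB mulrBl addrACA -opprD -zE' -zE subrr //.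
Qed.

Lemma quadratic_fst_linear d z z' :
  quadratic_fst (A d * z + z') = d * quadratic_fst z + quadratic_fst z'.
Proof.
have [] // := @quadratic_coordE (A d * z + z')
  (d * quadratic_fst z + quadratic_fst z') (d * quadratic_snd z + quadratic_snd z').
rewrite {1}[z]quadratic_eta {1}[z']quadratic_eta !rmorphD !rmorphM; ring.
Qed.

Lemma quadratic_fst1 : quadratic_fst 1 = 1.
Proof.
by have [] // := @quadratic_coordE 1 1 0; rewrite rmorph1 rmorph0 mul0r addr0.
Qed.

(** [- A b - t] is the other root of the polynomial of [t]. *)
Definition quadratic_conj z : N :=
  A (quadratic_fst z) + A (quadratic_snd z) * (- A b - t).

Lemma quadratic_conjE x y :
  quadratic_conj (A x + A y * t) = A x + A y * (- A b - t).
Proof. by rewrite /quadratic_conj; have [-> ->] := quadratic_coordE (erefl (A x + A y * t)). Qed.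

Let tt : t ^+ 2 = - (A b * t) - A c.
Proof. by apply: subr0_eq; rewrite -[RHS]t_root; ring. Qed.

Fact quadratic_conj_zmod : zmod_morphism quadratic_conj.
Proof.
move=> z z'; rewrite [z]quadratic_eta [z']quadratic_eta.
set x := quadratic_fst z; set y := quadratic_snd z.
set x' := quadratic_fst z'; set y' := quadratic_snd z'.
have -> : A x + A y * t - (A x' + A y' * t) = A (x - x') + A (y - y') * t.
  by rewrite !rmorphB; ring.
by rewrite !quadratic_conjE !rmorphB; ring.
Qed.

Fact quadratic_conj_monoid : monoid_morphism quadratic_conj.
Proof.
split.
  have E : (1 : N) = A 1 + A 0 * t by rewrite rmorph1 rmorph0 mul0r addr0.
  by rewrite {1}E quadratic_conjE rmorph0 mul0r addr0 rmorph1.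
move=> z z'; rewrite [z]quadratic_eta [z']quadratic_eta.
set x := quadratic_fst z; set y := quadratic_snd z.
set x' := quadratic_fst z'; set y' := quadratic_snd z'.
have -> : (A x + A y * t) * (A x' + A y' * t)
    = A (x * x' - y * y' * c) + A (x * y' + y * x' - y * y' * b) * t.
  have -> : (A x + A y * t) * (A x' + A y' * t)
    = A x * A x' + (A x * A y' + A y * A x') * t + A y * A y' * t ^+ 2 by ring.
  by rewrite tt !rmorphB !rmorphD !rmorphM; ring.
rewrite !quadratic_conjE !rmorphB !rmorphD !rmorphM.
have -> : (A x + A y * (- A b - t)) * (A x' + A y' * (- A b - t))
  = A x * A x' + (A x * A y' + A y * A x') * (- A b - t)
    + A y * A y' * (A b ^+ 2 + 2%:R * A b * t + t ^+ 2) by ring.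
by rewrite tt; ring.
Qed.

Definition quadratic_aut : {rmorphism N -> N} :=
  HB.pack quadratic_conj
    (GRing.isZmodMorphism.Build _ _ quadratic_conj quadratic_conj_zmod)
    (GRing.isMonoidMorphism.Build _ _ quadratic_conj quadratic_conj_monoid).

Lemma quadratic_conj_base x : quadratic_conj (A x) = A x.
Proof.
have := quadratic_conjE x 0; rewrite rmorph0 !mul0r !addr0 //.
Qed.

Lemma quadratic_conj_root : quadratic_conj t = - A b - t.
Proof.
have := quadratic_conjE 0 1; rewrite rmorph0 rmorph1 !mul1r !add0r //.
Qed.

End QuadraticExtension.

Section QuadraticStep.
Variables (G : orderedGroupType) (F : fieldType) (v : valuation F G).
Hypothesis hen : henselian v.
Variables (M : fieldExtType F) (w : valuation M G).
Hypothesis good : good_extension v w.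

Lemma henselian_unique (L : fieldExtType F) (w1 w2 : valuation L G) :
  extends (GRing.in_alg L) v w1 -> extends (GRing.in_alg L) v w2 -> w1 =1 w2.
Proof.
move=> e1 e2 x; have [w0 _ uniq] := hen (@fieldExt_algebraic F L).
by rewrite (uniq _ e1) (uniq _ e2).
Qed.

Variables (b c : M).
Hypothesis bc : (Fin 0 < v 2%:R /\ b = 1 /\ Fin 0 <= w c) \/
                (v 2%:R = Fin 0 /\ b = 0).

Section Irreducible.
Variables (N : fieldExtType M) (t : N).
Local Notation A := (in_alg N).
Hypothesis t_root : t ^+ 2 + A b * t + A c = 0.
Hypothesis no_root : forall x : M, x ^+ 2 + b * x + c != 0.
Hypothesis t_gen : <<1; t>>%VS = fullv.
Hypothesis dimN : \dim {:N} = 2%N.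

Local Notation N0 := (baseFieldType N : fieldExtType F).
Variable w' : valuation N0 G.
Hypothesis vw' : extends (GRing.in_alg N0) v w'.

Local Notation z1 := (quadratic_fst t_root t_gen).
Local Notation z2 := (quadratic_snd t_root t_gen).
Local Notation aut := (quadratic_aut t_root no_root t_gen).

Lemma in_alg_tower (a : F) : (a%:A : N0) = A (a%:A : M).
Proof. exact: baseField_scaleE. Qed.

Lemma scale_tower (a : F) (x : N0) : a *: x = A (a%:A : M) * (x : N) :> N.
Proof. rewrite baseField_scaleE; exact: (esym (mulr_algl (a%:A : M) (x : N))). Qed.

Lemma quadratic_extends x : w' (A x) = w x.
Proof.
pose wM : valuation M G := valuation_pullback (in_alg N) (w' : valuation N G).
have vwM : extends (GRing.in_alg M) v wM.
  move=> a; rewrite -[RHS]vw'; congr (valuation_fun w' _).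
exact: (henselian_unique vwM (good_extends good) x).
Qed.

(** The pullback of [w'] along the conjugation also extends [v], so uniqueness applies. *)
Lemma quadratic_conj_val z : w' (aut z) = w' z.
Proof.
pose wN : valuation N0 G := valuation_pullback aut (w' : valuation N G).
have vwN : extends (GRing.in_alg N0) v wN.
  move=> a; rewrite -[RHS]vw'; congr (valuation_fun w' _).
  exact: (quadratic_conj_base t_root no_root t_gen (in_alg M a)).
exact: (henselian_unique vwN vw').
Qed.

Lemma val_double (x : N) : v 2%:R = Fin 0 -> w' (2%:R * x) = w' x.
Proof.
move=> v2; rewrite valuationM.
have -> : (2%:R : N0) = 2%:R%:A by rewrite scaler_nat.
by rewrite vw' v2 add0r.
Qed.

Lemma quadratic_autE z : aut z = A (z1 z) + A (z2 z) * (- A b - t).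
Proof. by []. Qed.

Lemma tower_eta z : z = A (z1 z) + A (z2 z) * t.
Proof. exact: quadratic_eta. Qed.

(** The norm [t * aut t] is [c], which is integral, and both factors have the same value. *)
Lemma root_ge : Fin 0 < v 2%:R -> Fin 0 <= w' t.
Proof.
case: bc => [[_ [b1 wc]] _|[-> _]]; last by rewrite ltxx.
have E : A c = t * aut t.
  have -> : aut t = - A b - t by apply: quadratic_conj_root.
  by apply: subr0_eq; rewrite -[RHS]t_root; ring.
have := wc; rewrite -quadratic_extends E valuationM quadratic_conj_val.
by rewrite -{1}[Fin 0](addr0 (Fin 0)) le_double.
Qed.

(** The difference [z - aut z] is the second coordinate times [2%:R * t + 1], a unit because [t] is
    integral and [2%:R] has positive value. *)
Lemma snd_ge z : Fin 0 < v 2%:R -> w' z <= w (z2 z).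
Proof.
move=> v2; case: bc => [[_ [b1 wc]]|[]]; last by move=> v2'; rewrite v2' ltxx in v2.
have t_ge := root_ge v2.
have w2 : Fin 0 < w' 2%:R.
  have -> : (2%:R : N0) = 2%:R%:A by rewrite scaler_nat.
  by rewrite vw'.
have w2t : w' (2%:R * t + 1) = Fin 0.
  have pos : Fin 0 < w' (2%:R * t).
    by rewrite valuationM addrC -[Fin 0](addr0 (Fin 0)); apply: lteD_Fin.
  by rewrite addrC val_dom valuation1.
have E : z - aut z = A (z2 z) * (2%:R * t + 1).
  have Ab : A b = 1 by rewrite b1 rmorph1.
  by rewrite quadratic_autE {1}[z]tower_eta Ab; ring.
have := filtB_ge (f := w') (g := w' z) (x := z) (y := aut z) (lexx _).
rewrite /= quadratic_conj_val => /(_ (lexx _)).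
by rewrite E valuationM w2t addr0 quadratic_extends.
Qed.

(** This is the bound that makes the first coordinate a suitable functional. In residue
    characteristic 2 it follows from the bounds on the second coordinate and on [t]; otherwise the
    trace [z + aut z] is twice the first coordinate. *)
Lemma fst_ge z : w' z <= w (z1 z).
Proof.
rewrite -quadratic_extends; case: bc => [[v2 _]|[v2 b0]].
  have E : A (z1 z) = z - A (z2 z) * t by rewrite {2}[z]tower_eta addrK.
  rewrite E; apply: (filtB_ge (f := w')) => //=; rewrite valuationM quadratic_extends.
  by rewrite -[leLHS]addr0; apply: leeD; [apply: snd_ge|apply: root_ge].
have E : z + aut z = 2%:R * A (z1 z).
  have Ab : A b = 0 by rewrite b0 rmorph0.
  by rewrite quadratic_autE {1}[z]tower_eta Ab; ring.
rewrite -(val_double (A (z1 z))) // -E; apply: (filtD_ge (f := w')) => //=.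
by rewrite quadratic_conj_val.
Qed.

Lemma quadratic_good : good_extension v w'.
Proof.
have [vw [psi [psi_lin psi1 psi_le]] [s dimM] unram gen] := good.
split=> //.
- exists (fun z => psi (z1 z)); split.
  + move=> a x y.
    have -> : z1 (a *: x + y) = a *: z1 x + z1 y.
      have -> : a *: z1 x = (a%:A : M) * z1 x by rewrite mulr_algl.
      rewrite scale_tower.
      exact: (quadratic_fst_linear t_root no_root t_gen (a%:A : M) x y).
    exact: psi_lin.
  + by rewrite /= (quadratic_fst1 t_root no_root t_gen).
  + by move=> z; apply: le_trans (fst_ge z) (psi_le _).
- exists s.+1; rewrite expnS -dimM -dimN -dim_baseVspace.
  have -> // : baseVspace (fullv : {vspace N}) = fullv.
  apply/vspaceP => x.
  apply/idP/idP => _; first exact: memvf.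
  rewrite mem_baseVspace; exact: memvf.
- move=> v2 z z0.
  (* The value of [z] is the minimum of the values of its two coordinates, hence the value of one of
     them. *)
  have [m [wm m_le]] : exists m, w' z = w m /\ m != 0.
    have z_ge : Num.min (w (z1 z)) (w (z2 z)) <= w' z.
      rewrite {3}[z]tower_eta; apply: (filtD_ge (f := w')) => /=.
        by rewrite quadratic_extends ge_min lexx.
      rewrite valuationM quadratic_extends -[leLHS]addr0.
      by apply: leeD; [rewrite ge_min lexx orbT|apply: root_ge].
    have [g gE] := val_fin w' z0.
    have z_le : w' z <= Num.min (w (z1 z)) (w (z2 z)).
      by rewrite le_min fst_ge snd_ge.
    have := le_anti (introT andP (conj z_ge z_le)); rewrite minEle.
    by case: ifP => _ E; [exists (z1 z)|exists (z2 z)]; split=> //;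
      rewrite -(val_neq_infty w) E gE.
  by have [a aE] := unram v2 m m_le; exists a; rewrite aE wm.
- move=> v2 P PD PM Pa P2 Pm z wz.
  have P_base x : Fin 0 <= w x -> P (A x).
    apply: (gen v2 (fun x => P (A x))) => {x} [x y Px Py|x y Px Py|a va|y wy|y wy].
    + by rewrite rmorphD; apply: PD.
    + by rewrite rmorphM; apply: PM.
    + by rewrite -in_alg_tower; apply: Pa.
    + by rewrite rmorphXn; apply: P2; rewrite quadratic_extends.
    + by apply: Pm; rewrite quadratic_extends.
  (* The equation of [t], with [b = 1], writes [t] as [- t ^+ 2 - c]: a square times a constant,
     plus an element of the base. *)
  have Pt : P t.
    case: bc => [[_ [b1 wc]]|[v2' _]]; last by rewrite v2' ltxx in v2.
    have -> : t = A (-1) * t ^+ 2 + A (- c).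
      rewrite !rmorphN rmorph1 mulN1r.
      by apply: subr0_eq; rewrite -[RHS]t_root b1 rmorph1; ring.
    apply: PD; last by apply: P_base; rewrite valuationN.
    apply: PM; first by apply: P_base; rewrite valuationN valuation1.
    by apply: P2; apply: root_ge.
  rewrite [z]tower_eta; apply: PD; first by apply: P_base; apply: le_trans (fst_ge z).
  by apply: PM => //; apply: P_base; apply: le_trans (snd_ge z v2).
Qed.

End Irreducible.

Lemma quadratic_step : exists (M' : fieldExtType F) (w' : valuation M' G)
    (h : {rmorphism M -> M'}) (t : M'),
  [/\ good_extension v w', forall a : F, h a%:A = a%:A, extends h w w'
    & t ^+ 2 + h b * t + h c = 0].
Proof.
have [[x x_root]|no_root] := pselect (exists x : M, x ^+ 2 + b * x + c = 0).
  by exists M, w, idfun, x.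
have noroot x : x ^+ 2 + b * x + c != 0.
  by apply/eqP => E; apply: no_root; exists x.
pose p : {poly M} := 'X^2 + (b%:P * 'X + c%:P).
have size_p : size p = 3%N.
  rewrite size_polyDl size_polyXn // size_MXaddC.
  by case: ifP => // _; rewrite ltnS size_polyC; case: (b == 0).
have irr_p : irreducible_poly p.
  apply: cubic_irreducible; rewrite ?size_p // => x.
  have := noroot x; rewrite rootE /p !hornerE ?addrA; exact.
have [N dimN [t t_root t_gen]] := irredp_FAdjoin irr_p.
have tE : t ^+ 2 + in_alg N b * t + in_alg N c = 0.
  move/rootP: t_root; rewrite !rmorphD !rmorphM /= map_polyX !map_polyC.
  by rewrite !hornerE ?addrA -?expr2.
pose N0 : fieldExtType F := baseFieldType N.
have [w' vw' _] := hen (@fieldExt_algebraic F N0).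
have dimN2 : \dim {:N} = 2%N by rewrite dimN size_p.
exists N0, w', (in_alg N), t; split=> //.
- exact: (quadratic_good tE noroot t_gen dimN2 vw').
- exact: (quadratic_extends vw').
Qed.

End QuadraticStep.

Lemma trivial_good (G : orderedGroupType) (F : fieldType) (v : valuation F G) :
  exists w : valuation (F^o : fieldExtType F) G, good_extension v w.
Proof.
exists (valuation_pullback (idfun : {rmorphism F^o -> F}) v).
have algE (a : F) : (a%:A : F^o) = a by exact: mulr1.
split.
- by move=> a; rewrite /= algE.
- by exists id; split.
- by exists 0%N; rewrite expn0 dimvf.
- by move=> _ x _; exists x.
- by move=> _ P _ _ Pa _ _ x vx; have := Pa x vx; rewrite algE.
Qed.

(** * From tame norms to hyperbolicity *)

Lemma base_change_map (F M M' : fieldType) (iota : {rmorphism F -> M})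
    (iota' : {rmorphism F -> M'}) (h : {rmorphism M -> M'}) (V : vectType F)
    (q : V -> F) z : (forall a, h (iota a) = iota' a) ->
  base_change iota' q (map_mx h z) = h (base_change iota q z).
Proof.
move=> hE; rewrite /base_change rmorphD !rmorph_sum; congr (_ + _).
  by apply: eq_bigr => i _; rewrite mxE rmorphM rmorphXn hE.
apply: eq_bigr => i _; rewrite rmorph_sum; apply: eq_bigr => j _.
by rewrite !mxE !rmorphM hE.
Qed.

(** * Chains of hyperbolic planes *)

Section Chains.
Variables (F : fieldType) (V : vectType F) (q : V -> F).
Hypothesis hq : quadratic_form q.

Fixpoint orth_chain (l : seq (V * V)) : V -> Prop :=
  if l is p :: l' then orth_pair q p.1 p.2 (orth_chain l') else fun=> True.

Fixpoint hyperbolic_chain (l : seq (V * V)) : Prop :=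
  if l is p :: l' then
    [/\ [/\ q p.1 = 0, q p.2 = 0 & polar q p.1 p.2 = 1],
        orth_chain l' p.1, orth_chain l' p.2 & hyperbolic_chain l']
  else True.

Lemma orth_chain_linear l : linear_pred (orth_chain l).
Proof. by elim: l => //= p l IH; apply: (linear_pred_pair hq). Qed.

Lemma orth_chain_vector l (xs : seq V) : (size l + size l + size xs < \dim {:V})%N ->
  exists2 z, z != 0 & orth_chain l z /\ forall x, x \in xs -> polar q z x = 0.
Proof.
move=> lt_n; pose ys := [seq p.1 | p <- l] ++ [seq p.2 | p <- l] ++ xs.
have [|z z0 zys] := @orthogonal_vector F V q (size ys) (fun i => ys`_i) hq.
  by rewrite !size_cat !size_map addnA.
have z_orth x : x \in ys -> polar q z x = 0.
  move=> xys; have := zys (Ordinal (etrans (index_mem x ys) xys)).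
  by rewrite /= nth_index.
exists z => //; split; last first.
  by move=> x xxs; apply: z_orth; rewrite !mem_cat xxs !orbT.
have : forall p, p \in l -> polar q z p.1 = 0 /\ polar q z p.2 = 0.
  by move=> p pl; split; apply: z_orth; rewrite !mem_cat map_f ?orbT.
elim: (l) => //= p l' IH zl; split.
- by apply: IH => p' p'l; apply: zl; rewrite inE p'l orbT.
- by case: (zl p (mem_head _ _)).
- by case: (zl p (mem_head _ _)).
Qed.

Lemma orth_chain_nth l x i : orth_chain l x -> (i < size l)%N ->
  polar q x (nth (0, 0) l i).1 = 0 /\ polar q x (nth (0, 0) l i).2 = 0.
Proof.
elim: l i => //= p l IH [|i] [xl x1 x2] //= i_lt.
exact: IH.
Qed.

Lemma hyperbolic_chain_nth l i j : hyperbolic_chain l ->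
  (i < size l)%N -> (j < size l)%N ->
  let u k := (nth (0, 0) l k).1 in let y k := (nth (0, 0) l k).2 in
  [/\ q (u i) = 0, q (y i) = 0, polar q (u i) (u j) = 0,
      polar q (y i) (y j) = 0 & polar q (u i) (y j) = (i == j)%:R].
Proof.
elim: l i j => //= p l IH [|i] [|j] [[q1 q2 p12] o1 o2 hl] //= i_lt j_lt.
- by rewrite q1 q2 p12 !(polarxx hq) q1 q2 !mulr0.
- have [-> ->] := orth_chain_nth o1 j_lt; have [_ ->] := orth_chain_nth o2 j_lt.
  by split.
- have [q1' q2' _ _ _] := IH i i hl i_lt i_lt.
  have [a1 b1] := orth_chain_nth o1 i_lt; have [a2 b2] := orth_chain_nth o2 i_lt.
  by split=> //; rewrite polarC.
- exact: IH.
Qed.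

Lemma qform_sum0 (I : Type) (r : seq I) (x : I -> V) :
  (forall i, q (x i) = 0) -> (forall i j, polar q (x i) (x j) = 0) ->
  q (\sum_(i <- r) x i) = 0.
Proof.
move=> q0 b0; elim: r => [|i r IH]; first by rewrite big_nil (qform0 hq).
by rewrite big_cons qformD q0 IH (polar_sumr hq) big1 ?addr0.
Qed.

Lemma hyperbolic_of_chain l : hyperbolic_chain l ->
  (size l + size l)%N = \dim {:V} -> hyperbolic q.
Proof.
move=> hl dimV; pose m := size l.
pose u (i : 'I_m) := (nth (0, 0) l i).1; pose y (i : 'I_m) := (nth (0, 0) l i).2.
have uy i j : [/\ q (u i) = 0, q (y i) = 0, polar q (u i) (u j) = 0,
    polar q (y i) (y j) = 0 & polar q (u i) (y j) = (i == j)%:R].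
  exact: hyperbolic_chain_nth hl (ltn_ord i) (ltn_ord j).
pose f (x : 'rV[F]_m * 'rV[F]_m) : V :=
  \sum_i x.1 0 i *: u i + \sum_i x.2 0 i *: y i.
have f_lin : linear f.
  move=> a [x x'] [z z']; rewrite /f /= scalerDr addrACA.
  by congr (_ + _); rewrite scaler_sumr -big_split; apply: eq_bigr => i _ /=;
    rewrite !mxE scalerA scalerDl.
pose fM := GRing.isLinear.Build _ _ _ _ f f_lin.
pose fL : {linear ('rV[F]_m * 'rV[F]_m)%type -> V} := HB.pack f fM.
have sum_d (c : 'I_m -> F) i : \sum_k c k * (k == i)%:R = c i.
  rewrite (bigD1 i) //= eqxx mulr1 big1 ?addr0 // => k /negPf ->.
  by rewrite mulr0.
have pol_u x i : polar q (f x) (y i) = x.1 0 i.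
  rewrite (polarDl hq) !(polar_sumZl hq) [X in _ + X]big1 => [|k _].
    rewrite addr0 -[RHS]sum_d; apply: eq_bigr => k _.
    by have [_ _ _ _ ->] := uy k i.
  by have [_ _ _ -> _] := uy k i; rewrite mulr0.
have pol_y x i : polar q (f x) (u i) = x.2 0 i.
  rewrite (polarDl hq) !(polar_sumZl hq) [X in X + _]big1 => [|k _].
    rewrite add0r -[RHS]sum_d; apply: eq_bigr => k _.
    by have [_ _ _ _ E] := uy i k; rewrite polarC E eq_sym.
  by have [_ _ -> _ _] := uy k i; rewrite mulr0.
exists m, fL; split; last first.
  move=> x x'; rewrite /fL /= /f /= qformD.
  rewrite qform_sum0 => [|i|i j]; last 2 first.
  - by rewrite (qformZ hq); have [-> _ _ _ _] := uy i i; rewrite mulr0.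
  - by rewrite (polarZl hq) (polarZr hq); have [_ _ -> _ _] := uy i j; rewrite !mulr0.
  rewrite qform_sum0 => [|i|i j]; last 2 first.
  - by rewrite (qformZ hq); have [_ -> _ _ _] := uy i i; rewrite mulr0.
  - by rewrite (polarZl hq) (polarZr hq); have [_ _ _ -> _] := uy i j; rewrite !mulr0.
  rewrite !add0r (polar_sumZr hq); apply: eq_bigr => i _.
  rewrite (polar_sumZl hq) mulrC; congr (_ * _).
  rewrite -[RHS]sum_d; apply: eq_bigr => k _.
  by have [_ _ _ _ ->] := uy k i.
have f_inj : lker (linfun fL) == 0%VS.
  rewrite -subv0; apply/subvP => -[x x']; rewrite memv_ker lfunE /= => /eqP fx.
  rewrite memv0; apply/eqP; congr (_, _); apply/rowP => i; rewrite mxE.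
    by rewrite -(pol_u (x, x')) fx (polar0l hq).
  by rewrite -(pol_y (x, x')) fx (polar0l hq).
have f_full : limg (linfun fL) = fullv.
  apply/eqP; rewrite eqEdim subvf /= -dimV limg_dim_eq.
    by rewrite dimvf /dim /= /dim /= !mul1n.
  by rewrite (eqP f_inj) capv0.
exists ((linfun fL)^-1)%VF => x.
  by rewrite -[fL x](lfunE fL); apply: lker0_lfunK.
rewrite -(lfunE fL); apply: limg_lfunVK; by rewrite f_full memvf.
Qed.

End Chains.

Section SelfDualChain.
Variables (F : fieldType) (G : orderedGroupType) (v : valuation F G).
Variables (V : vectType F) (q : V -> F).
Hypothesis hq : quadratic_form q.
Variable beta : value_function v V.

(** The condition on each plane under which its orthogonal inherits self-duality. *)
Fixpoint normed_chain (l : seq (V * V)) : Prop :=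
  if l is p :: l' then Fin 0 <= beta p.1 + beta p.2 /\ normed_chain l' else True.

Lemma self_dual_chain l : norm_prec q beta -> self_dual_on q beta (fun=> True) ->
  hyperbolic_chain q l -> normed_chain l ->
  self_dual_on q beta (orth_chain q l).
Proof.
move=> prec sd; elim: l => //= p l IH [[q1 q2 p12] o1 o2 hl] [b12 nl].
exact: (self_dual_pair hq prec (@orth_chain_linear F V q hq l) (IH hl nl) o1 o2 q1 q2 p12 b12).
Qed.

Lemma chain_extend l u : norm_prec q beta -> self_dual_on q beta (fun=> True) ->
  hyperbolic_chain q l -> normed_chain l ->
  orth_chain q l u -> u != 0 -> q u = 0 ->
  exists p, hyperbolic_chain q (p :: l) /\ normed_chain (p :: l).
Proof.
move=> prec sd hl nl ou u0 qu.
have [y [oy qy uy uy_ge]] := isotropic_partner hq prec (@orth_chain_linear F V q hq l)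
  (self_dual_chain prec sd hl nl) ou u0 qu.
by exists (u, y); split=> //=; split.
Qed.

Lemma tame_family_full (e : 'I_(\dim {:V}) -> V) gam :
  tame_family v q e gam -> forall z, (forall i, polar q z (e i) = 0) -> z = 0.
Proof.
move=> tame_e z ze; have e_free := tame_family_free hq tame_e.
have e_basis : basis_of fullv [tuple e i | i < \dim {:V}].
  by rewrite basisEfree e_free subvf size_tuple /=.
have [_ _ [C BC _]] := tame_e.
have zE : z = \sum_i coord [tuple e i | i < \dim {:V}] i z *: e i.
  rewrite {1}(coord_basis e_basis (memvf z)); apply: eq_bigr => i _.
  by rewrite -tnth_nth tnth_mktuple.
rewrite zE big1 // => i _; suff -> : coord [tuple e i | i < \dim {:V}] i z = 0.
  exact: scale0r.
move: i; apply: (gram_free hq (c := fun i => coord _ i z) BC) => j.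
by rewrite -zE.
Qed.

End SelfDualChain.

Section Tower.
Variables (G : orderedGroupType) (F : fieldType) (v : valuation F G).
Hypothesis hen : henselian v.
Variables (V : vectType F) (q : V -> F).
Hypothesis hq : quadratic_form q.
Variables (e : 'I_(\dim {:V}) -> V) (gam : 'I_(\dim {:V}) -> G).
Hypothesis tame_e : tame_family v q e gam.

Local Notation n := (\dim {:V}).
Local Notation qE M := (base_change (in_alg M) q).
Local Notation emb M := (embed (in_alg M) (V := V)).

Section OneField.
Variables (M : fieldExtType F) (w : valuation M G).
Hypothesis vw : extends (GRing.in_alg M) v w.

Lemma qE_quadratic : quadratic_form (qE M).
Proof. exact: base_change_quadratic. Qed.

Lemma qE_tame : tame_family w (qE M) (fun i => emb M (e i)) gam.
Proof. exact: (embed_tame_family hq vw tame_e). Qed.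

Lemma qE_dim : \dim {:'rV[M]_n} = n.
Proof. by rewrite dimvf /dim /= mul1n. Qed.

Lemma qE_full z : (forall i, polar (qE M) z (emb M (e i)) = 0) -> z = 0.
Proof.
have tame_M := qE_tame; move: (qE_dim) => dimE ze.
have := @tame_family_full M G w 'rV[M]_n (qE M) qE_quadratic.
rewrite dimE => full; exact: (full _ _ tame_M).
Qed.

Definition norm_over := dual_norm w qE_quadratic gam qE_full.

Lemma norm_over_prec : norm_prec (qE M) norm_over.
Proof. exact: (dual_norm_prec qE_quadratic qE_tame qE_full). Qed.

Lemma norm_over_self_dual : self_dual_on (qE M) norm_over (fun=> True).
Proof. exact: (dual_norm_self_dual qE_quadratic qE_tame qE_full). Qed.

End OneField.

Section Transfer.
Variables (M M' : fieldExtType F) (w : valuation M G) (w' : valuation M' G).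
Hypotheses (vw : extends (GRing.in_alg M) v w) (vw' : extends (GRing.in_alg M') v w').
Variable h : {rmorphism M -> M'}.
Hypotheses (hF : forall a : F, h a%:A = a%:A) (hw : extends h w w').

Lemma qE_map z : qE M' (map_mx h z) = h (qE M z).
Proof. exact: base_change_map. Qed.

Lemma qE_polar_map z t : polar (qE M') (map_mx h z) (map_mx h t) = h (polar (qE M) z t).
Proof. by rewrite /polar -map_mxD !qE_map !rmorphB. Qed.

Lemma emb_map x : map_mx h (emb M x) = emb M' x.
Proof. by apply/rowP => i; rewrite !mxE /= hF. Qed.

(** Both norms are minima over the same vectors of [V] with the same [gam], so the planes already
    split off keep their bounds in the larger field. *)
Lemma norm_over_map z : norm_over vw' (map_mx h z) = norm_over vw z.
Proof. by apply: eq_bigr => i _; rewrite -emb_map qE_polar_map hw. Qed.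

Let hh (p : 'rV[M]_n * 'rV[M]_n) := (map_mx h p.1, map_mx h p.2).

Lemma orth_chain_map l z :
  orth_chain (qE M) l z -> orth_chain (qE M') [seq hh p | p <- l] (map_mx h z).
Proof.
elim: l => //= p l IH [o1 z1 z2]; split; first exact: IH.
  by rewrite qE_polar_map z1 rmorph0.
by rewrite qE_polar_map z2 rmorph0.
Qed.

Lemma hyperbolic_chain_map l :
  hyperbolic_chain (qE M) l -> hyperbolic_chain (qE M') [seq hh p | p <- l].
Proof.
elim: l => //= p l IH [[q1 q2 p12] o1 o2 hl]; split; last exact: IH.
- by rewrite !qE_map qE_polar_map q1 q2 p12 rmorph0 rmorph1.
- exact: orth_chain_map.
- exact: orth_chain_map.
Qed.

Lemma normed_chain_map l :
  normed_chain (norm_over vw) l -> normed_chain (norm_over vw') [seq hh p | p <- l].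
Proof.
elim: l => // p l IH [b12 nl]; split; last exact: IH.
by move: b12; rewrite -(norm_over_map p.1) -(norm_over_map p.2).
Qed.

End Transfer.

Definition chain_over (M : fieldExtType F) (m : nat) :=
  exists (w : valuation M G) (vw : extends (GRing.in_alg M) v w)
    (l : seq ('rV[M]_n * 'rV[M]_n)),
  [/\ good_extension v w, size l = m, hyperbolic_chain (qE M) l
    & normed_chain (norm_over vw) l].

(** Either an isotropic vector is already at hand, or it is a combination of two anisotropic vectors
    of the orthogonal whose coefficients solve one admissible quadratic equation. *)
Lemma isotropic_vector (M : fieldExtType F) (w : valuation M G)
    (vw : extends (GRing.in_alg M) v w) (l : seq ('rV[M]_n * 'rV[M]_n)) :
  good_extension v w -> hyperbolic_chain (qE M) l ->
  normed_chain (norm_over vw) l -> ((size l + size l).+1 < n)%N ->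
  exists (M' : fieldExtType F) (w' : valuation M' G) (h : {rmorphism M -> M'})
    (u : 'rV[M']_n),
  [/\ good_extension v w', forall a : F, h a%:A = a%:A, extends h w w',
      u != 0 & qE M' u = 0 /\
      orth_chain (qE M') [seq (map_mx h p.1, map_mx h p.2) | p <- l] u].
Proof.
move=> good hl nl lt_n; pose qM := qE M.
have hqM : quadratic_form qM := qE_quadratic M.
have here u : orth_chain qM l u -> u != 0 -> qM u = 0 ->
  exists (M' : fieldExtType F) (w' : valuation M' G) (h : {rmorphism M -> M'})
    (u : 'rV[M']_n),
  [/\ good_extension v w', forall a : F, h a%:A = a%:A, extends h w w',
      u != 0 & qE M' u = 0 /\
      orth_chain (qE M') [seq (map_mx h p.1, map_mx h p.2) | p <- l] u].
  move=> ou u0 qu; exists M, w, idfun, u; split=> //; split=> //.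
  rewrite (_ : map _ l = l) // -[RHS]map_id; apply: eq_map => -[x y] /=.
  by rewrite !map_mx_id.
have lt0 : (size l + size l + size ([::] : seq 'rV[M]_n) < \dim {:'rV[M]_n})%N.
  by rewrite qE_dim addn0 ltnW.
have [z z0 [oz _]] := orth_chain_vector hqM lt0.
have [qz0|qz0] := eqVneq (qM z) 0; first exact: here z oz z0 qz0.
have [v2|v2] := boolP (Fin 0 < v 2%:R).
- have sd := self_dual_chain hqM (norm_over_prec vw) (norm_over_self_dual vw) hl nl.
  have [t [ot b0 vb]] := sd z oz z0; set b := polar qM z t in b0 vb.
  have t0 : t != 0 by apply: contraNneq b0 => t0; rewrite /b t0 (polar0r hqM).
  have [qt0|qt0] := eqVneq (qM t) 0; first exact: here t ot t0 qt0.
  (* With this [c], the value of [q] at [q t *: z + (s * b) *: t] is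
     [q t * b ^+ 2 * (s ^+ 2 + s + c)]. Self-duality bounds [v b] by the norms of [z] and [t], which
     makes [c] integral. *)
  pose c := qM z * qM t / b ^+ 2.
  have wc : Fin 0 <= w c.
    have [g gE] := val_fin w b0; have b2 : w (b ^+ 2) = Fin (g + g) by rewrite valX2 gE.
    rewrite /c valuationM (valV b2) lee_FinBr add0r -b2 valX2 valuationM.
    apply: le_trans (leeD vb vb) _; rewrite addrACA.
    by apply: leeD; apply: (qform_ge (norm_over_prec vw)).
  have [M' [w' [h [s [good' hF hw sE]]]]] :=
    quadratic_step hen good (b := 1) (c := c) (or_introl (conj v2 (conj erefl wc))).
  exists M', w', h; pose qM' := qE M'.
  have hqM' : quadratic_form qM' := qE_quadratic M'.
  have lin' := @orth_chain_linear M' _ qM' hqM' [seq (map_mx h p.1, map_mx h p.2) | p <- l].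
  pose Z := map_mx h z; pose T := map_mx h t.
  have ZT : polar qM' Z T = h b by exact: qE_polar_map.
  have qZ : qM' Z = h (qM z) by exact: qE_map.
  have qT : qM' T = h (qM t) by exact: qE_map.
  have hcE : h (qM z) * h (qM t) = h c * h b ^+ 2.
    by rewrite -rmorphXn -!rmorphM /c mulfVK // expf_neq0.
  (* If [s] had negative value, then [s ^+ 2 = - (s + h c)] would have value at least that of [s],
     while doubling a negative value lowers it. *)
  have s_ge : Fin 0 <= w' s.
    rewrite leNgt; apply/negP => s_lt.
    have s2 : s ^+ 2 = - (s + h c) by apply: subr0_eq; rewrite -[RHS]sE rmorph1; ring.
    have [|g gE] := @neq_infty _ (w' s).
      by apply: contraTneq s_lt => ->; rewrite -leNgt lee_infty.
    have : w' s <= w' (s ^+ 2).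
      rewrite s2 valuationN; apply: (filtD_ge (f := w')) => //=.
      by rewrite hw ltW // (lt_le_trans s_lt).
    rewrite valX2 gE -{1}[Fin g]addr0 leD2l_Fin => g0.
    by move: s_lt; rewrite gE ltNge g0.
  exists (h (qM t) *: Z + (s * h b) *: T); split=> //; last first.
    split.
      change (qM' (h (qM t) *: Z + (s * h b) *: T) = 0).
      rewrite qformD (polarZl hqM') (polarZr hqM') !(qformZ hqM') ZT qZ qT.
      transitivity (h (qM t) * (h (qM z) * h (qM t) + h b ^+ 2 * (s ^+ 2 + s))).
        by ring.
      transitivity (h (qM t) * (h b ^+ 2 * (s ^+ 2 + s + h c))).
        by rewrite hcE; ring.
      have -> : s ^+ 2 + s + h c = 0 by rewrite -[RHS]sE rmorph1 mul1r.
      by rewrite !mulr0.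
    have oZ := linear_predZ (h (qM t)) lin' (orth_chain_map hF oz).
    have oT := linear_predZ (s * h b) lin' (orth_chain_map hF ot).
    by have := lin' 1 _ _ oZ oT; rewrite scale1r.
  (* The new vector is nonzero because it pairs nontrivially with [T]: [1 + s * 2%:R] is a unit, as
     [s] is integral and [2%:R] has positive value. *)
  have uT : polar qM' (h (qM t) *: Z + (s * h b) *: T) T
      = h (qM t) * h b * (1 + s * 2%:R).
    by rewrite (polarDl hqM') !(polarZl hqM') ZT (polarxx hqM') qT; ring.
  have w1s : w' (1 + s * 2%:R) = 0.
    rewrite val_dom valuation1 // valuationM.
    rewrite -[X in X < _](addr0 (Fin 0)); apply: lteD_Fin s_ge _.
    have -> : 2%:R = h (2%:R%:A) by rewrite hF scaler_nat.
    by rewrite hF (good_extends good').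
  apply/eqP => u0; move: uT; rewrite u0 (polar0l hqM') => /esym/eqP.
  rewrite !mulf_eq0 !fmorph_eq0 (negPf qt0) (negPf b0) /= => /eqP E.
  by move: w1s; rewrite E valuation0.
have v2E : v 2%:R = Fin 0 by apply/le_anti; rewrite leNgt v2 val_nat_ge0.
(* Room for a second vector orthogonal to [z]: on an orthogonal pair a root of
   [s ^+ 2 = - (q z / q z')] makes [s *: z' + z] isotropic. *)
have lt1 : (size l + size l + size [:: z] < \dim {:'rV[M]_n})%N.
  by rewrite qE_dim addn1.
have [z' z'0 [oz' zz']] := orth_chain_vector hqM lt1.
have {}zz' : polar qM z' z = 0 by apply: zz'; rewrite mem_head.
have [qz'0|qz'0] := eqVneq (qM z') 0; first exact: here z' oz' z'0 qz'0.
pose c := qM z / qM z'.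
have [M' [w' [h [s [good' hF hw sE]]]]] :=
  quadratic_step hen good (b := 0) (c := c) (or_intror (conj v2E erefl)).
exists M', w', h; pose qM' := qE M'.
have hqM' : quadratic_form qM' := qE_quadratic M'.
have lin' := @orth_chain_linear M' _ qM' hqM' [seq (map_mx h p.1, map_mx h p.2) | p <- l].
pose Z := map_mx h z; pose T := map_mx h z'.
have TZ : polar qM' T Z = 0 by rewrite qE_polar_map // zz' rmorph0.
have qZ : qM' Z = h (qM z) by exact: qE_map.
have qT : qM' T = h (qM z') by exact: qE_map.
exists (s *: T + Z); split=> //; last first.
  split; last exact: lin' (orth_chain_map hF oz') (orth_chain_map hF oz).
  change (qM' (s *: T + Z) = 0); rewrite qformD (polarZl hqM') TZ mulr0 addr0 (qformZ hqM') qZ qT.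
  have -> : h (qM z) = h c * h (qM z') by rewrite -rmorphM /c divfK.
  rewrite -mulrDl; have -> : s ^+ 2 + h c = 0 by rewrite -[RHS]sE rmorph0 mul0r addr0.
  by rewrite mul0r.
(* Nonvanishing again comes from a pairing, here with [Z], since 2 is a unit and [q z] is
   nonzero. *)
have uZ : polar qM' (s *: T + Z) Z = 2%:R * h (qM z).
  by rewrite (polarDl hqM') (polarZl hqM') TZ (polarxx hqM') qZ mulr0 add0r.
apply/eqP => u0; move: uZ; rewrite u0 (polar0l hqM') => /esym/eqP.
rewrite mulf_eq0 fmorph_eq0 (negPf qz0) orbF => /eqP two0.
have : w' 2%:R = Fin 0.
  have -> : 2%:R = h (2%:R%:A) by rewrite hF scaler_nat.
  by rewrite hF (good_extends good').
by rewrite two0 valuation0.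
Qed.

Lemma chain_over_all m : ~~ odd n -> (m + m <= n)%N ->
  exists M : fieldExtType F, chain_over M m.
Proof.
move=> even_n; elim: m => [|m IH] le_n.
  have [w good] := trivial_good v.
  by exists (F^o : fieldExtType F), w, (good_extends good), [::].
have [|M [w [vw [l [good sl hl nl]]]]] := IH.
  by apply: leq_trans le_n; rewrite addSnnS addnS -addSnnS leqW // leqW.
have lt_n : ((size l + size l).+1 < n)%N by move: le_n; rewrite sl addSn addnS.
have [M' [w' [h [u [good' hF hw u0 [qu ou]]]]]] :=
  isotropic_vector good hl nl lt_n.
have vw' := good_extends good'.
have hl' := hyperbolic_chain_map hF hl.
have nl' := normed_chain_map (vw := vw) vw' hF hw nl.
have [p [hpl npl]] := chain_extend (qE_quadratic M') (norm_over_prec vw')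
  (norm_over_self_dual vw') hl' nl' ou u0 qu.
exists M', w', vw', (p :: [seq (map_mx h p.1, map_mx h p.2) | p <- l]).
by split=> //=; rewrite size_map sl.
Qed.

Theorem hyperbolic_of_tame_family : ~~ odd n ->
  exists (K : fieldType) (iota : {rmorphism F -> K}),
    tame_extension v iota /\ hyperbolic (base_change iota q).
Proof.
move=> even_n; have nE : (n./2 + n./2)%N = n.
  by rewrite addnn -{2}(odd_double_half n) (negPf even_n).
have [M [w [vw [l [good sl hl _]]]]] := chain_over_all even_n (eq_leq nE).
exists M, (in_alg M); split; first exact: good_extension_tame good.
apply: (hyperbolic_of_chain (qE_quadratic M) hl).
by rewrite sl nE qE_dim.
Qed.

End Tower.

Theorem theorem18 (G : orderedGroupType) (F : fieldType) (v : valuation F G)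
    (V : vectType F) (q : V -> F) :
  divisible G ->
  henselian v ->
  quadratic_form q ->
  ~~ odd (\dim {:V}) ->
  nondegenerate_pairing (polar q) ->
  (exists (K : fieldType) (iota : {rmorphism F -> K}),
     tame_extension v iota /\ hyperbolic (base_change iota q))
  <->
  (exists alpha : value_function v V, tame_compatible_norm q alpha).
Proof.
move=> dG hen hq even_n nd; split=> [[K [iota [tame hyp]]]|[alpha [norm prec gr_nd]]].
  exact: (tame_norm_of_hyperbolic dG hen hq nd tame hyp).
have sd := gr_self_dual hq prec gr_nd.
have [e [gam tame_e]] := tame_family_of_norm hq prec nd sd norm.
exact: (hyperbolic_of_tame_family hen hq tame_e even_n).
Qed.
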